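(* For every $d\in\mathbb{N}$ consider the random walk $S_k^{(d)}:=X_1^{(d)}+\dots+X_k^{(d)}$ in $\mathbb{R}^d$ with increments $X_i^{(d)}:=R_iU_i^{(d)}$, $i\in\mathbb{N}$, where $(R_i)_{i=1}^\infty$ are independent copies of a non-negative random variable $R$ (whose distribution does not depend on $d$) with $\mathbb{E}R^2=1$; $(U_i^{(d)})_{i=1}^\infty$ are i.i.d. random vectors uniformly distributed on the unit sphere in $\mathbb{R}^d$; and $(R_i)_{i=1}^\infty$ and $(U_i^{(d)})_{i=1}^\infty$ are independent. Suppose that for some $\alpha\in(1,2)$ $$\frac{R_1^2+\dots+R_m^2-m}{m^{1/\alpha}L(m)}\ \overset{w}{\longrightarrow}\ \zeta_\alpha\qquad(m\to\infty)$$ for some slowly varying function $L$ and a zero-mean random variable $\zeta_\alpha$ having a spectrally positive $\alpha$-stable distribution. Let $n=n(d)$ be a sequence of positive integers with $n(d)\to\infty$ as $d\to\infty$. (a) If $n>d^{\frac{\alpha}{2\alpha-2}+\delta}$ for some $\delta>0$ and all sufficiently large $d$, then, as $d\to\infty$, $$\frac{\|S_n^{(d)}\|^2-n}{\sqrt{2n^2/d}}\ \overset{w}{\longrightarrow}\ \mathrm{N}(0,1).$$ (b) If $n<d^{\frac{\alpha}{2\alpha-2}-\delta}$ for some $\delta>0$ and all sufficiently large $d$, then, as $d\to\infty$, $$\frac{\|S_n^{(d)}\|^2-n}{n^{1/\alpha}L(n)}\ \overset{w}{\longrightarrow}\ \zeta_\alpha.$$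
   Context: $\|\cdot\|$ is the Euclidean norm, $\overset{w}{\longrightarrow}$ denotes convergence in distribution, and $\mathrm{N}(0,1)$ is the standard normal distribution. Slowly varying means (positive and) slowly varying at infinity in Karamata's sense: $L(cx)/L(x)\to1$ as $x\to\infty$ for every $c>0$. Spectrally positive means that the (non-degenerate) stable law has no negative jumps, i.e. its Lévy measure is concentrated on $(0,\infty)$. *)

(* Defs.v *)
From HB Require Import structures.
From mathcomp Require Import all_boot all_order all_algebra.
From mathcomp Require Import all_classical all_reals all_analysis.

Set Implicit Arguments.
Unset Strict Implicit.
Unset Printing Implicit Defensive.

Import Order.TTheory GRing.Theory Num.Theory.
Import numFieldNormedType.Exports.

Local Open Scope classical_set_scope.
Local Open Scope ring_scope.

(* R^k with its Borel sigma-algebra; convertible to 'rV[R]_k. *)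
Notation borel_rV R k := (g_sigma_algebraType (@open 'rV[R]_k)).

(* The norm `|x| that the library puts on 'rV[R]_k is the sup norm. *)
Definition enorm (R : realType) (k : nat) (x : 'rV[R]_k) : R :=
  Num.sqrt (\sum_(j < k) x ord0 j ^+ 2).

(* The uniform distribution on the unit sphere is the unique probability
   measure carried by the sphere and invariant under O(k).  Invariance is
   under O(k), not SO(k), so that k = 1 gives the symmetric law on {-1, 1}. *)
Definition uniform_on_sphere (R : realType) (k : nat)
    (mu : probability (borel_rV R k) R) : Prop :=
  mu [set x | enorm x = 1] = 1%E /\
  forall Q : 'M[R]_k, Q *m Q^T = 1%:M ->
    forall A : set (borel_rV R k), measurable A ->
      mu [set x : 'rV[R]_k | A (x *m Q)] = mu A.

Definition independent_RVs (d d' : measure_display) (T : measurableType d)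
    (T' : measurableType d') (R : realType) (P : probability T R)
    (I : eqType) (X : I -> {RV P >-> T'}) : Prop :=
  forall (s : seq I) (A : I -> set T'),
    uniq s -> (forall i, measurable (A i)) ->
    P [set w | forall i, i \in s -> A i (X i w)] =
    (\prod_(i <- s) P (X i @^-1` A i))%E.
Arguments independent_RVs {d d' T T' R} P {I} X.

(* The sigma-algebra generated by a whole family of random elements. *)
Definition sigma_gen (d d' : measure_display) (T : measurableType d)
    (T' : measurableType d') (I : Type) (X : I -> T -> T') : set (set T) :=
  <<s \bigcup_i preimage_set_system setT (X i) measurable >>.

Definition independent_families (d d1 d2 : measure_display)
    (T : measurableType d) (T1 : measurableType d1) (T2 : measurableType d2)
    (R : realType) (P : probability T R) (I J : Type)
    (X : I -> {RV P >-> T1}) (Y : J -> {RV P >-> T2}) : Prop :=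
  forall A B : set T, sigma_gen X A -> sigma_gen Y B ->
    P (A `&` B) = (P A * P B)%E.
Arguments independent_families {d d1 d2 T T1 T2 R} P {I J} X Y.

(* X n converges in distribution to Z (n -> oo); X n lives on the space of P, Z
   on the space of Q.  The X n and Z are unbundled functions, meant to be
   measurable. *)
Definition cvg_in_distribution (dT dZ : measure_display)
    (T : measurableType dT) (TZ : measurableType dZ) (R : realType)
    (P : probability T R) (X : nat -> T -> R)
    (Q : probability TZ R) (Z : TZ -> R) : Prop :=
  forall f : R -> R, continuous f -> (exists M : R, forall x, `|f x| <= M) ->
    ('E_P[f \o X n])%E @[n --> \oo] --> ('E_Q[f \o Z])%E.
Arguments cvg_in_distribution {dT dZ T TZ R} P X Q Z.

Definition slowly_varying (R : realType) (L : R -> R) : Prop :=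
  (\forall x \near +oo, 0 < L x) /\
  forall c : R, 0 < c -> L (c * x) / L x @[x --> +oo] --> (1 : R).

Definition nondegenerate (R : realType)
    (mu : probability R R) : Prop :=
  forall c : R, mu [set c] <> 1%E.

(* For independent X1, X2 with law mu and A, B > 0, the variable A X1 + B X2
   has the law of C X1 + D for some real D, where C^a = A^a + B^a. *)
Definition alpha_stable (R : realType) (alpha : R)
    (mu : probability R R) : Prop :=
  nondegenerate mu /\
  forall A B : R, 0 < A -> 0 < B -> exists D : R,
    forall V : set R, measurable V ->
      (mu \x mu)%E [set p | V (A * p.1 + B * p.2)] =
      mu [set x | V ((A `^ alpha + B `^ alpha) `^ alpha^-1 * x + D)].

Definition is_levy_measure (R : realType)
    (nu : {measure set R -> \bar R}) : Prop :=
  nu [set 0] = 0%E /\ (\int[nu]_x (Num.min 1 (x ^+ 2))%:E < +oo)%E.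

(* Levy-Khintchine: the characteristic function of mu is exp(psi), where
     psi(t) = i b t - s^2 t^2 / 2
              + \int (exp(i t x) - 1 - i t x 1_{|x| <= 1}) nu(dx),
   written out with Re psi, Im psi and the real and imaginary parts of exp. *)
Definition levy_measure_of (R : realType)
    (mu : probability R R)
    (nu : {measure set R -> \bar R}) : Prop :=
  is_levy_measure nu /\
  exists b s : R, forall t : R,
    let re_psi := - (s ^+ 2 * t ^+ 2 / 2) +
      \int[nu]_x (cos (t * x) - 1) in
    let im_psi := b * t +
      \int[nu]_x (sin (t * x) - t * x * \1_[set y : R | `|y| <= 1] x) in
    \int[mu]_x cos (t * x) = expR re_psi * cos im_psi /\
    \int[mu]_x sin (t * x) = expR re_psi * sin im_psi.

Definition spectrally_positive (R : realType)
    (mu : probability R R) : Prop :=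
  exists nu : {measure set R -> \bar R},
    levy_measure_of mu nu /\ nu [set x : R | x <= 0] = 0%E.

(* The walk S_m with increments r_i u_i, the index i running over 0, ..., m-1. *)
Definition walk (R : realType) (T : Type) (k : nat) (r : nat -> T -> R)
    (u : nat -> T -> 'rV[R]_k) (m : nat) (w : T) : 'rV[R]_k :=
  \sum_(i < m) r i w *: u i w.

(* Main.v *)
(* Almost surely |S_n|^2 = Q_n + T_n with Q_n = R_1^2 + ... + R_n^2 and T_n the sum over k < n of
   the increments D_k = 2 R_k <S_k, U_k>.

   The cross term T_n / sqrt (2 n^2 / d) is asymptotically N(0,1) as soon as n and d tend to
   infinity.  Given S_k and R_k, the increment D_k is symmetric with second moment
   4 R_k^2 |S_k|^2 / d, and |S_k|^2 is close to k in mean; truncating the radii at a level M to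
   control the fourth moment of D_k, one gets for a_k = E cos (tau T_k + theta), where
   tau^2 = t^2 d / (2 n^2), the recursion a_(k+1) = (1 - t^2 k / n^2) a_k + error, hence
   a_n -> exp (- t^2 / 2) cos theta.

   The sum Q_n - n lives on the scale s_n = n^(1/alpha) L(n) = n^(1/alpha + o(1)), which balances
   n / sqrt d exactly when n is about d^(alpha / (2 alpha - 2)); each part is then Slutsky's lemma.
   Power bounds for s_n do not need Karamata's representation theorem: the limit law is centered
   and not degenerate, hence charges both half-lines, which gives s_m <= C s_n for m <= n, and
   s_(2m) / s_m -> 2^(1/alpha). *)
Require Import Defs.
From HB Require Import structures.
From mathcomp Require Import all_boot all_order all_algebra.
From mathcomp Require Import all_classical all_reals all_analysis.
From mathcomp Require Import measurable_realfun ring lra.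

Set Implicit Arguments.
Unset Strict Implicit.
Unset Printing Implicit Defensive.

Import Order.TTheory GRing.Theory Num.Theory.
Import numFieldNormedType.Exports.

Local Open Scope classical_set_scope.
Local Open Scope ring_scope.

(** * Approximation by trigonometric polynomials *)

(** Attraction to a stable law of index alpha < 2 leaves [R] without a fourth moment, so neither Q_n
    nor D_k has a usable variance or fourth moment, and all estimates must live on E R^2 = 1. The
    loss from truncation is E (R^2; R > M), which vanishes as M grows but at no known rate: M is
    therefore fixed before d and n go to infinity.

    The D_k are dependent, and conditioning on the past takes the form of Tonelli's theorem: the
    past is a smaller sigma-algebra on the same space, and U_k is integrated out under its own law
    with the past frozen. Symmetry of that law turns the cosine of a sum into a product of cosines,
    so that only even moments of D_k enter.

    The phase theta packs the real and imaginary parts of a characteristic function into one real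
    sequence. Tightness comes from second moments; given it, passing from cosines to bounded
    continuous functions is an approximation on a compact interval, provided that the approximant
    stays bounded on the whole line. *)

Section trigonometric_polynomials.
Context {R : realType}.
Implicit Types (f p : R -> R) (x t K M e : R).

(** The phase [a] makes sines available, so a single kind of generator covers both parts of a
    characteristic function. *)
Inductive trigpoly : (R -> R) -> Prop :=
| trigpoly_cos t a : trigpoly (fun x => cos (t * x + a))
| trigpoly_scale c p : trigpoly p -> trigpoly (fun x => c * p x)
| trigpoly_add p q : trigpoly p -> trigpoly q -> trigpoly (fun x => p x + q x).

Lemma trigpoly_cst c : trigpoly (fun=> c).
Proof.
rewrite (_ : (fun=> c) = fun x => c * cos (0 * x + 0)).
  exact/trigpoly_scale/trigpoly_cos.
by apply/funext => x; rewrite mul0r addr0 cos0 mulr1.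
Qed.

(** Product-to-sum formula. Products with a sine are the ones that the Bernstein recursion creates,
    since each level multiplies by [u] or [1 - u] with [u = (1 + sin (t * x)) / 2]. *)
Lemma trigpoly_sinM t p : trigpoly p -> trigpoly (fun x => sin (t * x) * p x).
Proof.
elim=> [s a|c {}p _ ih|{}p q _ ihp _ ihq].
- rewrite (_ : (fun _ => _) = fun x => 2^-1 * cos ((t - s) * x + (- a - pi / 2))
                  + 2^-1 * cos ((t + s) * x + (a - pi / 2))); last first.
    apply/funext => x.
    rewrite !addrA !cosBpihalf.
    rewrite (_ : (t - s) * x - a = t * x - (s * x + a)); last by ring.
    rewrite (_ : (t + s) * x + a = t * x + (s * x + a)); last by ring.
    have prod (y z : R) : sin y * cos z = 2^-1 * sin (y - z) + 2^-1 * sin (y + z).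
      by rewrite sinB sinD; field.
    exact: prod.
  by apply: trigpoly_add; apply: trigpoly_scale; exact: trigpoly_cos.
- under eq_fun do rewrite mulrCA; exact: trigpoly_scale.
- under eq_fun do rewrite mulrDr; exact: trigpoly_add.
Qed.

(* The expectation of [g] of a binomial(n, u) variable. *)
Fixpoint bernstein (n : nat) (g : nat -> R) (u : R) : R :=
  if n is n'.+1 then
    u * bernstein n' (fun k => g k.+1) u + (1 - u) * bernstein n' g u
  else g 0%N.

Lemma trigpoly_bernstein n g t :
  trigpoly (fun x => bernstein n g ((1 + sin (t * x)) / 2)).
Proof.
elim: n g => [|n ih] g /=; first exact: trigpoly_cst.
set B1 := fun x => bernstein n (fun k => g k.+1) ((1 + sin (t * x)) / 2).
set B0 := fun x => bernstein n g ((1 + sin (t * x)) / 2).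
rewrite (_ : (fun _ => _) = fun x => 2^-1 * (B1 x + B0 x) +
    2^-1 * (sin (t * x) * (B1 x + (- 1) * B0 x))); last first.
  by apply/funext => x; rewrite /B1 /B0; field.
have T1 : trigpoly B1 := ih _; have T0 : trigpoly B0 := ih _.
apply: trigpoly_add; first exact/trigpoly_scale/trigpoly_add.
by apply/trigpoly_scale/trigpoly_sinM/trigpoly_add => //; exact: trigpoly_scale.
Qed.

Lemma ler_bernstein n g h u : 0 <= u <= 1 ->
  (forall k, (k <= n)%N -> g k <= h k) -> bernstein n g u <= bernstein n h u.
Proof.
move=> /andP[u0 u1]; elim: n g h => [|n ih] g h gh /=; first exact: gh.
apply: lerD; apply: ler_wpM2l; rewrite ?subr_ge0//; apply: ih => k kn; apply: gh.
  by rewrite ltnS.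
exact: leqW.
Qed.

(** Mean and variance of the binomial law. With [c = n u] the bracket is the variance, which feeds a
    Chebyshev argument; with [b = 0] constants are reproduced, so bounds on [g] pass to its
    Bernstein polynomial. *)
Lemma bernstein_quadratic n a b c u :
  bernstein n (fun k => a + b * (k%:R - c) ^+ 2) u =
  a + b * (n%:R * u * (1 - u) + (n%:R * u - c) ^+ 2).
Proof.
elim: n c => [|n ih] c /=; first by ring.
rewrite ih.
rewrite (_ : (fun k => _) = fun k => a + b * (k%:R - (c - 1)) ^+ 2); last first.
  by apply/funext => k; rewrite -natr1; congr (_ + _ * _ ^+ 2); ring.
by rewrite ih -natr1; ring.
Qed.

Lemma ler_cos_pi x y : 0 <= y -> y <= x -> x <= pi -> cos x <= cos y.
Proof. by move=> y0 yx xpi; rewrite leNgt ltr_cos ?in_itv/= -?leNgt//; lra. Qed.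

(** A quantitative injectivity of the sine. The difference is [2 * cos B * sin A] with [B] the
    midpoint and [A] the half-distance; both points lie in the interval, so [|B| <= pi / 2 - A] and
    thus [cos B >= sin A]. *)
Lemma sin_separation x y e : 0 < e -> - (pi / 2) <= x -> x <= pi / 2 ->
  - (pi / 2) <= y -> y <= pi / 2 ->
  e <= `|x - y| -> 2 * sin (e / 2) ^+ 2 <= `|sin x - sin y|.
Proof.
wlog yx : x y / (y : R) <= x.
  move=> H e0 x1 x2 y1 y2.
  have /orP[xy|yx] := le_total x y; last exact: H.
  by rewrite distrC (distrC (sin x)); exact: H.
move=> e0 x1 x2 y1 y2; rewrite ger0_norm ?subr_ge0// => exy.
have pi_gt0 := pi_gt0 R.
set A := (x - y) / 2; set B := (x + y) / 2.
have -> : sin x - sin y = 2 * (cos B * sin A).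
  have xE : x = B + A by rewrite /A /B; field.
  have yE : y = B - A by rewrite /A /B; field.
  by rewrite xE yE sinD sinB; ring.
have sin_mono (a b : R) : 0 <= a -> a <= b -> b <= pi / 2 -> sin a <= sin b.
  move=> a0 ab b2; rewrite -(cosBpihalf a) -(cosBpihalf b).
  by rewrite -(cosN (a - _)) -(cosN (b - _)); apply: ler_cos_pi; lra.
have s0 : 0 <= sin (e / 2) by apply: sin_ge0_pi; lra.
have sA : sin (e / 2) <= sin A by apply: sin_mono; rewrite /A; lra.
have cB : sin A <= cos B.
  rewrite -cosBpihalf -cosN -(cos_norm B) ler_cos_pi//.
  - by rewrite ler_norml /A /B; apply/andP; split; lra.
  - by rewrite /A; lra.
rewrite (le_trans _ (ler_norm _))// ler_pM2l// expr2.
by apply: ler_pM => //; exact: le_trans cB.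
Qed.

(** Only [x] is confined to the interval: in Slutsky's lemma the perturbed point [y] may leave
    it. *)
Lemma uniformly_continuous_itv f K e : continuous f -> 0 < e ->
  exists2 dl : R, 0 < dl & forall x y : R, `|x| <= K -> `|x - y| < dl -> `|f x - f y| <= e.
Proof.
move=> cf e0.
have := (compact_near_coveringP _).1 (@segment_compact R (- K) K) R 0^'+
  (fun dl x => forall y, `|x - y| < dl -> `|f x - f y| <= e).
case=> [x _|dl /= dl0 H].
- have e2 : 0 < e / 2 by rewrite divr_gt0.
  have /cvgrPdist_le/(_ _ e2)/nbhs_ballP[r /= r0 xr] := cf x.
  near=> x' dl => /= y xy.
  have xx' : `|x - x'| < r / 2.
    by near: x'; apply: nbhsx_ballx; rewrite divr_gt0.
  have dlr : dl < r / 2.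
    by near: dl; apply: nbhs_right_lt; rewrite divr_gt0.
  have : `|f x - f x'| <= e / 2 by apply: xr; rewrite /ball/=; lra.
  have : `|f x - f y| <= e / 2.
    apply: xr; rewrite /ball/=.
    have := ler_distD x' x y; lra.
  have := ler_distD (f x) (f x') (f y); rewrite (distrC (f x') (f x)); lra.
exists (dl / 2); first by rewrite divr_gt0.
move=> x y xK xy; apply: (H (dl / 2)) => //=.
- by rewrite sub0r normrN gtr0_norm ?divr_gt0// gtr_pMr// invf_lt1// ltr1n.
- by rewrite divr_gt0.
- by rewrite in_itv/= -ler_norml.
Unshelve. all: by end_near. Qed.

(* The Bernstein polynomial of [f] o arcsin, evaluated at [(1 + sin (t x)) / 2], is a
   trigonometric polynomial that inherits the bound of [f] on the whole line. *)
Lemma trigpoly_approx f M K e : continuous f -> (forall x, `|f x| <= M) ->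
  0 < K -> 0 < e -> exists p, [/\ trigpoly p, forall x, `|p x| <= M &
    forall x, `|x| <= K -> `|f x - p x| <= e].
Proof.
move=> cf fM K0 e0.
have M0 : 0 <= M := le_trans (normr_ge0 _) (fM 0).
have e2 : 0 < e / 2 by rewrite divr_gt0.
have [dl dl0 fdl] := uniformly_continuous_itv K cf e2.
have pi0 := pi_gt0 R.
(* Maps the interval from - K to K onto the one from - pi / 2 to pi / 2, where [asin] inverts the
   sine. *)
pose t := pi / 2 / K.
have t0 : 0 < t by rewrite /t !divr_gt0.
(* The cap at 1 keeps [eta / 2] between 0 and pi, so that [r] is positive. *)
pose eta := Num.min (t * dl / 2) 1.
have eta0 : 0 < eta by rewrite /eta lt_min ltr01 andbT divr_gt0// mulr_gt0.
pose r := sin (eta / 2) ^+ 2.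
have r0 : 0 < r.
  rewrite exprn_gt0// sin_gt0_pi// divr_gt0//=.
  have : eta <= 1 by rewrite /eta ge_min lexx orbT.
  have := pi_ge2 R; lra.
pose u x := (1 + sin (t * x)) / 2.
have u01 x : 0 <= u x <= 1.
  by have := sin_geN1 (t * x); have := sin_le1 (t * x); rewrite /u; lra.
(* Makes the Chebyshev error [2 * M / (n r^2)] at most [e / 2]. *)
pose n := (Num.truncn (2 * M / (r ^+ 2 * (e / 2)))).+1.
pose g k := f (asin (2 * (k%:R / n%:R) - 1) / t).
have n0 : 0 < n%:R :> R by rewrite ltr0n.
have nM : 2 * M / (r ^+ 2 * (e / 2)) < n%:R by exact: truncnS_gt.
clearbody n.
exists (fun x => bernstein n g (u x)); split.
- exact: trigpoly_bernstein.
- move=> x; rewrite ler_norml; apply/andP; split.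
    have := @ler_bernstein n (fun k => - M + 0 * (k%:R - 0) ^+ 2) g (u x) (u01 x).
    rewrite bernstein_quadratic mul0r addr0; apply => k _.
    by rewrite mul0r addr0; have := fM (asin (2 * (k%:R / n%:R) - 1) / t); rewrite ler_norml => /andP[].
  have := @ler_bernstein n g (fun k => M + 0 * (k%:R - 0) ^+ 2) (u x) (u01 x).
  rewrite bernstein_quadratic mul0r addr0; apply => k _.
  by rewrite mul0r addr0; have := fM (asin (2 * (k%:R / n%:R) - 1) / t); rewrite ler_norml => /andP[].
move=> x xK.
pose c := 2 * M / (n%:R * r) ^+ 2.
(* Either the node of index [k] is within [dl] of [x] and uniform continuity applies, or [k / n] and
   [u x] differ by at least [r] and the quadratic term alone exceeds [2 * M]. Averaging over the
   binomial law then leaves its variance. *)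
have key k : (k <= n)%N -> `|f x - g k| <= e / 2 + c * (k%:R - n%:R * u x) ^+ 2.
  move=> kn.
  rewrite /g; set y := asin _.
  have kn1 : -1 <= (2 * (k%:R / n%:R) - 1 : R) <= 1.
    have : 0 <= (k%:R / n%:R : R) <= 1.
      by rewrite divr_ge0//= ler_pdivrMr// mul1r ler_nat.
    lra.
  have [/andP[y1 y2] sy] := asin_def kn1.
  have [H|H] := ltP `|x - y / t| dl.
    apply: (le_trans (fdl _ _ xK H)).
    by rewrite lerDl mulr_ge0 ?sqr_ge0// divr_ge0 ?sqr_ge0// mulr_ge0.
  have txy : eta <= `|t * x - y|.
    rewrite (_ : t * x - y = t * (x - y / t)); last by field; rewrite gt_eqF.
    rewrite normrM (gtr0_norm t0).
    have : t * dl <= t * `|x - y / t| by rewrite ler_pM2l.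
    have : eta <= t * dl / 2 by rewrite /eta ge_min lexx.
    have : 0 < t * dl by rewrite mulr_gt0.
    lra.
  have tx : `|t * x| <= pi / 2.
    rewrite normrM (gtr0_norm t0) /t mulrAC ler_pdivrMr// ler_pM2l//.
    by rewrite divr_gt0.
  have := @sin_separation (t * x) y eta eta0.
  move: tx; rewrite ler_norml => /andP[tx1 tx2] /(_ tx1 tx2 y1 y2 txy).
  rewrite sy -/r => sep.
  have {}sep : n%:R * r <= `|k%:R - n%:R * u x|.
    rewrite (_ : k%:R - _ = n%:R * (- (sin (t * x) - (2 * (k%:R / n%:R) - 1)) / 2)); last first.
      by rewrite /u; field; rewrite gt_eqF.
    rewrite normrM (gtr0_norm n0) ler_pM2l// normrM normrN.
    rewrite (gtr0_norm (_ : 0 < 2^-1))//; lra.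
  have nr0 : 0 < n%:R * r by rewrite mulr_gt0.
  have : 2 * M <= c * (k%:R - n%:R * u x) ^+ 2.
    rewrite /c mulrAC ler_pdivlMr ?exprn_gt0// ler_wpM2l ?mulr_ge0//.
    rewrite -[leRHS]real_normK ?num_real// lerXn2r ?nnegrE ?normr_ge0// ltW//.
  have : `|f x - g k| <= 2 * M.
    apply: (le_trans (ler_normB _ _)); have := fM x; have := fM (y / t).
    lra.
  lra.
have cb : c * (n%:R * u x * (1 - u x)) <= e / 2.
  have h : u x * (1 - u x) <= 1 by have := u01 x; nra.
  have c0 : 0 <= c by rewrite /c divr_ge0 ?sqr_ge0// mulr_ge0.
  have : c * (n%:R * u x * (1 - u x)) <= c * n%:R.
    by apply: ler_wpM2l => //; rewrite -mulrA ler_piMr// ltW.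
  move/le_trans; apply.
  rewrite /c (_ : _ * n%:R = 2 * M / r ^+ 2 / n%:R); last first.
    by field; rewrite !gt_eqF.
  have r2 : 0 < r ^+ 2 by rewrite exprn_gt0.
  move: nM; rewrite ltr_pdivrMr; last by rewrite mulr_gt0.
  by move=> nM; rewrite !ler_pdivrMr//; clearbody r; lra.
have B := bernstein_quadratic n.
rewrite ler_norml; apply/andP; split.
  have := @ler_bernstein n g
     (fun k => (f x + e / 2) + c * (k%:R - n%:R * u x) ^+ 2) (u x) (u01 x).
  rewrite B subrr expr0n/= addr0 => /(_ _)/le_trans H.
  have : bernstein n g (u x) <= f x + e / 2 + c * (n%:R * u x * (1 - u x)).
    apply: H => // k kn; have := key k kn; rewrite ler_norml; lra.
  lra.
have := @ler_bernstein n
   (fun k => (f x - e / 2) + (- c) * (k%:R - n%:R * u x) ^+ 2) g (u x) (u01 x).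
rewrite B subrr expr0n/= addr0 => H.
have : f x - e / 2 + - c * (n%:R * u x * (1 - u x)) <= bernstein n g (u x).
  apply: H => // k kn; have := key k kn; rewrite ler_norml; lra.
lra.
Qed.

End trigonometric_polynomials.

(** * Real-valued expectations *)

Section real_expectation.
Context d (T : measurableType d) (R : realType).
Implicit Types (P : probability T R) (f g : T -> R).

Definition L1 P f := P.-integrable setT (EFin \o f).

Lemma L1_measurable P f : L1 P f -> measurable_fun setT f.
Proof. by move=> /integrableP[/measurable_EFinP]. Qed.

Lemma L1_bounded P f M : measurable_fun setT f -> (forall w, `|f w| <= M) ->
  L1 P f.
Proof.
move=> mf fM; apply: measurable_bounded_integrable => //.
  by rewrite /= probability_setT ltry.
exists M; split; first exact: num_real.
move=> x Mx w _ /=; exact/(le_trans (fM w))/ltW.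
Qed.

Lemma L1_le P f g : measurable_fun setT f -> L1 P g ->
  (forall w, `|f w| <= g w) -> L1 P f.
Proof.
move=> mf ig fg; apply: (le_integrable _ _ _ ig) => //.
  exact/measurable_EFinP.
by move=> w _ /=; rewrite lee_fin (le_trans (fg w))// ler_norm.
Qed.

Lemma L1_cst P c : L1 P (fun=> c).
Proof. by apply: (@L1_bounded _ _ `|c|). Qed.

Lemma L1D P f g : L1 P f -> L1 P g -> L1 P (fun w => f w + g w).
Proof. by move=> fi gi; have := integrableD measurableT fi gi. Qed.

Lemma L1Z P c f : L1 P f -> L1 P (fun w => c * f w).
Proof. by move=> fi; have := integrableZl measurableT c fi. Qed.

Lemma L1N P f : L1 P f -> L1 P (fun w => - f w).
Proof. by move=> /(L1Z (-1)); under eq_fun do rewrite mulN1r. Qed.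

Lemma L1B P f g : L1 P f -> L1 P g -> L1 P (fun w => f w - g w).
Proof. by move=> fi /L1N; exact: L1D. Qed.

Lemma L1_norm P f : L1 P f -> L1 P (fun w => `|f w|).
Proof. exact: integrable_norm. Qed.

Lemma L1_boundedM P f g M : measurable_fun setT f -> (forall w, `|f w| <= M) ->
  L1 P g -> L1 P (fun w => f w * g w).
Proof.
move=> mf fM ig; apply: (@L1_le _ _ (fun w => M * `|g w|)).
- by apply: measurable_funM => //; exact: L1_measurable ig.
- exact/L1Z/L1_norm.
- by move=> w; rewrite normrM ler_wpM2r.
Qed.

Lemma L1_sum P (I : Type) (s : seq I) (f : I -> T -> R) :
  (forall i, L1 P (f i)) -> L1 P (fun w => \sum_(i <- s) f i w).
Proof.
move=> h; elim: s => [|i s ih].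
  by under eq_fun do rewrite big_nil; exact: L1_cst.
by under eq_fun do rewrite big_cons; exact: L1D.
Qed.

Lemma L1_sqr P f : measurable_fun setT f -> L1 P (fun w => f w ^+ 2) -> L1 P f.
Proof.
move=> mf f2; apply: (@L1_le _ _ (fun w => 1 + f w ^+ 2)) => //.
  exact/L1D/f2/L1_cst.
by move=> w; rewrite -real_normK ?num_real//; have := normr_ge0 (f w); nra.
Qed.

Lemma L1P_ge0 P f : measurable_fun setT f -> (forall w, 0 <= f w) ->
  L1 P f <-> (\int[P]_w (f w)%:E < +oo)%E.
Proof.
move=> mf f0; split => [/integrableP[_]|h].
  by under eq_integral do rewrite /= ger0_norm//.
apply/integrableP; split; first exact/measurable_EFinP.
by under eq_integral do rewrite /= ger0_norm//.
Qed.

Lemma EFin_Rintegral P f : L1 P f ->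
  (\int[P]_w f w)%:E = (\int[P]_w (f w)%:E)%E.
Proof. by move=> fi; rewrite fineK// integrable_fin_num. Qed.

Lemma expectationE P f : L1 P f -> 'E_P[f]%E = (\int[P]_w f w)%:E.
Proof. by move=> /EFin_Rintegral ->; rewrite unlock. Qed.

Lemma integral_EFinE P f r : measurable_fun setT f -> (forall w, 0 <= f w) ->
  (\int[P]_w (f w)%:E = r%:E)%E -> L1 P f /\ \int[P]_w f w = r.
Proof.
by move=> mf f0 h; split; [apply/L1P_ge0 => //; rewrite h ltry | rewrite /Rintegral h].
Qed.

Lemma Rint_cst P c : \int[P]_w c = c.
Proof. by rewrite Rintegral_cst//= probability_setT mulr1. Qed.

Lemma RintD P f g : L1 P f -> L1 P g ->
  \int[P]_w (f w + g w) = \int[P]_w f w + \int[P]_w g w.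
Proof. exact: RintegralD. Qed.

Lemma RintB P f g : L1 P f -> L1 P g ->
  \int[P]_w (f w - g w) = \int[P]_w f w - \int[P]_w g w.
Proof. exact: RintegralB. Qed.

Lemma RintZ P c f : L1 P f -> \int[P]_w (c * f w) = c * \int[P]_w f w.
Proof. by move=> fi; rewrite RintegralZl. Qed.

Lemma Rint_sum P (I : Type) (s : seq I) (f : I -> T -> R) :
  (forall i, L1 P (f i)) ->
  \int[P]_w (\sum_(i <- s) f i w) = \sum_(i <- s) \int[P]_w f i w.
Proof.
move=> h; elim: s => [|i s ih].
  by rewrite big_nil; under eq_Rintegral do rewrite big_nil; exact: Rint_cst.
rewrite big_cons -ih -RintD//; last exact: L1_sum.
by under eq_Rintegral do rewrite big_cons.
Qed.

Lemma Rint_le P f g : L1 P f -> L1 P g -> (forall w, f w <= g w) ->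
  \int[P]_w f w <= \int[P]_w g w.
Proof. by move=> fi gi fg; apply: le_Rintegral. Qed.

Lemma Rint_ge0 P f : (forall w, 0 <= f w) -> 0 <= \int[P]_w f w.
Proof. by move=> f0; apply: Rintegral_ge0. Qed.

Lemma Rint_norm P f : L1 P f -> `|\int[P]_w f w| <= \int[P]_w `|f w|.
Proof. exact: le_normr_Rintegral. Qed.

Lemma Rint_dist P f g h : L1 P f -> L1 P g -> L1 P h ->
  (forall w, `|f w - g w| <= h w) -> `|\int[P]_w f w - \int[P]_w g w| <= \int[P]_w h w.
Proof.
move=> fi gi hi fg; rewrite -RintB//.
apply: (le_trans (Rint_norm _)); first exact: L1B.
by apply: Rint_le => //; exact/L1_norm/L1B.
Qed.

Lemma L1_indic P (A : set T) : measurable A -> L1 P (\1_A : T -> R).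
Proof.
move=> mA; apply: (@L1_bounded _ _ 1) => // w.
by rewrite indicE; case: (_ \in _); rewrite ?normr1 ?normr0.
Qed.

Lemma Rint_indic P (A : set T) : measurable A -> (\int[P]_w \1_A w)%:E = P A.
Proof.
by move=> mA; rewrite EFin_Rintegral ?integral_indic ?setIT//; exact: L1_indic.
Qed.

Lemma Rint_ae P f g : measurable_fun setT f -> measurable_fun setT g ->
  {ae P, forall w, f w = g w} -> \int[P]_w f w = \int[P]_w g w.
Proof.
move=> mf mg fg; congr fine; apply: ae_eq_integral => //; [exact/measurable_EFinP..|].
by apply: filterS fg => w /= -> _.
Qed.

Lemma L1_ae_eq P f g : measurable_fun setT f -> L1 P g ->
  {ae P, forall w, f w = g w} -> L1 P f.
Proof.
move=> mf ig fg; have mg := L1_measurable ig.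
apply/integrableP; split; first exact/measurable_EFinP.
have /integrableP[_] := ig.
rewrite (_ : (\int[P]_x `|(EFin \o f) x| = \int[P]_x `|(EFin \o g) x|)%E)//.
apply: ae_eq_integral => //.
- by apply: measurableT_comp => //; exact/measurable_EFinP.
- by apply: measurableT_comp => //; exact/measurable_EFinP.
- by apply: filterS fg => w /= -> _.
Qed.

(** Integrates [|f| <= (f^2 / a + a) / 2]. Choosing [a] near the square root of the second moment
    recovers the Cauchy-Schwarz bound up to a constant. *)
Lemma Rint_sqr_le P f a c : 0 < a -> L1 P f -> L1 P (fun w => f w ^+ 2) ->
  \int[P]_w f w ^+ 2 <= c -> \int[P]_w `|f w| <= (c / a + a) / 2.
Proof.
move=> a0 fi f2i fc.
have -> : (c / a + a) / 2 = (2 * a)^-1 * c + a / 2 by field; rewrite gt_eqF.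
apply: (@le_trans _ _ (\int[P]_w ((2 * a)^-1 * f w ^+ 2 + a / 2))).
  apply: Rint_le; first exact: L1_norm.
    exact/L1D/L1_cst/L1Z.
  move=> w; rewrite -(real_normK (num_real (f w))).
  rewrite (_ : _ + _ = (`|f w| ^+ 2 + a ^+ 2) / (2 * a)); last by field; rewrite gt_eqF.
  by rewrite ler_pdivlMr ?mulr_gt0//; have := sqr_ge0 (`|f w| - a); nra.
rewrite RintD ?Rint_cst ?RintZ//; [|exact: L1Z|exact: L1_cst].
by rewrite lerD2r ler_pM2l// invr_gt0 mulr_gt0.
Qed.

End real_expectation.

(** Passes through positive and negative parts, hence also covers [f] whose integral does not
    converge: both sides are then the same default value. *)
Lemma Rint_eq_ge0 d d' (T : measurableType d) (S : measurableType d')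
    (R : realType) (P : probability T R) (V W : T -> S) (f : S -> R) :
  measurable_fun setT f ->
  (forall g : S -> \bar R, measurable_fun setT g -> (forall x, 0 <= g x)%E ->
    (\int[P]_w g (V w) = \int[P]_w g (W w))%E) ->
  \int[P]_w f (V w) = \int[P]_w f (W w).
Proof.
move=> mf VW; rewrite /Rintegral integralE [in RHS]integralE.
have mE : measurable_fun setT (EFin \o f) by exact/measurable_EFinP.
have pE (X : T -> S) : (fun w => (f (X w))%:E)^\+%E = ((EFin \o f)^\+ \o X)%E.
  by apply/funext => w; rewrite /= !funeposE.
have nE (X : T -> S) : (fun w => (f (X w))%:E)^\-%E = ((EFin \o f)^\- \o X)%E.
  by apply/funext => w; rewrite /= !funenegE.
rewrite !pE !nE; congr (fine (_ - _)%E); apply: VW => //.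
- exact: measurable_funepos.
- exact: measurable_funeneg.
Qed.


(** * Convergence in distribution *)

Section weak_convergence.
Context dT dZ (T : measurableType dT) (TZ : measurableType dZ) (R : realType)
  (P : probability T R) (Q : probability TZ R).
Implicit Types (X Y : nat -> T -> R) (Z : TZ -> R) (f : R -> R) (e K M : R).

Lemma measurable_gt_norm d (S : measurableType d) (V : S -> R) K :
  measurable_fun setT V -> measurable [set w | K < `|V w|].
Proof.
move=> mV; rewrite -[X in measurable X]setTI.
have := measurable_fun_ltr (measurable_cst K) (measurableT_comp (@normr_measurable R setT) mV).
by move=> /(_ measurableT [set true] I); rewrite (_ : _ @^-1` _ = [set w | K < `|V w|]).
Qed.

Lemma L1_bounded_comp d (S : measurableType d) (Pr : probability S R)
    (V : S -> R) f M : measurable_fun setT f -> (forall x, `|f x| <= M) ->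
  measurable_fun setT V -> L1 Pr (fun w => f (V w)).
Proof.
move=> mf fM mV; apply: (@L1_bounded _ _ _ _ _ M) => [|w]; last exact: fM.
exact: measurableT_comp.
Qed.

Lemma cvg_in_distributionP X Z : (forall n, measurable_fun setT (X n)) ->
  measurable_fun setT Z ->
  cvg_in_distribution P X Q Z <->
  forall f, continuous f -> (exists M : R, forall x, `|f x| <= M) ->
    \int[P]_w f (X n w) @[n --> \oo] --> \int[Q]_w f (Z w).
Proof.
move=> mX mZ.
have EP f n : continuous f -> (exists M : R, forall x, `|f x| <= M) ->
    'E_P[f \o X n]%E = (\int[P]_w f (X n w))%:E.
  move=> /continuous_measurable_fun mf [M fM]; apply: expectationE.
  exact: (L1_bounded_comp _ mf fM).
have EQ f : continuous f -> (exists M : R, forall x, `|f x| <= M) ->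
    'E_Q[f \o Z]%E = (\int[Q]_w f (Z w))%:E.
  move=> /continuous_measurable_fun mf [M fM]; apply: expectationE.
  exact: (L1_bounded_comp _ mf fM).
split=> h f cf bf; have := h f cf bf; rewrite ?EQ//.
  by under eq_cvg do rewrite EP//; move=> /fine_cvg.
by move=> h1; under eq_cvg do rewrite EP//; apply: cvg_EFin => //; exact: nearW.
Qed.

Lemma tail_cvg0 d (S : measurableType d) (Pr : probability S R) (V : S -> R) e :
  measurable_fun setT V -> 0 < e ->
  exists2 K : R, 0 < K & \int[Pr]_w \1_[set w | K < `|V w|] w <= e.
Proof.
move=> mV e0.
pose F n := [set w | n.+1%:R < `|V w|].
have mF n : measurable (F n) by exact: measurable_gt_norm.
have : Pr \o F @ \oo --> Pr (\bigcap_n F n).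
  apply: nonincreasing_cvg_mu => //.
  - by rewrite (le_lt_trans (probability_le1 _ _)) ?ltry.
  - exact: bigcap_measurable.
  - move=> m n mn; apply/subsetPset => w; rewrite /F/=; apply: le_lt_trans.
    by rewrite ler_nat.
rewrite (_ : \bigcap_n F n = set0) ?measure0; last first.
  rewrite -subset0 => w /= /(_ (Num.truncn `|V w|) I).
  by rewrite /F/= ltNge ltW// truncnS_gt.
move=> /fine_cvg/cvgrPdist_le/(_ _ e0)[N _ /(_ N (leqnn _))] /=.
rewrite sub0r normrN => FN.
exists N.+1%:R; first by rewrite ltr0n.
rewrite -lee_fin Rint_indic; last exact: mF.
rewrite -(@fineK _ (Pr _)) ?lee_fin ?(le_trans _ FN) ?ler_norm//.
by rewrite fin_num_measure//; exact: mF.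
Qed.

Definition tight X := forall e : R, 0 < e -> exists2 K : R, 0 < K &
  \forall n \near \oo, \int[P]_w \1_[set w | K < `|X n w|] w <= e.

Definition cvg_in_probability0 Y := forall e : R, 0 < e ->
  \int[P]_w \1_[set w | e < `|Y n w|] w @[n --> \oo] --> (0 : R).

Lemma tight_of_cvg X Z : (forall n, measurable_fun setT (X n)) ->
  measurable_fun setT Z -> cvg_in_distribution P X Q Z -> tight X.
Proof.
move=> mX mZ /cvg_in_distributionP XZ e e0.
have e2 : 0 < e / 2 by rewrite divr_gt0.
have [K K0 ZK] := tail_cvg0 Q mZ e2.
(* A continuous ramp lying between the indicators of [|x| > K + 1] and [|x| > K]. *)
pose f (x : R) : R := Num.min 1 (Num.max 0 (`|x| - K)).
have f01 x : 0 <= f x <= 1.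
  by rewrite /f le_min ler01 le_max lexx ge_min lexx.
have cf : continuous f.
  move=> x; rewrite /f; apply: (@continuous_min _ _ (fun=> 1) _ x).
    exact: cst_continuous.
  apply: (@continuous_max _ _ (fun=> 0) (fun x : R => `|x| - K) x).
    exact: cst_continuous.
  by apply: cvgB; [exact: norm_continuous|exact: cvg_cst].
have bf : exists M : R, forall x, `|f x| <= M.
  by exists 1 => x; have /andP[? ?] := f01 x; rewrite ger0_norm.
have mf := continuous_measurable_fun cf.
have f1 x : `|f x| <= 1 by have /andP[? ?] := f01 x; rewrite ger0_norm.
exists (K + 1); first by rewrite addr_gt0.
have := XZ mX mZ f cf bf => /cvgrPdist_le/(_ _ e2); apply: filterS => n.
rewrite ler_norml => /andP[h1 h2].
have fZ : \int[Q]_w f (Z w) <= e / 2.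
  apply: le_trans ZK; apply: Rint_le.
  - exact: L1_bounded_comp f1 _.
  - exact/L1_indic/measurable_gt_norm.
  - move=> w; rewrite indicE; case: (boolP (w \in _)) => /= [_|].
      by have /andP[] := f01 (Z w).
    rewrite notin_setE/= => /negP; rewrite -leNgt => h.
    by rewrite /f (max_idPl _) ?subr_le0// ge_min lexx orbT.
have : \int[P]_w \1_[set w | K + 1 < `|X n w|] w <= \int[P]_w f (X n w).
  apply: Rint_le.
  - exact/L1_indic/measurable_gt_norm.
  - exact: L1_bounded_comp f1 _.
  - move=> w; rewrite indicE; case: (boolP (w \in _)) => /= [|_].
      rewrite inE/= => h; rewrite /f le_min lexx/= le_max; apply/orP; right; lra.
    by have /andP[] := f01 (X n w).
lra.
Qed.

(** Slutsky's lemma. Where [X n] is bounded by [K] and [Y n] is small, uniform continuity compares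
    the two values of [f]; elsewhere they differ by at most [2 * M]. *)
Lemma cvg_in_distributionD0 X Y Z : (forall n, measurable_fun setT (X n)) ->
  (forall n, measurable_fun setT (Y n)) -> measurable_fun setT Z ->
  cvg_in_distribution P X Q Z -> cvg_in_probability0 Y ->
  cvg_in_distribution P (fun n w => X n w + Y n w) Q Z.
Proof.
move=> mX mY mZ XZ Y0; have tX := tight_of_cvg mX mZ XZ.
apply/cvg_in_distributionP => //; first by move=> n; exact: measurable_funD.
move=> f cf [M fM]; apply/cvgrPdist_le => e e0.
have M0 : 0 <= M := le_trans (normr_ge0 _) (fM 0).
have mf := continuous_measurable_fun cf.
(* Two exceptional events of probability at most [a], at cost [2 * M] each, use up [e / 2]; uniform
   continuity and the convergence of [X] take [e / 4] each. *)
pose a := e / (4 * (2 * M + 1)).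
have a0 : 0 < a by rewrite divr_gt0// mulr_gt0//; lra.
have aM : 2 * M * a <= e / 4.
  rewrite /a mulrA ler_pdivrMr ?mulr_gt0//; last by lra.
  by have : 0 <= M * e; [rewrite mulr_ge0// ltW|lra].
have [K K0 XK] := tX a a0.
have e4 : 0 < e / 4 by rewrite divr_gt0.
have [dl dl0 fdl] := uniformly_continuous_itv K cf e4.
have dl2 : 0 < dl / 2 by rewrite divr_gt0.
have bf : exists M : R, forall x, `|f x| <= M by exists M.
have /(cvg_in_distributionP mX mZ)/(_ f cf bf)/cvgrPdist_le/(_ _ e4) := XZ.
have /cvgrPdist_le/(_ _ a0) := Y0 _ dl2.
move: XK; apply: filterS3 => n XK YK XZn.
have iXY : L1 P (fun w => f (X n w + Y n w)).
  by apply: L1_bounded_comp fM _ => //; exact: measurable_funD.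
have iX : L1 P (fun w => f (X n w)).
  exact: L1_bounded_comp fM _.
pose A := [set w | K < `|X n w|]; pose B := [set w | dl / 2 < `|Y n w|].
have iA : L1 P (\1_A : T -> R) by exact/L1_indic/measurable_gt_norm.
have iB : L1 P (\1_B : T -> R) by exact/L1_indic/measurable_gt_norm.
have ih : L1 P (fun w => e / 4 + 2 * M * (\1_A w + \1_B w)).
  by apply: L1D; [exact: L1_cst|exact/L1Z/L1D].
have := Rint_dist iX iXY ih.
rewrite RintD ?Rint_cst ?RintZ ?RintD//; [|exact: L1D|exact: L1_cst|exact/L1Z/L1D].
set IA := Rintegral _ _ \1_A; set IB := Rintegral _ _ \1_B.
have IAa : IA <= a by exact: XK.
have IBa : IB <= a.
  by apply: le_trans YK; rewrite sub0r normrN; exact: ler_norm.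
have : 2 * M * (IA + IB) <= 2 * M * (a + a).
  by apply: ler_wpM2l; [rewrite mulr_ge0|exact: lerD].
move=> h1 h2.
have {}h2 : `|\int[P]_w f (X n w) - \int[P]_w f (X n w + Y n w)| <= e / 4 + 2 * M * (IA + IB).
  apply: h2 => w.
  have M2 : `|f (X n w) - f (X n w + Y n w)| <= 2 * M.
    by apply: (le_trans (ler_normB _ _)); have := fM (X n w); have := fM (X n w + Y n w); lra.
  rewrite !indicE; case: (boolP (w \in A)) => [_|]; last first.
    rewrite notin_setE /A/= => /negP; rewrite -leNgt => XnK.
    case: (boolP (w \in B)) => [_|]; first by rewrite add0r mulr1; lra.
    rewrite notin_setE /B/= => /negP; rewrite -leNgt => YB.
    rewrite addr0 mulr0 addr0; apply: fdl => //.
    by rewrite opprD addNKr normrN; lra.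
  by case: (_ \in _); rewrite /= ?addr0; lra.
have := ler_distD (\int[P]_w f (X n w)) (\int[Q]_w f (Z w)) (\int[P]_w f (X n w + Y n w)).
by rewrite /=; lra.
Qed.

(** Stands in for Levy's continuity theorem, with tightness as a hypothesis. The approximant of [f]
    obeys the same bound [M] everywhere, so on the tails it costs no more than [f] does. *)
Lemma cvg_in_distribution_trig X Z : (forall n, measurable_fun setT (X n)) ->
  measurable_fun setT Z -> tight X ->
  (forall t a, \int[P]_w cos (t * X n w + a) @[n --> \oo] --> \int[Q]_w cos (t * Z w + a)) ->
  cvg_in_distribution P X Q Z.
Proof.
move=> mX mZ tX Xcos.
have trig p : trigpoly p -> [/\ measurable_fun setT p, exists M : R, forall x, `|p x| <= M &
    \int[P]_w p (X n w) @[n --> \oo] --> \int[Q]_w p (Z w)].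
  have L (q : R -> R) d (S : measurableType d) (Pr : probability S R) (V : S -> R) :
      measurable_fun setT q -> (exists M : R, forall x, `|q x| <= M) ->
      measurable_fun setT V -> L1 Pr (fun w => q (V w)).
    by move=> mq [M qM]; exact: L1_bounded_comp qM.
  elim=> [t a|c {}p _ [mp [M pM] pc]|{}p q _ [mp [M pM] pc] _ [mq [N qN] qc]].
  - split => //.
    + apply: (measurableT_comp (continuous_measurable_fun (@continuous_cos R))).
      by apply: measurable_funD => //; exact: measurable_funM.
    + by exists 1 => x; rewrite ler_norml cos_geN1 cos_le1.
  - split; first exact: measurable_funM.
      by exists (`|c| * M) => x; rewrite normrM ler_wpM2l.
    have bp : exists M : R, forall x, `|p x| <= M by exists M.
    rewrite RintZ; last exact: L.
    rewrite [X in X @ _ --> _](_ : _ = fun n => c * \int[P]_w p (X n w)).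
      by apply: cvgMr.
    by apply/funext => n; rewrite RintZ//; exact: L.
  - split; first exact: measurable_funD.
      by exists (M + N) => x; rewrite (le_trans (ler_normD _ _))// lerD.
    have bp : exists M : R, forall x, `|p x| <= M by exists M.
    have bq : exists M : R, forall x, `|q x| <= M by exists N.
    rewrite RintD; [|exact: L..].
    rewrite [X in X @ _ --> _](_ : _ = fun n => \int[P]_w p (X n w) + \int[P]_w q (X n w)).
      exact: cvgD.
    by apply/funext => n; rewrite RintD//; exact: L.
apply/cvg_in_distributionP => // f cf [M fM]; apply/cvgrPdist_le => e e0.
have M0 : 0 <= M := le_trans (normr_ge0 _) (fM 0).
have mf := continuous_measurable_fun cf.
(* Replacing [f] by [p] costs one fifth on the compact interval and one on the tail, under each of
   the two laws; the last fifth is the convergence for [p]. *)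
pose a := e / (5 * (2 * M + 1)).
have a0 : 0 < a by rewrite divr_gt0// mulr_gt0//; lra.
have aM : 2 * M * a <= e / 5.
  rewrite /a mulrA ler_pdivrMr ?mulr_gt0//; last by lra.
  by have : 0 <= M * e; [rewrite mulr_ge0// ltW|lra].
have [K1 K10 XK] := tX a a0; have [K2 K20 ZK] := tail_cvg0 Q mZ a0.
pose K := Num.max K1 K2.
have K0 : 0 < K by rewrite lt_max K10.
have e5 : 0 < e / 5 by rewrite divr_gt0.
have [p [tp pM fp]] := trigpoly_approx cf fM K0 e5.
have [mp _ /cvgrPdist_le/(_ _ e5)] := trig p tp.
have H d (S : measurableType d) (Pr : probability S R) (V : S -> R) K' :
    measurable_fun setT V -> K' <= K -> \int[Pr]_w \1_[set w | K' < `|V w|] w <= a ->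
    `|\int[Pr]_w f (V w) - \int[Pr]_w p (V w)| <= 2 * (e / 5).
  move=> mV K'K Va.
  have iA : L1 Pr (\1_[set w | K' < `|V w|] : S -> R) by exact/L1_indic/measurable_gt_norm.
  have := @Rint_dist _ _ _ Pr (f \o V) (p \o V)
    (fun w => e / 5 + 2 * M * \1_[set w | K' < `|V w|] w).
  rewrite RintD ?Rint_cst ?RintZ//; [|exact: L1_cst|exact: L1Z].
  move=> /(_ _ _ _ _)/le_trans; apply.
  - exact: L1_bounded_comp fM _.
  - exact: L1_bounded_comp pM _.
  - by apply: L1D; [exact: L1_cst|exact: L1Z].
  - move=> w; rewrite indicE; case: (boolP (w \in _)) => [_|].
      rewrite mulr1; apply: (le_trans (ler_normB _ _)).
      by have := fM (V w); have := pM (V w); rewrite /=; lra.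
    rewrite notin_setE/= => /negP; rewrite -leNgt => VK.
    by rewrite mulr0 addr0; apply: fp; exact: le_trans K'K.
  - have : 2 * M * \int[Pr]_w \1_[set w | K' < `|V w|] w <= 2 * M * a.
      by apply: ler_wpM2l => //; rewrite mulr_ge0.
    lra.
have KZ : `|\int[Q]_w f (Z w) - \int[Q]_w p (Z w)| <= 2 * (e / 5).
  by apply: (H _ _ _ _ K2) => //; rewrite /K le_max lexx orbT.
move: XK; apply: filterS2 => n XK XpZ /=.
have KX : `|\int[P]_w f (X n w) - \int[P]_w p (X n w)| <= 2 * (e / 5).
  by apply: (H _ _ _ _ K1) => //; rewrite /K le_max lexx.
have := ler_distD (\int[Q]_w p (Z w)) (\int[Q]_w f (Z w)) (\int[P]_w f (X n w)).
have := ler_distD (\int[P]_w p (X n w)) (\int[Q]_w p (Z w)) (\int[P]_w f (X n w)).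
rewrite (distrC (\int[P]_w p (X n w)) (\int[P]_w f (X n w))); lra.
Qed.

Lemma sqr_tail (V : T -> R) c K : measurable_fun setT V -> 0 < K ->
  L1 P (fun w => V w ^+ 2) -> \int[P]_w V w ^+ 2 <= c ->
  \int[P]_w \1_[set w | K < `|V w|] w <= c / K ^+ 2.
Proof.
move=> mV K0 iV Vc; rewrite ler_pdivlMr ?exprn_gt0//; apply: le_trans Vc.
rewrite mulrC -RintZ; last exact/L1_indic/measurable_gt_norm.
apply: Rint_le => //; first exact/L1Z/L1_indic/measurable_gt_norm.
move=> w; rewrite indicE; case: (boolP (w \in _)) => [|_].
  rewrite inE/= mulr1 => KV; rewrite -(real_normK (num_real (V w))).
  by rewrite ler_sqr ?nnegrE ?ltW// (lt_trans K0).
by rewrite mulr0 sqr_ge0.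
Qed.

Lemma cvg_in_probability0_scale X (c : nat -> R) :
  (forall n, measurable_fun setT (X n)) -> tight X -> c @ \oo --> (0 : R) ->
  cvg_in_probability0 (fun n w => c n * X n w).
Proof.
move=> mX tX c0 e e0; apply/cvgrPdist_le => a a0.
have [K K0 XK] := tX a a0.
have eK : 0 < e / K by rewrite divr_gt0.
move/cvgrPdist_le : c0 => /(_ _ eK).
move: XK; apply: filterS2 => n XK; rewrite !sub0r !normrN => cn.
rewrite ger0_norm; last first.
  by apply: Rint_ge0 => w; rewrite indicE ler0n.
apply: le_trans XK; apply: Rint_le.
- by apply/L1_indic/measurable_gt_norm/measurable_funM.
- exact/L1_indic/measurable_gt_norm.
- move=> w; rewrite !indicE ler_nat.
  case: (boolP (w \in [set w | e < _])) => //; rewrite inE/= normrM => h.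
  rewrite lt0b inE/= ltNge; apply/negP => XnK.
  have : `|c n| * `|X n w| <= e / K * K by apply: ler_pM.
  by rewrite divfK ?gt_eqF// leNgt h.
Qed.

End weak_convergence.

(** * The Gaussian characteristic function *)

Section gaussian_characteristic_function.
Context {R : realType}.
Local Notation mu := (@lebesgue_measure R).
Local Notation p := (normal_pdf (0 : R) 1).

Lemma normal_pdf01E (x : R) : p x = normal_peak 1 * expR (- (x ^+ 2 / 2)).
Proof.
rewrite normal_pdfE ?oner_eq0//= /normal_fun subr0 expr1n mulNr.
by rewrite mulr2n.
Qed.

Lemma is_derive_normal_pdf01 (x : R) : is_derive x (1 : R) (p : R -> R) (- x * p x).
Proof.
rewrite (_ : (p : R -> R) = fun x => normal_peak 1 * expR (- (x ^+ 2 / 2))); last first.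
  by apply/funext => y; exact: normal_pdf01E.
by apply: trigger_derive; rewrite /GRing.scale /=; field.
Qed.

Lemma is_derive_cos_affine (t a x : R) :
  is_derive t (1 : R) (fun s : R => cos (s * x + a)) (- sin (t * x + a) * x).
Proof. by apply: trigger_derive; rewrite /GRing.scale /=; ring. Qed.

Lemma is_derive_sin_affine (t a x : R) :
  is_derive x (1 : R) (fun y : R => sin (t * y + a)) (t * cos (t * x + a)).
Proof. by apply: trigger_derive; rewrite /GRing.scale /=; ring. Qed.

Lemma integrable_normM_normal_pdf01 :
  mu.-integrable setT (EFin \o (fun x => `|x| * p x)).
Proof.
have s2 : Num.sqrt 2 != 0 :> R by rewrite gt_eqF// sqrtr_gt0.
(* The dominating function is a multiple of the density of variance 2: half of the exponent absorbs
   [|x|], because [|x| <= 1 + x^2 / 4 <= expR (x^2 / 4)]. *)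
pose C : R := normal_peak 1 / normal_peak (Num.sqrt 2).
have pk (s : R) : s != 0 -> 0 < normal_peak s by exact: normal_peak_gt0.
have := integrableZl measurableT C (integrable_normal_pdf 0 (Num.sqrt 2 : R)).
apply: le_integrable => //.
  apply/measurable_EFinP; apply: measurable_funM; last exact: measurable_normal_pdf.
  exact: normr_measurable.
move=> x _; rewrite /= lee_fin ger0_norm; last by rewrite mulr_ge0// normal_pdf_ge0.
rewrite (le_trans _ (ler_norm _))// normal_pdf01E normal_pdfE//= /normal_fun subr0 sqr_sqrtr//.
rewrite [leRHS]mulrA /C divfK ?gt_eqF ?pk// mulrCA ler_pM2l ?pk ?oner_eq0//.
rewrite (_ : - (x ^+ 2 / 2) = - (x ^+ 2 / 4) + - (x ^+ 2 / 4)); last by field.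
rewrite (_ : - x ^+ 2 / _ = - (x ^+ 2 / 4)); last by rewrite mulNr; congr (- (_ / _)); ring.
rewrite expRD mulrA ler_piMl ?expR_ge0// expRN ler_pdivrMr ?expR_gt0// mul1r.
apply: (le_trans _ (expR_ge1Dx _)).
by rewrite -(real_normK (num_real x)); have := sqr_ge0 (`|x| - 2); nra.
Qed.

Lemma integrable_boundedM_normal_pdf01 (f : R -> R) M : measurable_fun setT f ->
  (forall x, `|f x| <= M) -> mu.-integrable setT (EFin \o (fun x => f x * p x)).
Proof.
move=> mf fM; have := integrableZl measurableT M (integrable_normal_pdf (0 : R) 1).
apply: le_integrable => //.
  by apply/measurable_EFinP; apply: measurable_funM => //; exact: measurable_normal_pdf.
move=> x _; rewrite /= lee_fin normrM (ger0_norm (normal_pdf_ge0 _ _ _)).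
by rewrite (le_trans _ (ler_norm _))// ler_wpM2r// normal_pdf_ge0.
Qed.

Lemma Rint_normal_prob01 (f : R -> R) M : measurable_fun setT f ->
  (forall x, `|f x| <= M) -> \int[normal_prob 0 1]_x f x = \int[mu]_x (f x * p x).
Proof.
move=> mf fM; congr fine.
have dom : normal_prob (0 : R) 1 `<< mu := @normal_prob_dominates R 0 1.
rewrite -(Radon_Nikodym_change_of_variables dom)//=; last first.
  exact: (@L1_bounded _ _ _ _ _ M).
apply: ae_eq_integral => //.
- apply: emeasurable_funM; first exact/measurable_EFinP.
  by apply: (measurable_int mu); exact: Radon_Nikodym_integrable.
- apply/measurable_EFinP; apply: measurable_funM => //; exact: measurable_normal_pdf.
under [X in ae_eq _ _ _ X]eq_fun do rewrite EFinM.
apply: ae_eqe_mul2l => /=.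
rewrite Radon_NikodymE//=; case: cid => /= h [h1 h2 h3].
apply: integral_ae_eq => //=.
- by apply/measurable_EFinP; exact: measurable_normal_pdf.
- by move=> E _ mE; rewrite -h3.
Qed.

(** Integrates the derivative of [sin (t x + a) * p x]: the fundamental theorem on growing intervals
    leaves boundary terms that vanish, and dominated convergence gives the integral over the
    line. *)
Lemma Rint_normal_byparts (t a : R) :
  \int[mu]_x (- (sin (t * x + a) * x) * p x) = - t * \int[mu]_x (cos (t * x + a) * p x).
Proof.
pose F x : R := sin (t * x + a) * p x.
pose f1 x : R := - (sin (t * x + a) * x) * p x.
pose f2 x : R := cos (t * x + a) * p x.
pose f x := f1 x + t * f2 x.
have mp := @measurable_normal_pdf R 0 1.
have mlin : measurable_fun setT (fun x : R => t * x + a).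
  by apply: measurable_funD => //; exact: measurable_funM.
have msin : measurable_fun setT (fun x : R => sin (t * x + a)).
  exact: (measurableT_comp (continuous_measurable_fun (@continuous_sin R))).
have mcos : measurable_fun setT (fun x : R => cos (t * x + a)).
  exact: (measurableT_comp (continuous_measurable_fun (@continuous_cos R))).
have if1 : mu.-integrable setT (EFin \o f1).
  apply: (le_integrable _ _ _ integrable_normM_normal_pdf01) => //.
    apply/measurable_EFinP; apply: measurable_funM => //.
    by apply: measurableT_comp => //; exact: measurable_funM.
  move=> x _; rewrite /= lee_fin /f1 !normrM normrN normrM normr_id ler_wpM2r//.
  by rewrite ler_piMl// ler_norml sin_geN1 sin_le1.
have if2 : mu.-integrable setT (EFin \o f2).
  by apply: (@integrable_boundedM_normal_pdf01 _ 1) => // x; rewrite ler_norml cos_geN1 cos_le1.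
have itf2 : mu.-integrable setT (EFin \o (fun x => t * f2 x)).
  exact: (integrableZl measurableT t if2).
have if_ : mu.-integrable setT (EFin \o f) by exact: (integrableD measurableT if1 itf2).
have dF (x : R) : is_derive x (1 : R) (F : R -> R) (f x).
  have D1 := is_derive_sin_affine t a x; have D2 := is_derive_normal_pdf01 x.
  have D : is_derive x (1 : R) (F : R -> R) _ := is_deriveM D1 D2.
  by apply: (is_derive_eq D); rewrite /GRing.scale/= /f /f1 /f2; ring.
have cf : continuous f.
  move=> x; apply: cvgD; last apply: cvgM; first apply: cvgM.
  - apply: cvgN; apply: cvgM => //.
    apply: (cvg_comp (fun x => t * x + a) sin); last exact: continuous_sin.
    by apply: cvgD; [apply: cvgM => //; exact: cvg_cst|exact: cvg_cst].
  - exact: continuous_normal_pdf.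
  - exact: cvg_cst.
  - apply: cvgM; last exact: continuous_normal_pdf.
    apply: (cvg_comp (fun x => t * x + a) cos); last exact: continuous_cos.
    by apply: cvgD; [apply: cvgM => //; exact: cvg_cst|exact: cvg_cst].
have FTC n : (\int[mu]_(x in `[(- n.+1%:R)%R, n.+1%:R%R]) (f x)%:E =
    (F n.+1%:R - F (- n.+1%:R))%R%:E)%E.
  rewrite EFinB; apply: continuous_FTC2.
  - by rewrite gtrN.
  - exact: continuous_subspaceT.
  - have dFx x : derivable F x 1 by have [] := dF x.
    have cF x : {for x, continuous F}.
      exact/differentiable_continuous/derivable1_diffP.
    split => //.
    + exact/cvg_at_right_filter/cF.
    + exact/cvg_at_left_filter/cF.
  - by move=> x _; rewrite derive1E; have [_ ->] := dF x.
have F0 : (F n.+1%:R - F (- n.+1%:R)) @[n --> \oo] --> (0 : R).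
  have harm : 4 * normal_peak 1 * harmonic n @[n --> \oo] --> (0 : R).
    by rewrite -[X in _ --> X](mulr0 (4 * normal_peak 1)); apply: cvgMr; exact: cvg_harmonic.
  apply/norm_cvg0P; apply: (squeeze_cvgr _ (cvg_cst 0) harm); apply: nearW => n.
  rewrite normr_ge0 /harmonic/=.
  have m0 : 0 < n.+1%:R :> R by rewrite ltr0n.
  (* With [m = n + 1], the crude bound [expR (m^2 / 2) >= m / 2] already makes the boundary terms
     O(1 / m). *)
  have pm : p n.+1%:R <= normal_peak 1 * (2 * n.+1%:R^-1).
    rewrite normal_pdf01E ler_wpM2l ?normal_peak_ge0// expRN.
    rewrite -[leRHS]invrK lef_pV2 ?posrE ?expR_gt0 ?invr_gt0 ?mulr_gt0 ?invr_gt0//.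
    apply: (le_trans _ (expR_ge1Dx _)); rewrite invfM invrK.
    have : 1 <= n.+1%:R :> R by rewrite ler1n.
    by nra.
  have pN : p (- n.+1%:R) = p n.+1%:R by rewrite !normal_pdf01E sqrrN.
  apply: (le_trans (ler_normB _ _)); rewrite /F !normrM pN !(ger0_norm (normal_pdf_ge0 _ _ _)).
  have sin1 (y : R) : `|sin y| <= 1 by rewrite ler_norml sin_geN1 sin_le1.
  have p0 : 0 <= p n.+1%:R := normal_pdf_ge0 _ _ _.
  rewrite (_ : 4 * normal_peak 1 / n.+1%:R =
    normal_peak 1 * (2 * n.+1%:R^-1) + normal_peak 1 * (2 * n.+1%:R^-1)); last by field.
  by apply: lerD; apply: le_trans pm; rewrite ler_piMl.
have DC : \int[mu]_(x in `[- n.+1%:R, n.+1%:R]) f x @[n --> \oo] --> \int[mu]_x f x.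
  have mf : measurable_fun setT f by exact: continuous_measurable_fun.
  have mI n : measurable (`[- n.+1%:R, n.+1%:R] : set R) by exact: measurable_itv.
  have [] := @dominated_convergence _ _ _ mu _ measurableT
    (fun n x => ((f \_ `[- n.+1%:R, n.+1%:R]) x)%:E) (fun x => (f x)%:E)
    (fun x => `|f x|%:E).
  - move=> n; apply/measurable_EFinP.
    by apply/(measurable_restrictT _ _).1 => //; exact: measurable_funTS.
  - exact/measurable_EFinP.
  - apply: aeW => x _; apply: cvg_near_cst.
    exists (Num.truncn `|x|) => // n /= nx.
    rewrite patchE mem_set//= in_itv/= -ler_norml ltW// (lt_le_trans (truncnS_gt _))//.
    by rewrite ler_nat.
  - exact: integrable_norm.
  - apply: aeW => x n _; rewrite lee_fin patchE; case: ifP => // _.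
    by rewrite normr0.
  move=> _ _; rewrite -(@fineK _ (\int[mu]_x (f x)%:E)%E); last exact: integrable_fin_num.
  move=> /fine_cvg; rewrite [X in X @ _ --> _ -> _](_ : _ = fun n =>
      \int[mu]_(x in `[- n.+1%:R, n.+1%:R]) f x)//.
  by apply/funext => n; rewrite Rintegral_mkcond.
have : \int[mu]_x f x = 0.
  move: DC; rewrite [X in X @ _ --> _ -> _](_ : _ = fun n => F n.+1%:R - F (- n.+1%:R)).
    by move=> DC; rewrite -(cvg_lim (@norm_hausdorff _ R^o) DC) (cvg_lim (@norm_hausdorff _ R^o) F0).
  by apply/funext => n; rewrite /Rintegral FTC.
rewrite /f RintegralD// RintegralZl//.
by move/eqP; rewrite addr_eq0 => /eqP ->; rewrite mulNr.
Qed.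

(** Differentiation under the integral, dominated by [|x| * p x], followed by integration by parts
    yields a linear differential equation in [t]. The phase [a] is carried along unchanged. *)
Lemma Rint_normal_cos (t a : R) :
  \int[normal_prob 0 1]_x cos (t * x + a) = expR (- (t ^+ 2 / 2)) * cos a.
Proof.
have mcos s : measurable_fun setT (fun x : R => cos (s * x + a)).
  apply: (measurableT_comp (continuous_measurable_fun (@continuous_cos R))).
  by apply: measurable_funD => //; exact: measurable_funM.
have cos1 s x : `|cos (s * x + a)| <= 1 :> R by rewrite ler_norml cos_geN1 cos_le1.
rewrite (@Rint_normal_prob01 _ 1)//.
pose F s : R := \int[mu]_x (cos (s * x + a) * p x).
pose f s x : R := cos (s * x + a) * p x.
have d1f s x : is_derive s (1 : R) (fun s : R => f s x) (- (sin (s * x + a) * x) * p x).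
  have D1 := is_derive_cos_affine s a x; have D2 := is_derive_cst (p x) s (1 : R).
  have D : is_derive s (1 : R) (f ^~ x : R -> R) _ := is_deriveM D1 D2.
  by apply: (is_derive_eq D); rewrite /GRing.scale/=; ring.
have pE s x : partial1of2 f s x = - (sin (s * x + a) * x) * p x.
  by rewrite partial1of2E; have [_ ->] := d1f s x.
have dF s : is_derive s (1 : R) (F : R -> R) (- s * F s).
  have I : (`]s - 1, s + 1[%classic : set R) s by rewrite /= in_itv/=; apply/andP; split; lra.
  have int1 x : `]s - 1, s + 1[%classic x -> mu.-integrable setT (EFin \o f x).
    by move=> _; apply: (@integrable_boundedM_normal_pdf01 _ 1).
  have der1 (x y : R) : `]s - 1, s + 1[%classic x -> setT y -> derivable (f ^~ y) x 1.
    by move=> _ _; have [] := d1f x y.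
  have G0 (y : R) : 0 <= `|y| * p y by rewrite mulr_ge0// normal_pdf_ge0.
  have Gub (x y : R) : `]s - 1, s + 1[%classic x -> setT y ->
      `|partial1of2 f x y| <= `|y| * p y.
    move=> _ _; rewrite pE normrM normrN normrM (ger0_norm (normal_pdf_ge0 _ _ _)).
    by rewrite ler_wpM2r ?normal_pdf_ge0// ler_piMl// ler_norml sin_geN1 sin_le1.
  apply: DeriveDef.
    exact: (derivable_under_integral measurableT I int1 der1 G0 integrable_normM_normal_pdf01 Gub).
  rewrite -derive1E.
  rewrite (differentiation_under_integral measurableT I int1 der1 G0
    integrable_normM_normal_pdf01 Gub).
  rewrite -Rint_normal_byparts; apply: eq_Rintegral => x _; exact: pE.
(* The equation [F' s = - s * F s] makes [F s * expR (s ^+ 2 / 2)] constant. *)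
pose H s : R := F s * expR (s ^+ 2 / 2).
have dH (s : R) : is_derive s (1 : R) (H : R -> R) 0.
  have D1 := dF s.
  have D2 : is_derive s (1 : R) (fun s : R => expR (s ^+ 2 / 2)) (s * expR (s ^+ 2 / 2)).
    by apply: trigger_derive; rewrite /GRing.scale /=; field.
  have D : is_derive s (1 : R) (H : R -> R) _ := is_deriveM D1 D2.
  by apply: (is_derive_eq D); rewrite /GRing.scale/=; ring.
have := is_derive_0_is_cst t 0 dH.
rewrite /H expr0n/= mul0r expR0 mulr1 => Ht.
have F0 : F 0 = cos a.
  rewrite /F (_ : (fun x => _) = fun x => cos a * p x); last first.
    by apply/funext => x; rewrite mul0r add0r.
  rewrite RintegralZl//; last exact: integrable_normal_pdf.
  by rewrite /Rintegral integral_normal_pdf mulr1.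
rewrite -[LHS]/(F t) -F0 -Ht /H mulrCA -expRD addNr expR0 mulr1//.
Qed.

End gaussian_characteristic_function.

(** * Independence *)

Section independence.
Context d (T : measurableType d) (R : realType) (P : probability T R).
Local Open Scope ereal_scope.

Definition independent_systems (G H : set (set T)) :=
  forall A B, G A -> H B -> P (A `&` B) = P A * P B.

Lemma independent_systemsC G H : independent_systems G H -> independent_systems H G.
Proof. by move=> GH A B HA GB; rewrite setIC GH// muleC. Qed.

(** Dynkin's argument: for a fixed [B], the events independent of [B] form a Dynkin system, and [G]
    is stable under intersection. *)
Lemma independent_sigma_l (G H : set (set T)) : setI_closed G ->
  G `<=` measurable -> H `<=` measurable -> independent_systems G H ->
  independent_systems <<s G >> H.
Proof.
move=> GI mG mH GH A B; rewrite -setI_closed_g_dynkin_g_sigma_algebra// => sA HB.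
have mB := mH _ HB.
suff [] : measurable A /\ P (A `&` B) = P A * P B by [].
apply: (sA [set C | measurable C /\ P (C `&` B) = P C * P B]); split; last first.
  by move=> C GC; split; [exact: mG|exact: GH].
have PBfin : P B \is a fin_num by exact: fin_num_measure.
split => [|C [mC CB]|F tF FP].
- by split => //; rewrite setTI probability_setT mul1e.
- split; first exact: measurableC.
  have PCfin : P C \is a fin_num by exact: fin_num_measure.
  have -> : P (~` C `&` B) = P B - P C * P B.
    by rewrite -CB (setIC (~` C)) -setDE measureD// ?ltey_eq ?PBfin// (setIC B).
  rewrite probability_setC//; move: PCfin PBfin; case: (P C) => [c| |] //; case: (P B) => [b| |] // _ _.
  by apply: (congr1 EFin); ring.
- have mF n : measurable (F n) by have [] := FP n.
  split; first exact: bigcup_measurable.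
  rewrite setI_bigcupl !measure_bigcup//; last 2 first.
  + by move=> n _; exact: measurableI.
  + exact: trivIset_setIr.
  have -> : P B = (fine (P B))%:E by rewrite fineK.
  rewrite muleC -nneseriesZl; last by move=> n _; rewrite measure_ge0.
  by apply: eq_eseriesr => n _; rewrite muleC fineK//; have [] := FP n.
Qed.

Lemma independent_sigma (G H : set (set T)) : setI_closed G -> setI_closed H ->
  G `<=` measurable -> H `<=` measurable -> independent_systems G H ->
  independent_systems <<s G >> <<s H >>.
Proof.
move=> GI HI mG mH GH.
have mG' : <<s G >> `<=` measurable.
  by apply: smallest_sub => //; exact: sigma_algebra_measurable.
apply/independent_systemsC/independent_sigma_l => //.
exact/independent_systemsC/independent_sigma_l.
Qed.

End independence.

Section independent_fubini.
Context d d1 d2 (T : measurableType d) (T1 : measurableType d1)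
  (T2 : measurableType d2) (R : realType) (P : probability T R)
  (X : T -> T1) (Y : T -> T2)
  (mX : measurable_fun setT X) (mY : measurable_fun setT Y).

Let XY w := (X w, Y w).
Let mXY : measurable_fun setT XY.
Proof. exact: measurable_fun_pair. Qed.

Let X_mixin := isMeasurableFun.Build _ _ _ _ _ mX.
Let Xm : {mfun T >-> T1} := HB.pack X X_mixin.
Let Y_mixin := isMeasurableFun.Build _ _ _ _ _ mY.
Let Ym : {mfun T >-> T2} := HB.pack Y Y_mixin.
Let XY_mixin := isMeasurableFun.Build _ _ _ _ _ mXY.
Let XYm : {mfun T >-> (T1 * T2)%type} := HB.pack XY XY_mixin.

(** Tonelli in the role of conditioning: agreement on rectangles identifies the law of the pair with
    the product law, and then [X w] is frozen while [Y] is averaged over a second point [w']. *)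
Lemma ge0_integral_independent (F : T1 * T2 -> \bar R) :
  (forall A B, measurable A -> measurable B ->
    P (X @^-1` A `&` Y @^-1` B) = P (X @^-1` A) * P (Y @^-1` B))%E ->
  measurable_fun setT F -> (forall z, 0 <= F z)%E ->
  (\int[P]_w F (X w, Y w) = \int[P]_w \int[P]_w' F (X w, Y w'))%E.
Proof.
move=> indXY mF F0.
transitivity (\int[distribution P XYm]_z F z)%E.
  by rewrite ge0_integral_distribution.
rewrite (eq_measure_integral (distribution P Xm \x distribution P Ym)%E); last first.
  move=> A mA _; apply/esym; apply: product_measure_unique => //; exact: indXY.
rewrite fubini_tonelli1// ge0_integral_distribution//.
- apply: eq_integral => w _ /=; rewrite /fubini_F.
  by rewrite ge0_integral_distribution//; exact: measurableT_comp.
- exact: measurable_fun_fubini_tonelli_F.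
- by move=> x; apply: integral_ge0.
Qed.

End independent_fubini.

(** * The uniform law on the sphere *)

Section sphere.
Context {R : realType} (d : nat).
Implicit Types (s u v : 'rV[R]_d).

Definition dotrv s u : R := \sum_(j < d) s ord0 j * u ord0 j.

Lemma dotrvE s u : dotrv s u = (u *m s^T) ord0 ord0.
Proof. by rewrite mxE; apply: eq_bigr => j _; rewrite mxE mulrC. Qed.

Lemma dotrv_sqr s : dotrv s s = \sum_(j < d) s ord0 j ^+ 2.
Proof. by apply: eq_bigr => j _; rewrite expr2. Qed.

(** The reflection in the hyperplane orthogonal to [s - s'] exchanges two vectors of equal norm.
    With O(d)-invariance, this makes the law of the product of [s] with a uniform direction depend
    on the norm of [s] only. *)
Lemma householder s s' : dotrv s s = dotrv s' s' ->
  exists2 Q : 'M[R]_d, Q *m Q^T = 1%:M & forall u, dotrv s (u *m Q) = dotrv s' u.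
Proof.
move=> ss; have [<-|ne] := eqVneq s s'.
  by exists 1%:M => [|u]; rewrite ?trmx1 mulmx1.
pose v := s - s'; pose c := (v *m v^T) ord0 ord0.
have vv : v *m v^T = c%:M by exact: mx11_scalar.
(* Equality of the norms gives [<v, v> = 2 <s, v>], hence the reflection sends [s] to
   [s - v = s']. *)
have cE : c = 2 * (s *m v^T) ord0 ord0.
  have cs : s *m s'^T = s' *m s^T.
    by apply/matrixP => i j; rewrite !mxE; apply: eq_bigr => k _; rewrite !mxE mulrC !ord1.
  move: ss; rewrite !dotrvE => ss.
  rewrite /c /v linearB/= mulmxBl !mulmxBr cs.
  have B11 (A B : 'M[R]_1) : (A - B) ord0 ord0 = A ord0 ord0 - B ord0 ord0 by rewrite !mxE.
  by rewrite !B11 -ss; ring.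
have c0 : c != 0.
  rewrite /c -dotrvE dotrv_sqr psumr_eq0; last by move=> j _; exact: sqr_ge0.
  apply: contraNN ne => /allP h; rewrite -subr_eq0; apply/eqP/rowP => j.
  by have := h j (mem_index_enum _); rewrite sqrf_eq0 /v !mxE => /eqP.
pose Q : 'M[R]_d := 1%:M - (2 / c) *: (v^T *m v).
have QT : Q^T = Q by rewrite /Q linearB/= linearZ/= trmx1 trmx_mul trmxK.
have sQ : s *m Q = s'.
  rewrite /Q mulmxBr mulmx1 -scalemxAr mulmxA [s *m v^T]mx11_scalar mul_scalar_mx scalerA.
  rewrite (_ : 2 / c * _ = 1) ?scale1r ?subKr// cE mulrAC divff// -cE//.
exists Q => [|u].
  rewrite QT; set W := v^T *m v in Q QT sQ *; set a := 2 / c in Q QT sQ *.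
  (* [W / c] is the projection onto the line of [v], so the symmetric matrix [1 - (2 / c) W] squares
     to the identity. *)
  have WW : W *m W = c *: W.
    by rewrite /W mulmxA -(mulmxA v^T v v^T) vv mul_mx_scalar -scalemxAl.
  have aac : a * (a * c) = a + a by rewrite /a; field.
  rewrite /Q mulmxBl !mulmxBr !mul1mx mulmx1 -!scalemxAl -!scalemxAr WW !scalerA.
  by rewrite -mulrA aac scalerDl opprB addrK subrK.
by rewrite !dotrvE -mulmxA -{1}QT -trmx_mul sQ.
Qed.

Lemma measurable_coord (j : 'I_d) :
  measurable_fun setT (fun u : borel_rV R d => (u : 'rV[R]_d) ord0 j).
Proof.
apply: (measurability _ (RGenOpens.measurableE R)).
move=> _ [_ [a [b ->] <-]]; rewrite setTI.
apply: sub_sigma_algebra.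
have := @coord_continuous R 1 d ord0 j => /continuousP; apply; exact: interval_open.
Qed.

Lemma measurable_dotrv s : measurable_fun setT (fun u : borel_rV R d => dotrv s u).
Proof.
apply: measurable_sum => j; apply: measurable_funM => //; exact: measurable_coord.
Qed.

Context (mu : probability (borel_rV R d) R) (mu_unif : uniform_on_sphere mu).

Lemma sphere_dotrv_law s s' (A : set R) : measurable A -> dotrv s s = dotrv s' s' ->
  mu [set u | A (dotrv s u)] = mu [set u | A (dotrv s' u)].
Proof.
move=> mA /householder[Q Q1 sQ]; have [_ /(_ Q Q1)] := mu_unif.
move=> /(_ [set u | A (dotrv s u)]) <-.
  by congr (mu _); apply/funext => u /=; rewrite sQ.
by have := measurable_dotrv s measurableT mA; rewrite setTI.
Qed.

Lemma ge0_integral_sphere_dotrv s s' (f : R -> \bar R) : measurable_fun setT f ->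
  (forall x, 0 <= f x)%E -> dotrv s s = dotrv s' s' ->
  (\int[mu]_u f (dotrv s u) = \int[mu]_u f (dotrv s' u))%E.
Proof.
move=> mf f0 ss.
pose X t : {mfun borel_rV R d >-> R} :=
  HB.pack (fun u => dotrv t u) (isMeasurableFun.Build _ _ _ _ _ (measurable_dotrv t)).
have E t : (\int[mu]_u f (dotrv t u) = \int[distribution mu (X t)]_x f x)%E.
  by rewrite ge0_integral_distribution.
rewrite !E; apply: eq_measure_integral => A mA _.
exact: sphere_dotrv_law.
Qed.

Lemma Rint_sphere_dotrv s s' (f : R -> R) : measurable_fun setT f ->
  (forall x, 0 <= f x) -> dotrv s s = dotrv s' s' ->
  \int[mu]_u f (dotrv s u) = \int[mu]_u f (dotrv s' u).
Proof.
move=> mf f0 ss; congr fine.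
by apply: (@ge0_integral_sphere_dotrv s s' (EFin \o f)) => //; exact/measurable_EFinP.
Qed.

Lemma sphere_ae : {ae mu, forall u : borel_rV R d, dotrv u u = 1}.
Proof.
have [mu1 _] := mu_unif.
have mS : measurable [set u : borel_rV R d | dotrv u u = 1].
  have m : measurable_fun setT (fun u : borel_rV R d => dotrv u u).
    by apply: measurable_sum => j; apply: measurable_funM; exact: measurable_coord.
  by have := m measurableT [set 1] (measurable_set1 _); rewrite setTI.
have S1 : [set u : borel_rV R d | enorm u = 1] = [set u | dotrv u u = 1].
  apply/seteqP; split => u /=; rewrite /enorm -dotrv_sqr.
    move=> u1; have u0 : 0 <= dotrv u u by rewrite dotrv_sqr sumr_ge0// => j _; exact: sqr_ge0.
    by rewrite -(sqr_sqrtr u0) u1 expr1n.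
  by move=> ->; exact: sqrtr1.
exists (~` [set u | dotrv u u = 1]); split => //; first exact: measurableC.
by rewrite probability_setC// -S1 mu1 subee.
Qed.

Lemma L1_ae_bounded (f : borel_rV R d -> R) M : measurable_fun setT f -> 0 <= M ->
  {ae mu, forall u, `|f u| <= M} -> L1 mu f.
Proof.
move=> mf M0 fM; apply/integrableP; split; first exact/measurable_EFinP.
apply: (@le_lt_trans _ _ (M%:E * mu setT)%E); last by rewrite probability_setT mule1 ltry.
apply: integral_le_bound => //; first exact/measurable_EFinP.
by near=> u => _; rewrite lee_fin; near: u.
Unshelve. all: by end_near.
Qed.

(** Polynomials in the coordinates are unbounded on the whole space, but almost every point has all
    its coordinates bounded by 1. *)
Lemma L1_sphere_poly (f : borel_rV R d -> R) M : measurable_fun setT f -> 0 <= M ->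
  (forall u, (forall j, `|(u : 'rV[R]_d) ord0 j| <= 1) -> `|f u| <= M) -> L1 mu f.
Proof.
move=> mf M0 fM; apply: (@L1_ae_bounded _ M) => //.
apply: filterS sphere_ae => u u1; apply: fM => j.
rewrite -(@expr_le1 _ 2)// real_normK ?num_real// -u1 dotrv_sqr (bigD1 j)//=.
by rewrite lerDl sumr_ge0// => k _; exact: sqr_ge0.
Qed.

Lemma dotrv_le s u : (forall j, `|u ord0 j| <= 1) -> `|dotrv s u| <= \sum_j `|s ord0 j|.
Proof.
move=> u1; apply: (le_trans (ler_norm_sum _ _ _)); apply: ler_sum => j _.
by rewrite normrM ler_piMr.
Qed.

Lemma L1_dotrvX s p : L1 mu (fun u : borel_rV R d => dotrv s u ^+ p).
Proof.
apply: (@L1_sphere_poly _ ((\sum_j `|s ord0 j|) ^+ p)).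
- by apply: measurable_funX; exact: measurable_dotrv.
- by rewrite exprn_ge0// sumr_ge0.
- by move=> u u1; rewrite normrX lerXn2r ?nnegrE ?normr_ge0 ?sumr_ge0// dotrv_le.
Qed.

Local Notation e_ j := (delta_mx ord0 j : 'rV[R]_d).

Lemma dotrv_delta j u : dotrv (e_ j) u = u ord0 j.
Proof.
rewrite /dotrv (bigD1 j)//= mxE !eqxx mul1r big1 ?addr0// => k kj.
by rewrite mxE eqxx (negbTE kj) mul0r.
Qed.

Lemma dotrvZ a s u : dotrv (a *: s) u = a * dotrv s u.
Proof. by rewrite /dotrv mulr_sumr; apply: eq_bigr => j _; rewrite mxE mulrA. Qed.

Lemma dotrvD s s' u : dotrv (s + s') u = dotrv s u + dotrv s' u.
Proof. by rewrite /dotrv -big_split; apply: eq_bigr => j _; rewrite mxE mulrDl. Qed.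

Lemma dotrvN s u : dotrv (- s) u = - dotrv s u.
Proof. by rewrite -scaleN1r dotrvZ mulN1r. Qed.

Lemma dotrvC s u : dotrv s u = dotrv u s.
Proof. by apply: eq_bigr => j _; rewrite mulrC. Qed.

(** [dotrv s] has the law of a coordinate scaled by the norm of [s]. An even power keeps the
    integrand nonnegative, as the transfer of laws requires. *)
Lemma sphere_moment_delta s j p : ~~ odd p ->
  \int[mu]_u dotrv s u ^+ p = Num.sqrt (dotrv s s) ^+ p * \int[mu]_u u ord0 j ^+ p.
Proof.
move=> pe.
have s0 : 0 <= dotrv s s by rewrite dotrv_sqr sumr_ge0// => k _; exact: sqr_ge0.
pose a := Num.sqrt (dotrv s s).
have -> : \int[mu]_u dotrv s u ^+ p = \int[mu]_u dotrv (a *: e_ j) u ^+ p.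
  apply: (@Rint_sphere_dotrv s (a *: e_ j) (fun x => x ^+ p)).
  - exact: measurable_funX.
  - by move=> x; rewrite exprn_even_ge0.
  - by rewrite dotrvZ dotrvC dotrvZ dotrv_delta mxE !eqxx mulr1 -expr2 sqr_sqrtr.
under eq_Rintegral do rewrite dotrvZ exprMn dotrv_delta.
rewrite RintZ//; have := L1_dotrvX (e_ j) p.
by under eq_fun do rewrite dotrv_delta.
Qed.

(** The [d] coordinates have equal second moments, which sum to 1 on the sphere. *)
Lemma sphere_moment2 s : (0 < d)%N ->
  \int[mu]_u dotrv s u ^+ 2 = dotrv s s / d%:R.
Proof.
move=> d0; pose j0 : 'I_d := Ordinal d0.
pose m := \int[mu]_u u ord0 j0 ^+ 2.
have s0 : 0 <= dotrv s s by rewrite dotrv_sqr sumr_ge0// => k _; exact: sqr_ge0.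
have mE j : \int[mu]_u u ord0 j ^+ 2 = m.
  have := @sphere_moment_delta (e_ j) j0 2 isT.
  rewrite dotrv_delta mxE !eqxx sqrtr1 expr1n mul1r.
  by under eq_Rintegral do rewrite dotrv_delta.
have L j : L1 mu (fun u : borel_rV R d => u ord0 j ^+ 2).
  by have := L1_dotrvX (e_ j) 2; under eq_fun do rewrite dotrv_delta.
have dm : d%:R * m = 1.
  have : \int[mu]_u (\sum_j u ord0 j ^+ 2) = 1.
    rewrite -(Rint_cst mu 1); apply: Rint_ae => //.
      apply: measurable_sum => j; apply: measurable_funX; exact: measurable_coord.
    by apply: filterS sphere_ae => u; rewrite dotrv_sqr.
  rewrite Rint_sum; last exact: L.
  by under eq_bigr do rewrite mE; rewrite sumr_const card_ord -[X in X = _]mulr_natl.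
rewrite (@sphere_moment_delta s j0)// sqr_sqrtr// -/m.
have dn0 : d%:R != 0 :> R by rewrite pnatr_eq0 -lt0n.
by congr (_ * _); apply: (mulfI dn0); rewrite dm divff.
Qed.

(** The exact value is 3 / (d (d + 2)). Bounding each of the d^2 terms of [E |u|^4 = 1] below by a
    third of the fourth moment of a coordinate is a shortcut to 3 / d^2, diagonal terms included. *)
Lemma sphere_moment4 : (0 < d)%N -> exists2 m4 : R, 0 <= m4 <= 3 / d%:R ^+ 2 &
  forall s, \int[mu]_u dotrv s u ^+ 4 = dotrv s s ^+ 2 * m4.
Proof.
move=> d0; pose j0 : 'I_d := Ordinal d0.
pose m := \int[mu]_u u ord0 j0 ^+ 4.
have s0 s : 0 <= dotrv s s by rewrite dotrv_sqr sumr_ge0// => k _; exact: sqr_ge0.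
have mE j : \int[mu]_u u ord0 j ^+ 4 = m.
  have := @sphere_moment_delta (e_ j) j0 4 isT.
  rewrite dotrv_delta mxE !eqxx sqrtr1 expr1n mul1r.
  by under eq_Rintegral do rewrite dotrv_delta.
have m0 : 0 <= m by apply: Rint_ge0 => u; rewrite exprn_even_ge0.
have L j : L1 mu (fun u : borel_rV R d => u ord0 j ^+ 4).
  by have := L1_dotrvX (e_ j) 4; under eq_fun do rewrite dotrv_delta.
have Lij i j : L1 mu (fun u : borel_rV R d => u ord0 i ^+ 2 * u ord0 j ^+ 2).
  apply: (@L1_sphere_poly _ 1) => //.
    by apply: measurable_funM; apply: measurable_funX; exact: measurable_coord.
  by move=> u u1; rewrite normrM !normrX mulr_ile1 ?exprn_ge0// exprn_ile1.
(* The vectors [e_i + e_j] and [e_i - e_j] have squared norm 2, so their fourth moments are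
   [4 * m]; adding the two expansions gives [E u_i^2 u_j^2 = m / 3] off the diagonal. *)
have mij i j : m / 3 <= \int[mu]_u (u ord0 i ^+ 2 * u ord0 j ^+ 2).
  have [->|ij] := eqVneq i j.
    under eq_Rintegral do rewrite -exprD.
    by rewrite mE; lra.
  have dd (a : R) : a ^+ 2 = 1 -> dotrv (e_ i + a *: e_ j) (e_ i + a *: e_ j) = 2.
    move=> a2; rewrite dotrvD dotrvZ !dotrv_delta !mxE !eqxx (negbTE ij) eq_sym (negbTE ij).
    by rewrite mulr0 mulr1 addr0 add0r -expr2 a2.
  have q (a : R) : a ^+ 2 = 1 -> \int[mu]_u (dotrv (e_ i + a *: e_ j) u ^+ 4) = 4 * m.
    move=> a2; rewrite (@sphere_moment_delta _ j0)// dd//.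
    by rewrite (exprM _ 2 2) sqr_sqrtr//; congr (_ * _); ring.
  have q1 := q 1 (expr1n _ _); have qN := q (-1) (etrans (sqrrN 1) (expr1n _ _)).
  have : \int[mu]_u (dotrv (e_ i + 1 *: e_ j) u ^+ 4 + dotrv (e_ i + (-1) *: e_ j) u ^+ 4)
      = \int[mu]_u (12 * (u ord0 i ^+ 2 * u ord0 j ^+ 2) + (2 * u ord0 i ^+ 4 + 2 * u ord0 j ^+ 4)).
    by apply: eq_Rintegral => u _; rewrite !dotrvD !dotrvZ !dotrv_delta; ring.
  rewrite RintD; [|exact: L1_dotrvX..].
  rewrite RintD; [|exact: L1Z|by apply: L1D; exact: L1Z].
  rewrite RintD; [|exact: L1Z|exact: L1Z].
  rewrite !RintZ// !mE q1 qN; lra.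
have dm : d%:R ^+ 2 * (m / 3) <= 1.
  have : \int[mu]_u (\sum_i \sum_j u ord0 i ^+ 2 * u ord0 j ^+ 2) = 1.
    rewrite -(Rint_cst mu 1); apply: Rint_ae => //.
      do 2 (apply: measurable_sum => ?).
      by apply: measurable_funM; apply: measurable_funX; exact: measurable_coord.
    apply: filterS sphere_ae => u; rewrite dotrv_sqr => u1.
    by under eq_bigr do rewrite -mulr_sumr u1 mulr1.
  rewrite Rint_sum; last by move=> i; apply: L1_sum => j; exact: Lij.
  under eq_bigr do (rewrite Rint_sum; last exact: Lij).
  move=> e1; rewrite -[leRHS]e1.
  apply: (@le_trans _ _ (\sum_(i < d) \sum_(j < d) (m / 3))).
    by rewrite !sumr_const !card_ord -mulrnA -[leRHS]mulr_natl natrM expr2.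
  by apply: ler_sum => i _; apply: ler_sum => j _; exact: mij.
exists m; last first.
  by move=> s; rewrite (@sphere_moment_delta s j0)// (exprM _ 2 2) sqr_sqrtr.
have d2 : 0 < d%:R ^+ 2 :> R by rewrite exprn_gt0// ltr0n.
by rewrite m0 ler_pdivlMr//; lra.
Qed.

End sphere.

(** * The past of the walk *)

Section past.
Context dT (T : measurableType dT) (R : realType) (P : probability T R) (d : nat)
  (Rs : nat -> {RV P >-> R}) (U : nat -> {RV P >-> borel_rV R d}).

(** A pi-system for the first [a] radii and the first [b] directions. Two indices are kept because
    [Rs k] is revealed before [U k]: given the past of type (k + 1, k), the increment is linear in
    the fresh direction. *)
Definition past_cylinder (a b : nat) : set (set T) := [set C | exists A B,
  [/\ forall i, measurable (A i), forall i, measurable (B i) &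
   C = [set w | forall i, (i < a)%N -> A i (Rs i w)] `&`
       [set w | forall i, (i < b)%N -> B i (U i w)]]].

Lemma measurable_cylinder d' d1 (S : measurableType d') (T1 : measurableType d1)
    (X : nat -> S -> T1) (A : nat -> set T1) k :
  (forall i, (i < k)%N -> measurable_fun setT (X i)) -> (forall i, measurable (A i)) ->
  measurable [set w | forall i, (i < k)%N -> A i (X i w)].
Proof.
move=> mX mA.
rewrite (_ : [set w | _] = \big[setI/setT]_(i < k) (X i @^-1` A i)); last first.
  by rewrite -(bigcap_mkord k (fun i => X i @^-1` A i)).
apply: bigsetI_measurable => i _.
by rewrite -[X in measurable X]setTI; exact: mX.
Qed.

Lemma past_cylinder_measurable a b : past_cylinder a b `<=` measurable.
Proof.
move=> _ [A [B [mA mB ->]]].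
by apply: measurableI; apply: measurable_cylinder.
Qed.

Lemma past_cylinder_setI a b : setI_closed (past_cylinder a b).
Proof.
move=> _ _ [A [B [mA mB ->]]] [A' [B' [mA' mB' ->]]].
exists (fun i => A i `&` A' i), (fun i => B i `&` B' i); split.
- by move=> i; exact: measurableI.
- by move=> i; exact: measurableI.
apply/seteqP; split => w /=.
  by move=> [[h1 h2] [h3 h4]]; split => i ii; split; auto.
by move=> [h1 h2]; split; split => i ii;
  [have [] := h1 _ ii|have [] := h2 _ ii|have [] := h1 _ ii|have [] := h2 _ ii].
Qed.

(** The same carrier under a smaller sigma-algebra: dependence on the past only becomes an ordinary
    measurability statement about functions on [T]. *)
Notation past a b := (g_sigma_algebraType (past_cylinder a b)).

Lemma measurable_past_id a b : measurable_fun setT (id : T -> past a b).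
Proof.
move=> _ C mC; rewrite setTI.
exact: (smallest_sub (@sigma_algebra_measurable _ T) (@past_cylinder_measurable a b) mC).
Qed.

Lemma measurable_past_radius a b i : (i < a)%N ->
  measurable_fun setT (Rs i : past a b -> R).
Proof.
move=> ia _ A mA; rewrite setTI; apply: sub_sigma_algebra.
exists (fun j => if j == i then A else setT), (fun=> setT); split => //.
  by move=> j; case: ifP.
apply/seteqP; split => w /=.
  by move=> wA; split => // j; case: eqP => // ->.
by move=> [/(_ i ia)]; rewrite eqxx.
Qed.

Lemma measurable_past_direction a b i : (i < b)%N ->
  measurable_fun setT (U i : past a b -> borel_rV R d).
Proof.
move=> ib _ A mA; rewrite setTI; apply: sub_sigma_algebra.
exists (fun=> setT), (fun j => if j == i then A else setT); split => //.
  by move=> j; case: ifP.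
apply/seteqP; split => w /=.
  by move=> wA; split => // j; case: eqP => // ->.
by move=> [_ /(_ i ib)]; rewrite eqxx.
Qed.

Lemma measurable_past a b d1 (T1 : measurableType d1) (Y : T -> T1) :
  measurable_fun setT (Y : past a b -> T1) -> measurable_fun setT Y.
Proof. by move=> mY; exact: (measurableT_comp mY (@measurable_past_id a b)). Qed.

Context (Rs_indep : independent_RVs P Rs) (U_indep : independent_RVs P U)
  (RU_indep : independent_families P Rs U).

Lemma prob_cylinder a b A B : (forall i, measurable (A i)) -> (forall i, measurable (B i)) ->
  P ([set w | forall i, (i < a)%N -> A i (Rs i w)] `&`
     [set w | forall i, (i < b)%N -> B i (U i w)]) =
  ((\prod_(i <- iota 0 a) P (Rs i @^-1` A i)) *
   (\prod_(i <- iota 0 b) P (U i @^-1` B i)))%E.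
Proof.
move=> mA mB; rewrite -Rs_indep ?iota_uniq// -U_indep ?iota_uniq//.
have iotaE k (Q : nat -> T -> Prop) :
    [set w | forall i, i \in iota 0 k -> Q i w] = [set w | forall i, (i < k)%N -> Q i w].
  by apply/seteqP; split => w h i ik; apply: h; move: ik; rewrite mem_iota.
rewrite !iotaE; apply: RU_indep.
  rewrite /sigma_gen; set G := \bigcup_i _.
  apply: (@measurable_cylinder _ _ (g_sigma_algebraType G) _ (fun i => Rs i : T -> R)) => //.
  move=> i _ _ C mC; rewrite setTI; apply: sub_sigma_algebra.
  by exists i => //; exists C => //; rewrite setTI.
rewrite /sigma_gen; set G := \bigcup_i _.
apply: (@measurable_cylinder _ _ (g_sigma_algebraType G) _ (fun i => U i : T -> borel_rV R d)) => //.
move=> i _ _ C mC; rewrite setTI; apply: sub_sigma_algebra.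
by exists i => //; exists C => //; rewrite setTI.
Qed.

(** A condition on [U b] extends a cylinder of type (a, b) to type (a, b + 1), where the product
    formula gains exactly one factor; the pi-lambda argument does the rest. *)
Lemma past_indep_direction a b (A : set T) (B : set (borel_rV R d)) :
  <<s past_cylinder a b >> A -> measurable B ->
  P (A `&` U b @^-1` B) = (P A * P (U b @^-1` B))%E.
Proof.
move=> sA mB.
apply: (independent_sigma_l (G := past_cylinder a b)
  (H := [set C | exists2 B, measurable B & C = U b @^-1` B])) => //.
- exact: past_cylinder_setI.
- exact: past_cylinder_measurable.
- by move=> _ [C mC ->]; rewrite -[X in measurable X]setTI; exact: measurable_funP.
- move=> _ _ [A' [B' [mA' mB' ->]]] [C mC ->].
  pose B2 i := if i == b then C else B' i.
  have mB2 i : measurable (B2 i) by rewrite /B2; case: ifP.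
  rewrite -setIA (_ : [set w | _] `&` (U b @^-1` C) =
      [set w | forall i, (i < b.+1)%N -> B2 i (U i w)]); last first.
    apply/seteqP; split => w /=.
      move=> [h1 h2] i; rewrite ltnS leq_eqVlt /B2.
      by case: eqP => [->//|_/= ib]; exact: h1.
    move=> h; split => [i ib|]; last by have := h b (ltnSn _); rewrite /B2 eqxx.
    by have := h i (ltnW ib); rewrite /B2 ltn_eqF.
  rewrite !prob_cylinder// -muleA; congr (_ * _)%E.
  rewrite -addn1 iotaD big_cat/= big_seq1 add0n {2}/B2 eqxx; congr (_ * _)%E.
  apply: eq_big_seq => i; rewrite mem_iota/= add0n => ib.
  by rewrite /B2 ltn_eqF.
- by exists B.
Qed.

Lemma past_indep_radius a b (A : set T) (B : set R) :
  <<s past_cylinder a b >> A -> measurable B ->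
  P (A `&` Rs a @^-1` B) = (P A * P (Rs a @^-1` B))%E.
Proof.
move=> sA mB.
apply: (independent_sigma_l (G := past_cylinder a b)
  (H := [set C | exists2 B, measurable B & C = Rs a @^-1` B])) => //.
- exact: past_cylinder_setI.
- exact: past_cylinder_measurable.
- by move=> _ [C mC ->]; rewrite -[X in measurable X]setTI; exact: measurable_funP.
- move=> _ _ [A' [B' [mA' mB' ->]]] [C mC ->].
  pose A2 i := if i == a then C else A' i.
  have mA2 i : measurable (A2 i) by rewrite /A2; case: ifP.
  rewrite setIAC (_ : [set w | _] `&` (Rs a @^-1` C) =
      [set w | forall i, (i < a.+1)%N -> A2 i (Rs i w)]); last first.
    apply/seteqP; split => w /=.
      move=> [h1 h2] i; rewrite ltnS leq_eqVlt /A2.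
      by case: eqP => [->//|_/= ib]; exact: h1.
    move=> h; split => [i ib|]; last by have := h a (ltnSn _); rewrite /A2 eqxx.
    by have := h i (ltnW ib); rewrite /A2 ltn_eqF.
  rewrite !prob_cylinder// muleAC; congr (_ * _)%E.
  rewrite -addn1 iotaD big_cat/= big_seq1 add0n {2}/A2 eqxx; congr (_ * _)%E.
  apply: eq_big_seq => i; rewrite mem_iota/= add0n => ia.
  by rewrite /A2 ltn_eqF.
- by exists B.
Qed.

(** Averages over the next direction given the past: whatever is known before, packed in [Y] and
    [s], stays frozen while the direction runs over the sphere. *)
Lemma ge0_integral_past_direction a b (Y : T -> R) (s : T -> 'rV[R]_d)
    (psi : R * R -> \bar R) :
  measurable_fun setT (Y : past a b -> R) ->
  (forall j, measurable_fun setT (fun w : past a b => s w ord0 j)) ->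
  measurable_fun setT psi -> (forall z, 0 <= psi z)%E ->
  (\int[P]_w psi (Y w, dotrv (s w) (U b w)) =
   \int[P]_w \int[distribution P (U b)]_u psi (Y w, dotrv (s w) u))%E.
Proof.
move=> mY ms mpsi psi0.
pose F (z : past a b * borel_rV R d) := psi (Y z.1, dotrv (s z.1) z.2).
have mdot : measurable_fun setT (fun z : past a b * borel_rV R d => dotrv (s z.1) z.2).
  apply: measurable_sum => j; apply: measurable_funM.
    exact: (measurableT_comp (ms j)).
  exact: (measurableT_comp (measurable_coord j)).
have mF : measurable_fun setT F.
  apply: (measurableT_comp mpsi); apply: measurable_fun_pair => //.
  exact: (measurableT_comp mY).
have := @ge0_integral_independent _ _ _ T (past a b) (borel_rV R d) R P id (U b)
  (@measurable_past_id a b) (measurable_funP (U b)) F.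
move=> ->//; last 2 first.
- by move=> A B mA mB; exact: (past_indep_direction mA mB).
- by move=> z; exact: psi0.
apply: eq_integral => w _; rewrite /F /= ge0_integral_distribution//.
apply: (measurableT_comp mpsi); apply: measurable_fun_pair => //.
exact: measurable_dotrv.
Qed.

Lemma ge0_integral_past_radius a b (Y : T -> R) (h : R -> R) :
  measurable_fun setT (Y : past a b -> R) -> measurable_fun setT h ->
  (forall w, 0 <= Y w) -> (forall x, 0 <= h x) ->
  (\int[P]_w (Y w * h (Rs a w))%:E =
   \int[P]_w (Y w)%:E * \int[P]_w (h (Rs a w))%:E)%E.
Proof.
move=> mY mh Y0 h0.
pose F (z : past a b * R) := (Y z.1 * h z.2)%:E.
have mF : measurable_fun setT F.
  apply/measurable_EFinP; apply: measurable_funM.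
    exact: (measurableT_comp mY).
  exact: (measurableT_comp mh).
have := @ge0_integral_independent _ _ _ T (past a b) R R P id (Rs a)
  (@measurable_past_id a b) (measurable_funP (Rs a)) F.
move=> ->//; last 2 first.
- by move=> A B mA mB; exact: (past_indep_radius mA mB).
- by move=> z; rewrite /F lee_fin mulr_ge0.
have mhR : measurable_fun setT (fun w => h (Rs a w)) by exact: measurableT_comp.
rewrite -ge0_integralZr//; last 3 first.
- exact/measurable_EFinP/(measurable_past mY).
- by move=> w _; rewrite lee_fin.
- by apply: integral_ge0 => w _; rewrite lee_fin.
apply: eq_integral => w _; rewrite /F/=; under eq_integral do rewrite EFinM.
rewrite ge0_integralZl//; first exact/measurable_EFinP.
- by move=> x _; rewrite lee_fin.
- by rewrite lee_fin.
Qed.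

End past.

Notation past Rs U a b := (g_sigma_algebraType (past_cylinder Rs U a b)).

(** * Moments of the walk *)

Section walk_moments.
Context dT (T : measurableType dT) (R : realType) (P : probability T R) (d : nat)
  (Rs : nat -> {RV P >-> R}) (U : nat -> {RV P >-> borel_rV R d}).

Local Notation S := (walk Rs U).

Definition walk_sq k w : R := dotrv (S k w) (S k w).
Definition walk_inc k w : R := 2 * Rs k w * dotrv (S k w) (U k w).
Definition walk_cross k w : R := \sum_(i < k) walk_inc i w.
Definition radii_sq k w : R := \sum_(i < k) Rs i w ^+ 2.

Lemma enorm_walk k w : enorm (S k w) ^+ 2 = walk_sq k w.
Proof.
rewrite /enorm -dotrv_sqr sqr_sqrtr// dotrv_sqr sumr_ge0// => j _; exact: sqr_ge0.
Qed.

Lemma walk_sq_ge0 k w : 0 <= walk_sq k w.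
Proof. by rewrite -enorm_walk sqr_ge0. Qed.

Lemma walk_incE k w : walk_inc k w = dotrv ((2 * Rs k w) *: S k w) (U k w).
Proof. by rewrite dotrvZ. Qed.

Lemma walk_inc_sq k w : dotrv ((2 * Rs k w) *: S k w) ((2 * Rs k w) *: S k w) =
  4 * (Rs k w ^+ 2 * walk_sq k w).
Proof. by rewrite dotrvZ dotrvC dotrvZ -/(walk_sq k w); ring. Qed.

Lemma walkS k w : S k.+1 w = S k w + Rs k w *: U k w.
Proof. by rewrite /walk big_ord_recr. Qed.

Lemma measurable_past_walk a b k j : (k <= a)%N -> (k <= b)%N ->
  measurable_fun setT (fun w : past Rs U a b => S k w ord0 j).
Proof.
move=> ka kb; rewrite (_ : (fun _ => _) = fun w => \sum_(i < k) Rs i w * (U i w : 'rV[R]_d) ord0 j).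
  apply: measurable_sum => i; apply: measurable_funM.
    by apply: measurable_past_radius; rewrite (leq_trans (ltn_ord i)).
  apply: (measurableT_comp (measurable_coord j)).
  by apply: measurable_past_direction; rewrite (leq_trans (ltn_ord i)).
by apply/funext => w; rewrite /walk summxE; apply: eq_bigr => i _; rewrite mxE.
Qed.

Lemma measurable_past_walk_sq a b k : (k <= a)%N -> (k <= b)%N ->
  measurable_fun setT (walk_sq k : past Rs U a b -> R).
Proof.
by move=> ka kb; apply: measurable_sum => j; apply: measurable_funM; exact: measurable_past_walk.
Qed.

Lemma measurable_past_cross a b k : (k <= a)%N -> (k <= b)%N ->
  measurable_fun setT (walk_cross k : past Rs U a b -> R).
Proof.
move=> ka kb; apply: measurable_sum => i.
have ia : (i < a)%N by rewrite (leq_trans (ltn_ord i)).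
have ib : (i < b)%N by rewrite (leq_trans (ltn_ord i)).
apply: measurable_funM.
  by apply: measurable_funM => //; exact: measurable_past_radius.
apply: measurable_sum => j; apply: measurable_funM.
  by apply: measurable_past_walk; exact: ltnW.
by apply: (measurableT_comp (measurable_coord j)); exact: measurable_past_direction.
Qed.

Lemma measurable_walk_sq k : measurable_fun setT (walk_sq k).
Proof. exact: (measurable_past (@measurable_past_walk_sq k k k _ _)). Qed.

Lemma measurable_walk_cross k : measurable_fun setT (walk_cross k).
Proof. exact: (measurable_past (@measurable_past_cross k k k _ _)). Qed.

Lemma walk_crossS k w : walk_cross k.+1 w = walk_cross k w + walk_inc k w.
Proof. by rewrite /walk_cross big_ord_recr. Qed.

Lemma measurable_walk_inc k : measurable_fun setT (walk_inc k).
Proof.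
rewrite (_ : walk_inc k = fun w => walk_cross k.+1 w - walk_cross k w); last first.
  by apply/funext => w; rewrite walk_crossS addrC addKr.
by apply: measurable_funB; exact: measurable_walk_cross.
Qed.

Lemma measurable_radii_sq k : measurable_fun setT (radii_sq k).
Proof. by apply: measurable_sum => i; exact: measurable_funX. Qed.

Context (Rs_indep : independent_RVs P Rs) (U_indep : independent_RVs P U)
  (RU_indep : independent_families P Rs U)
  (U_unif : forall i, uniform_on_sphere (distribution P (U i)))
  (d_gt0 : (0 < d)%N)
  (Rs_law : forall i A, measurable A -> P (Rs i @^-1` A) = P (Rs 0%N @^-1` A))
  (Rs_sq : (\int[P]_w (Rs 0%N w ^+ 2)%:E = 1%:E)%E).

Let d_pos : 0 < d%:R :> R. Proof. by rewrite ltr0n. Qed.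

Lemma measurable_past_scaled_walk k j :
  measurable_fun setT (fun w : past Rs U k.+1 k => ((2 * Rs k w) *: S k w) ord0 j).
Proof.
rewrite (_ : (fun _ => _) = fun w => 2 * Rs k w * S k w ord0 j).
  apply: measurable_funM; last exact: measurable_past_walk.
  by apply: measurable_funM => //; exact: measurable_past_radius.
by apply/funext => w; rewrite mxE.
Qed.

Lemma ge0_integral_inc k (Y : T -> R) (psi : R * R -> \bar R) :
  measurable_fun setT (Y : past Rs U k.+1 k -> R) ->
  measurable_fun setT psi -> (forall z, 0 <= psi z)%E ->
  (\int[P]_w psi (Y w, walk_inc k w) =
   \int[P]_w \int[distribution P (U k)]_u psi (Y w, dotrv ((2 * Rs k w) *: S k w) u))%E.
Proof.
move=> mY mpsi psi0.
rewrite -(ge0_integral_past_direction Rs_indep U_indep RU_indep (s := fun w => (2 * Rs k w) *: S k w) mY)//.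
  by apply: eq_integral => w _; rewrite walk_incE.
exact: measurable_past_scaled_walk.
Qed.

(** For a frozen past the increment is the product of a vector [s] with a uniform direction; [s] and
    [- s] have the same norm, hence give the same law. *)
Lemma ge0_integral_inc_sym k (Y : T -> R) (psi : R * R -> \bar R) :
  measurable_fun setT (Y : past Rs U k.+1 k -> R) ->
  measurable_fun setT psi -> (forall z, 0 <= psi z)%E ->
  (\int[P]_w psi (Y w, walk_inc k w) = \int[P]_w psi (Y w, (- walk_inc k w)%R))%E.
Proof.
move=> mY mpsi psi0.
have mN : measurable_fun setT (fun z : R * R => (z.1, - z.2)).
  by apply: measurable_fun_pair => //; exact: measurableT_comp.
rewrite ge0_integral_inc//.
rewrite (@ge0_integral_inc k Y (psi \o (fun z : R * R => (z.1, - z.2))))//; last 2 first.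
- exact: (measurableT_comp mpsi mN).
- by move=> z; exact: psi0.
apply: eq_integral => w _ /=.
set s := _ *: _.
rewrite (@ge0_integral_sphere_dotrv R d _ (U_unif k) s (- s) (fun x => psi (Y w, x)))//.
- by apply: eq_integral => u _; rewrite dotrvN.
- by apply: (measurableT_comp mpsi); apply: measurable_fun_pair.
- by rewrite dotrvN dotrvC dotrvN opprK.
Qed.

Lemma Rint_inc_sym k (Y : T -> R) (psi : R * R -> R) :
  measurable_fun setT (Y : past Rs U k.+1 k -> R) -> measurable_fun setT psi ->
  \int[P]_w psi (Y w, walk_inc k w) = \int[P]_w psi (Y w, - walk_inc k w).
Proof.
move=> mY mpsi; apply: (Rint_eq_ge0 (V := fun w => (Y w, walk_inc k w))
  (W := fun w => (Y w, - walk_inc k w))) => // g mg g0.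
exact: ge0_integral_inc_sym.
Qed.

Lemma ge0_integral_inc2 k (Y : T -> R) :
  measurable_fun setT (Y : past Rs U k.+1 k -> R) -> (forall w, 0 <= Y w) ->
  (\int[P]_w (Y w * walk_inc k w ^+ 2)%:E =
   \int[P]_w (Y w * (4 * (Rs k w ^+ 2 * walk_sq k w) / d%:R))%:E)%E.
Proof.
move=> mY Y0.
(* The integrand must be nonnegative on the whole plane, not only at the values that [Y] takes. *)
transitivity (\int[P]_w (`|Y w| * walk_inc k w ^+ 2)%:E)%E.
  by apply: eq_integral => w _; rewrite ger0_norm.
rewrite (@ge0_integral_inc k Y (fun z => (`|z.1| * z.2 ^+ 2)%:E))//; last 2 first.
- apply/measurable_EFinP; apply: measurable_funM; last exact: measurable_funX.
  exact: (measurableT_comp (@normr_measurable R setT)).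
- by move=> z; rewrite lee_fin mulr_ge0// sqr_ge0.
apply: eq_integral => w _; rewrite /= -walk_inc_sq.
rewrite -EFin_Rintegral; last exact/L1Z/(L1_dotrvX (U_unif k)).
rewrite RintZ ?(sphere_moment2 (U_unif k)) ?ger0_norm//; exact: (L1_dotrvX (U_unif k)).
Qed.

Lemma ge0_integral_inc4 k (Y : T -> R) :
  measurable_fun setT (Y : past Rs U k.+1 k -> R) -> (forall w, 0 <= Y w) ->
  (\int[P]_w (Y w * walk_inc k w ^+ 4)%:E <=
   \int[P]_w (Y w * (3 * (4 * (Rs k w ^+ 2 * walk_sq k w)) ^+ 2 / d%:R ^+ 2))%:E)%E.
Proof.
move=> mY Y0.
have -> : (\int[P]_w (Y w * walk_inc k w ^+ 4)%:E =
    \int[P]_w (`|Y w| * walk_inc k w ^+ 4)%:E)%E.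
  by apply: eq_integral => w _; rewrite ger0_norm.
rewrite (@ge0_integral_inc k Y (fun z => (`|z.1| * z.2 ^+ 4)%:E))//; last 2 first.
- apply/measurable_EFinP; apply: measurable_funM; last exact: measurable_funX.
  exact: (measurableT_comp (@normr_measurable R setT)).
- by move=> z; rewrite lee_fin mulr_ge0// exprn_even_ge0.
have [m4 /andP[m40 m4d] m4E] := sphere_moment4 (U_unif k) d_gt0.
have e w : (\int[distribution P (U k)]_u (`|Y w| * dotrv ((2 * Rs k w) *: S k w) u ^+ 4)%:E)%E =
    (Y w * ((4 * (Rs k w ^+ 2 * walk_sq k w)) ^+ 2 * m4))%:E.
  rewrite -EFin_Rintegral; last exact/L1Z/(L1_dotrvX (U_unif k)).
  by rewrite RintZ ?ger0_norm ?m4E ?walk_inc_sq//; exact: (L1_dotrvX (U_unif k)).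
under eq_integral do rewrite /= e.
have mY' := measurable_past mY.
apply: ge0_le_integral => //.
- by move=> w _; rewrite lee_fin; do 2 (apply: mulr_ge0 => //); exact: sqr_ge0.
- apply/measurable_EFinP; apply: measurable_funM => //; apply: measurable_funM => //.
  apply: measurable_funX; apply: measurable_funM => //; apply: measurable_funM.
    exact: measurable_funX.
  exact: measurable_walk_sq.
- apply/measurable_EFinP; apply: measurable_funM => //; apply: measurable_funM => //.
  apply: measurable_funM => //; apply: measurable_funX; apply: measurable_funM => //.
  apply: measurable_funM; first exact: measurable_funX.
  exact: measurable_walk_sq.
- move=> w _; rewrite lee_fin ler_wpM2l//.
  rewrite (_ : 3 * _ / _ = (4 * (Rs k w ^+ 2 * walk_sq k w)) ^+ 2 * (3 / d%:R ^+ 2)); last by rewrite -mulrA mulrCA.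
  by apply: ler_wpM2l => //; exact: sqr_ge0.
Qed.

Lemma ge0_integral_radius i (h : R -> R) : measurable_fun setT h ->
  (forall x, 0 <= h x) ->
  (\int[P]_w (h (Rs i w))%:E = \int[P]_w (h (Rs 0%N w))%:E)%E.
Proof.
move=> mh h0; have mhE : measurable_fun setT (EFin \o h) by exact/measurable_EFinP.
rewrite -[LHS](ge0_integral_distribution (Rs i) mhE)//.
rewrite -[RHS](ge0_integral_distribution (Rs 0%N) mhE)//.
by apply: eq_measure_integral => A mA _; exact: Rs_law.
Qed.

Lemma Rint_radius i (h : R -> R) : measurable_fun setT h -> (forall x, 0 <= h x) ->
  L1 P (fun w => h (Rs 0%N w)) ->
  L1 P (fun w => h (Rs i w)) /\ \int[P]_w h (Rs i w) = \int[P]_w h (Rs 0%N w).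
Proof.
move=> mh h0 hi; apply: integral_EFinE => //; first exact: measurableT_comp.
by rewrite ge0_integral_radius// EFin_Rintegral.
Qed.

Lemma Rint_past_radius a b (Y : T -> R) (h : R -> R) :
  measurable_fun setT (Y : past Rs U a b -> R) -> (forall w, 0 <= Y w) -> L1 P Y ->
  measurable_fun setT h -> (forall x, 0 <= h x) -> L1 P (fun w => h (Rs a w)) ->
  L1 P (fun w => Y w * h (Rs a w)) /\
  \int[P]_w (Y w * h (Rs a w)) = \int[P]_w Y w * \int[P]_w h (Rs a w).
Proof.
move=> mY Y0 iY mh h0 ih; apply: integral_EFinE.
- by apply: measurable_funM; [exact: measurable_past mY|exact: measurableT_comp].
- by move=> w; rewrite mulr_ge0.
- by rewrite (ge0_integral_past_radius Rs_indep U_indep RU_indep mY)// EFinM !EFin_Rintegral.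
Qed.

Lemma radius_sq i : L1 P (fun w => Rs i w ^+ 2) /\ \int[P]_w Rs i w ^+ 2 = 1.
Proof.
have m2 : measurable_fun setT (fun x : R => x ^+ 2) by exact: measurable_funX.
have [i0 i1] : L1 P (fun w => Rs 0%N w ^+ 2) /\ \int[P]_w Rs 0%N w ^+ 2 = 1.
  by apply: integral_EFinE => // [|w]; [exact: measurable_funX|exact: sqr_ge0].
by rewrite -i1; apply: (@Rint_radius i (fun x => x ^+ 2)) => // x; exact: sqr_ge0.
Qed.

Lemma radii_sq_mean k : L1 P (radii_sq k) /\ \int[P]_w radii_sq k w = k%:R.
Proof.
have i2 (i : 'I_k) : L1 P (fun w => Rs i w ^+ 2) by have [] := radius_sq i.
split; first exact: L1_sum.
rewrite Rint_sum//; under eq_bigr do rewrite (radius_sq _).2.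
by rewrite sumr_const card_ord.
Qed.

Lemma direction_ae i : {ae P, forall w, dotrv (U i w) (U i w) = 1}.
Proof.
have [N [mN N0 sN]] := sphere_ae (U_unif i).
exists (U i @^-1` N); split => //; last by move=> w h; exact: sN.
by rewrite -[X in measurable X]setTI; exact: measurable_funP.
Qed.

Lemma walk_sq_ae k : {ae P, forall w, walk_sq k w = radii_sq k w + walk_cross k w}.
Proof.
elim: k => [|k ih].
  apply: aeW => w; rewrite /walk_sq /radii_sq /walk_cross /walk !big_ord0 addr0.
  by rewrite /dotrv big1// => j _; rewrite mxE mul0r.
move: ih (direction_ae k); apply: filterS2 => w ih U1.
rewrite walk_crossS /radii_sq big_ord_recr/= -/(radii_sq k w) /walk_sq walkS.
rewrite dotrvD dotrvZ !(dotrvC _ (_ + _)) !dotrvD !dotrvZ.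
by rewrite U1 (dotrvC (U k w)) -/(walk_sq k w) ih /walk_inc; ring.
Qed.

(** The claims need a joint induction: the mean of [walk_sq k] gives [E D_k^2 = 4 k / d], and the
    centering of the cross term gives the mean of the next [walk_sq]. Summing [4 i / d] over [i < k]
    stays below [2 k^2 / d]. *)
Lemma walk_moments k :
  [/\ L1 P (fun w => walk_cross k w ^+ 2), \int[P]_w walk_cross k w = 0,
      \int[P]_w walk_cross k w ^+ 2 <= 2 * k%:R ^+ 2 / d%:R,
      L1 P (walk_sq k) & \int[P]_w walk_sq k w = k%:R].
Proof.
have sq_of_cross m : L1 P (walk_cross m) -> \int[P]_w walk_cross m w = 0 ->
    L1 P (walk_sq m) /\ \int[P]_w walk_sq m w = m%:R.
  move=> ic c0; have [iQ Q1] := radii_sq_mean m; have ae := walk_sq_ae m.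
  split; first exact: (L1_ae_eq (@measurable_walk_sq m) (L1D iQ ic) ae).
  rewrite (Rint_ae (@measurable_walk_sq m) _ ae); last first.
    by apply: measurable_funD; [exact: measurable_radii_sq|exact: measurable_walk_cross].
  by rewrite RintD// Q1 c0 addr0.
elim: k => [|k [iT2 T0 T2 iS S1]].
  have c0 : walk_cross 0 = fun=> 0 by apply/funext => w; rewrite /walk_cross big_ord0.
  have i0 : L1 P (walk_cross 0) by rewrite c0; exact: L1_cst.
  have e0 : \int[P]_w walk_cross 0 w = 0 by rewrite c0 Rint_cst.
  have [? ?] := sq_of_cross 0%N i0 e0.
  split => //; rewrite c0 ?Rint_cst; first exact: L1_cst.
  by rewrite expr0n/= mulr0 mul0r.
have [i2 r1] := radius_sq k.
have mI := @measurable_walk_inc k.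
have [iRS RS] := Rint_past_radius (b := k) (@measurable_past_walk_sq k k k (leqnn _) (leqnn _))
  (walk_sq_ge0 k) iS (measurable_funX 2 (@measurable_id _ R setT)) (@sqr_ge0 _) i2.
have [iD2 D2] : L1 P (fun w => walk_inc k w ^+ 2) /\
    \int[P]_w walk_inc k w ^+ 2 = 4 * k%:R / d%:R.
  apply: integral_EFinE; first exact: measurable_funX.
    by move=> w; exact: sqr_ge0.
  have := @ge0_integral_inc2 k (fun=> 1) (measurable_cst _) (fun=> ler01).
  under eq_integral do rewrite mul1r.
  move=> ->; under eq_integral do rewrite mul1r mulrAC (mulrC (Rs k _ ^+ 2)).
  rewrite -EFin_Rintegral; last exact: L1Z.
  by rewrite RintZ// RS r1 S1 mulr1 mulrAC.
have iT := L1_sqr (@measurable_walk_cross k) iT2.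
have iD := L1_sqr mI iD2.
have D0 : \int[P]_w walk_inc k w = 0.
  have := @Rint_inc_sym k (fun=> 0) snd (measurable_cst _) measurable_snd.
  rewrite /=; under [X in _ = X]eq_Rintegral do rewrite -mulN1r.
  by rewrite RintZ//; lra.
have sqD (e : R) : e ^+ 2 = 1 -> L1 P (fun w => (walk_cross k w + e * walk_inc k w) ^+ 2).
  move=> e1; apply: (@L1_le _ _ _ _ _ (fun w => 2 * walk_cross k w ^+ 2 + 2 * walk_inc k w ^+ 2)).
  - apply: measurable_funX; apply: measurable_funD; first exact: measurable_walk_cross.
    exact: measurable_funM.
  - by apply: L1D; exact: L1Z.
  - move=> w; rewrite ger0_norm ?sqr_ge0//.
    have := sqr_ge0 (walk_cross k w - e * walk_inc k w).
    have : (e * walk_inc k w) ^+ 2 = walk_inc k w ^+ 2 by rewrite exprMn e1 mul1r.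
    nra.
have e1 := sqD 1 (expr1n _ _); have eN := sqD (-1) (etrans (sqrrN 1) (expr1n _ _)).
have cross1 w : walk_cross k.+1 w = walk_cross k w + 1 * walk_inc k w by rewrite walk_crossS mul1r.
have iT1 : L1 P (fun w => walk_cross k.+1 w ^+ 2) by under eq_fun do rewrite cross1.
have T10 : \int[P]_w walk_cross k.+1 w = 0.
  by under eq_Rintegral do rewrite walk_crossS; rewrite RintD// T0 D0 addr0.
have T12 : \int[P]_w walk_cross k.+1 w ^+ 2 =
    \int[P]_w walk_cross k w ^+ 2 + \int[P]_w walk_inc k w ^+ 2.
  (* Orthogonality by symmetry: the two squares have equal means, and their sum contains no mixed
     product. *)
  have sym : \int[P]_w (walk_cross k w + 1 * walk_inc k w) ^+ 2 =
             \int[P]_w (walk_cross k w + (-1) * walk_inc k w) ^+ 2.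
    under eq_Rintegral do rewrite mul1r; under [in RHS]eq_Rintegral do rewrite mulN1r.
    apply: (@Rint_inc_sym k (walk_cross k) (fun z => (z.1 + z.2) ^+ 2)).
      exact: measurable_past_cross.
    by apply: measurable_funX; exact: measurable_funD.
  have : \int[P]_w ((walk_cross k w + 1 * walk_inc k w) ^+ 2 +
                    (walk_cross k w + (-1) * walk_inc k w) ^+ 2) =
         \int[P]_w (2 * walk_cross k w ^+ 2 + 2 * walk_inc k w ^+ 2).
    by apply: eq_Rintegral => w _; ring.
  rewrite RintD// RintD ?RintZ//; [|exact: L1Z|exact: L1Z].
  rewrite -sym => h.
  by under [X in X = _]eq_Rintegral do rewrite cross1; lra.
have [iS1 S11] := sq_of_cross k.+1 (L1_sqr (@measurable_walk_cross k.+1) iT1) T10.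
split => //; rewrite T12 D2.
apply: (@le_trans _ _ (2 * k%:R ^+ 2 / d%:R + 4 * k%:R / d%:R)); first exact: lerD.
by rewrite -mulrDl ler_pM2r ?invr_gt0// -natr1; nra.
Qed.

End walk_moments.

(** * Elementary bounds for sine, cosine and exponential *)

Section elementary_bounds.
Context {R : realType}.
Implicit Types x y : R.

Lemma ler_norm_sin y : `|sin y| <= `|y|.
Proof.
wlog y0 : y / 0 <= y.
  move=> H; have [|/ltW y0] := leP 0 y; first exact: H.
  by rewrite -normrN -sinN -(normrN y); apply: H; rewrite oppr_ge0.
have [|c _] := @MVT_segment R sin cos 0 y y0 (fun x _ => is_derive_sin x).
  exact/continuous_subspaceT/continuous_sin.
rewrite sin0 !subr0 => ->; rewrite normrM ler_piMl// ler_norml cos_geN1 cos_le1 //.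
Qed.

Lemma one_minus_cos y : 1 - cos y = 2 * sin (y / 2) ^+ 2.
Proof.
have {1}-> : y = y / 2 + y / 2 by field.
by rewrite cosD; have := cos2Dsin2 (y / 2); nra.
Qed.

Lemma cos_ge_quadratic y : 0 <= cos y - 1 + y ^+ 2 / 2.
Proof.
have := one_minus_cos y.
have : sin (y / 2) ^+ 2 <= (y / 2) ^+ 2.
  rewrite -(real_normK (num_real (sin _))) -(real_normK (num_real (y / 2))).
  by rewrite lerXn2r ?nnegrE// ler_norm_sin.
have -> : (y / 2) ^+ 2 = y ^+ 2 / 4 by field.
lra.
Qed.

Lemma sin_ge_cubic y : 0 <= y -> y - sin y <= y ^+ 3 / 2.
Proof.
move=> y0; have dsin x : is_derive x 1 (fun x => x - sin x) (1 - cos x).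
  by apply: is_deriveB.
have [|c] := @MVT_segment R _ _ 0 y y0 (fun x _ => dsin x).
  apply: continuous_subspaceT => x; apply: cvgB; [exact: cvg_id|exact: continuous_sin].
rewrite in_itv/= => /andP[c0 cy]; rewrite sin0 !subr0 => ->.
have := cos_ge_quadratic c => h.
have h1 : (1 - cos c) * y <= c ^+ 2 / 2 * y by apply: ler_wpM2r => //; lra.
have h2 : c ^+ 2 * y <= y ^+ 2 * y by apply: ler_wpM2r => //; rewrite lerXn2r ?nnegrE.
by rewrite exprSr; lra.
Qed.

(** With [y = x / 2] the left side is [2 (y - sin y) (y + sin y)], a cubic bound times a linear one.
    The crude constant 1 is enough for an error term. *)
Lemma cos_le_quartic x : cos x - 1 + x ^+ 2 / 2 <= x ^+ 4.
Proof.
wlog x0 : x / 0 <= x.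
  move=> H; have [|/ltW x0] := leP 0 x; first exact: H.
  have : 0 <= - x by rewrite oppr_ge0.
  by move=> /H; rewrite cosN sqrrN (_ : (- x) ^+ 4 = x ^+ 4)//; ring.
set y := x / 2.
have y0 : 0 <= y by rewrite divr_ge0.
have -> : x = 2 * y by rewrite /y; field.
have := one_minus_cos (2 * y); rewrite (_ : 2 * y / 2 = y); last by field.
move=> h.
have sy := sin_ge_cubic y0.
have : `|sin y| <= y by have := ler_norm_sin y; rewrite (ger0_norm y0).
rewrite ler_norml => /andP[sy1 sy2].
have : (y - sin y) * (y + sin y) <= y ^+ 3 / 2 * (2 * y) by apply: ler_pM; lra.
have : 0 <= y ^+ 4 by rewrite exprn_ge0.
nra.
Qed.

Lemma cos_le_quadratic x : cos x - 1 + x ^+ 2 / 2 <= x ^+ 2 / 2.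
Proof. by have := cos_le1 x; lra. Qed.

Lemma expRN_approx x : 0 <= x -> `|expR (- x) - (1 - x)| <= x ^+ 2.
Proof.
move=> x0; have h1 := expR_ge1Dx (- x); have h2 := expR_ge1Dx x.
have e1 : expR (- x) * (1 + x) <= 1.
  rewrite expRN mulrC ler_pdivrMr ?expR_gt0// mul1r//.
rewrite ger0_norm; last by lra.
have x1 : 0 < 1 + x by lra.
rewrite -(ler_pM2r x1); have : 0 <= x ^+ 3 by rewrite exprn_ge0.
have -> : x ^+ 2 * (1 + x) = x ^+ 2 + x ^+ 3 by ring.
lra.
Qed.

End elementary_bounds.

(** * Concentration of the squared norm by truncation of the radii *)

Section walk_clt.
Context dT (T : measurableType dT) (R : realType) (P : probability T R) (d : nat)
  (Rs : nat -> {RV P >-> R}) (U : nat -> {RV P >-> borel_rV R d}).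

(** The second moment lost by truncating a radius at [M]; the only measure of the tail of [R] that
    the estimates use. *)
Definition radius_tail (M : R) :=
  \int[P]_w (Rs 0%N w ^+ 2 * \1_[set x | M < `|x|] (Rs 0%N w)).

Context (Rs_indep : independent_RVs P Rs) (U_indep : independent_RVs P U)
  (RU_indep : independent_families P Rs U)
  (U_unif : forall i, uniform_on_sphere (distribution P (U i)))
  (d_gt0 : (0 < d)%N)
  (Rs_law : forall i A, measurable A -> P (Rs i @^-1` A) = P (Rs 0%N @^-1` A))
  (Rs_sq : (\int[P]_w (Rs 0%N w ^+ 2)%:E = 1%:E)%E).

Let d_pos : 0 < d%:R :> R. Proof. by rewrite ltr0n. Qed.

Let above (M x : R) : R := \1_[set x | M < `|x|] x.

Let above01 M x : 0 <= above M x <= 1.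
Proof. by rewrite /above indicE; case: (_ \in _); rewrite /= ?lexx ?ler01. Qed.

Let measurable_above M : measurable_fun setT (above M).
Proof.
by apply: measurable_indic; exact: (measurable_gt_norm (V := id)).
Qed.

Let measurable_sqr : measurable_fun setT (fun x : R => x ^+ 2).
Proof. exact: measurable_funX. Qed.

Lemma radius_tailE i M : L1 P (fun w => Rs i w ^+ 2 * above M (Rs i w)) /\
  \int[P]_w (Rs i w ^+ 2 * above M (Rs i w)) = radius_tail M.
Proof.
have mh : measurable_fun setT (fun x : R => x ^+ 2 * above M x) by exact: measurable_funM.
apply: (Rint_radius Rs_law i mh) => [x|].
  by rewrite mulr_ge0 ?sqr_ge0//; have /andP[] := above01 M x.
have [i0 _] := radius_sq Rs_law Rs_sq 0.
apply: (L1_le _ i0); first exact: (measurableT_comp mh).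
move=> w; have /andP[h0 h1] := above01 M (Rs 0%N w).
rewrite ger0_norm; first by apply: ler_piMr => //; exact: sqr_ge0.
by apply: mulr_ge0 => //; exact: sqr_ge0.
Qed.

Lemma radius_tail_ge0 M : 0 <= radius_tail M.
Proof.
apply: Rint_ge0 => w; apply: mulr_ge0; first exact: sqr_ge0.
by have /andP[] := above01 M (Rs 0%N w).
Qed.

Section truncation.
Context (M : R) (M_gt0 : 0 < M).
Let g x : R := x ^+ 2 * (1 - above M x).

Let g0 x : 0 <= g x.
Proof. by rewrite mulr_ge0 ?sqr_ge0//; have := above01 M x; lra. Qed.

Let gM x : g x <= M ^+ 2.
Proof.
have M2 : 0 <= M ^+ 2 := sqr_ge0 _.
rewrite /g /above indicE; case: (boolP (x \in _)) => /=.
  by rewrite subrr mulr0.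
rewrite notin_setE/= => /negP; rewrite -leNgt subr0 mulr1 => xM.
by rewrite -(real_normK (num_real x)) lerXn2r ?nnegrE// ltW.
Qed.

Let mg : measurable_fun setT g.
Proof. by apply: measurable_funM => //; exact: measurable_funB. Qed.

Let g_bound x : `|g x| <= M ^+ 2. Proof. by rewrite ger0_norm. Qed.

Let gi i : L1 P (fun w => g (Rs i w)).
Proof. exact: (L1_bounded_comp _ mg g_bound). Qed.

Let gE i : \int[P]_w g (Rs i w) = 1 - radius_tail M.
Proof.
have [i2 e2] := radius_sq Rs_law Rs_sq i; have [it et] := radius_tailE i M.
rewrite -e2 -et -RintB//; apply: eq_Rintegral => w _; rewrite /g; ring.
Qed.

Let V k w : R := \sum_(i < k) (g (Rs i w) - (1 - radius_tail M)).

Let tail1 : 0 <= 1 - radius_tail M <= M ^+ 2.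
Proof.
rewrite -(gE 0); apply/andP; split; first exact: Rint_ge0.
by rewrite -[leRHS](Rint_cst P); apply: Rint_le => //; exact: L1_cst.
Qed.

Let term_bound x : `|g x - (1 - radius_tail M)| <= M ^+ 2.
Proof.
have := g0 x; have := gM x; have := tail1 => /andP[h1 h2] h3 h4.
by rewrite ler_norml; apply/andP; split; lra.
Qed.

Let V_bound k w : `|V k w| <= k%:R * M ^+ 2.
Proof.
apply: (le_trans (ler_norm_sum _ _ _)).
apply: (@le_trans _ _ (\sum_(i < k) M ^+ 2)); first by apply: ler_sum.
by rewrite sumr_const card_ord -[X in X <= _]mulr_natl.
Qed.

Let mVp k : measurable_fun setT (V k : past Rs U k k -> R).
Proof.
apply: measurable_sum => i; apply: measurable_funB => //.
by apply: (measurableT_comp mg); exact: measurable_past_radius.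
Qed.

Let mV k : measurable_fun setT (V k) := measurable_past (@mVp k).

(** The truncated squares are centered, independent and bounded by [M ^+ 2], so their variances add
    up, one radius at a time. *)
Let V2 k : \int[P]_w V k w ^+ 2 <= k%:R * M ^+ 4.
Proof.
have bV2 m : L1 P (fun w => V m w ^+ 2).
  apply: (@L1_bounded _ _ _ _ _ ((m%:R * M ^+ 2) ^+ 2)); first exact: measurable_funX.
  by move=> w; rewrite normrX lerXn2r ?nnegrE// mulr_ge0// sqr_ge0.
elim: k => [|k ih].
  rewrite (_ : (fun w => _) = fun=> 0) ?Rint_cst ?mul0r//.
  by apply/funext => w; rewrite /V big_ord0 expr0n.
pose mu := 1 - radius_tail M.
have iV : L1 P (V k) by apply: (@L1_bounded _ _ _ _ _ (k%:R * M ^+ 2)).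
(* The product rule for a function of the past and a fresh radius asks for nonnegative factors; [C]
   shifts [V k] above 0 and its contribution cancels afterwards. *)
pose C := k%:R * M ^+ 2.
have iVC : L1 P (fun w => V k w + C) by apply: L1D => //; exact: L1_cst.
have VC0 w : 0 <= V k w + C.
  by have := V_bound k w; rewrite ler_norml /C => /andP[h _]; lra.
have mVC : measurable_fun setT (fun w : past Rs U k k => V k w + C).
  by apply: measurable_funD => //; exact: mVp.
have [iVg eVg] := Rint_past_radius Rs_indep U_indep RU_indep (a := k) (b := k)
  (Y := fun w => V k w + C) mVC VC0 iVC mg g0 (gi k).
have cross : \int[P]_w (V k w * (g (Rs k w) - mu)) = 0.
  have -> : \int[P]_w (V k w * (g (Rs k w) - mu)) =
      \int[P]_w (((V k w + C) * g (Rs k w) - mu * (V k w + C)) - C * (g (Rs k w) - mu)).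
    by apply: eq_Rintegral => w _; ring.
  rewrite RintB; [|by apply: L1B => //; exact: L1Z|by apply: L1Z; apply: L1B => //; exact: L1_cst].
  rewrite RintB//; [|exact: L1Z].
  rewrite !RintZ//; last by apply: L1B => //; exact: L1_cst.
  by rewrite RintB ?Rint_cst ?eVg ?gE//; [rewrite -/mu; ring|exact: L1_cst].
have it : L1 P (fun w => (g (Rs k w) - mu) ^+ 2).
  apply: (@L1_bounded _ _ _ _ _ ((M ^+ 2) ^+ 2)) => [|w].
    apply: measurable_funX; apply: measurable_funB => //; exact: measurableT_comp.
  by rewrite normrX lerXn2r ?nnegrE ?sqr_ge0// term_bound.
have ix : L1 P (fun w => V k w * (g (Rs k w) - mu)).
  apply: (@L1_boundedM _ _ _ _ _ _ (k%:R * M ^+ 2)) => //.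
  by apply: L1B => //; exact: L1_cst.
have -> : \int[P]_w V k.+1 w ^+ 2 =
    \int[P]_w (V k w ^+ 2 + 2 * (V k w * (g (Rs k w) - mu)) + (g (Rs k w) - mu) ^+ 2).
  by apply: eq_Rintegral => w _; rewrite /V big_ord_recr/= -/(V k w) -/mu; ring.
rewrite RintD//; last by apply: L1D => //; exact: L1Z.
rewrite RintD//; last exact: L1Z.
rewrite RintZ// cross mulr0 addr0 -natr1 mulrDl mul1r; apply: lerD => //.
rewrite -[leRHS](Rint_cst P); apply: Rint_le => //; first exact: L1_cst.
move=> w; rewrite -(real_normK (num_real _)) (exprM M 2 2).
by rewrite lerXn2r ?nnegrE ?sqr_ge0// term_bound.
Qed.

(** The truncated part is controlled by its variance and the rest by its mean, each tail term being
    counted once for itself and once for its centering. Bounds in [n] instead of [k] make the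
    estimate uniform along the walk. *)
Lemma radii_sq_dev n k : (0 < n)%N -> (k <= n)%N ->
  \int[P]_w `|radii_sq Rs k w - k%:R| <= M ^+ 2 * Num.sqrt n%:R + 2 * n%:R * radius_tail M.
Proof.
move=> n0 kn.
have nk : k%:R <= n%:R :> R by rewrite ler_nat.
have n_pos : 0 < n%:R :> R by rewrite ltr0n.
have a0 : 0 < M ^+ 2 * Num.sqrt n%:R by rewrite mulr_gt0 ?exprn_gt0// sqrtr_gt0.
have iV : L1 P (V k) by apply: (@L1_bounded _ _ _ _ _ (k%:R * M ^+ 2)).
have iV2 : L1 P (fun w => V k w ^+ 2).
  apply: (@L1_bounded _ _ _ _ _ ((k%:R * M ^+ 2) ^+ 2)); first exact: measurable_funX.
  by move=> w; rewrite normrX lerXn2r ?nnegrE// mulr_ge0// sqr_ge0.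
have EV : \int[P]_w `|V k w| <= M ^+ 2 * Num.sqrt n%:R.
  have := Rint_sqr_le a0 iV iV2 (V2 k); move/le_trans; apply.
  have : k%:R * M ^+ 4 / (M ^+ 2 * Num.sqrt n%:R) <= M ^+ 2 * Num.sqrt n%:R.
    rewrite ler_pdivrMr//.
    have -> : M ^+ 2 * Num.sqrt n%:R * (M ^+ 2 * Num.sqrt n%:R) = Num.sqrt n%:R ^+ 2 * M ^+ 4 by ring.
    by rewrite sqr_sqrtr ?ler0n// ler_pM2r// exprn_gt0.
  lra.
have [iQ _] := radii_sq_mean Rs_law Rs_sq k.
have it i : L1 P (fun w => Rs i w ^+ 2 * above M (Rs i w) + radius_tail M).
  by apply: L1D; [have [] := radius_tailE i M|exact: L1_cst].
have is_ : L1 P (fun w => \sum_(i < k) (Rs i w ^+ 2 * above M (Rs i w) + radius_tail M)).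
  by apply: L1_sum => i.
apply: (@le_trans _ _ (\int[P]_w (`|V k w| + \sum_(i < k) (Rs i w ^+ 2 * above M (Rs i w) + radius_tail M)))).
  apply: Rint_le.
  - by apply/L1_norm/L1B => //; exact: L1_cst.
  - by apply: L1D => //; exact: L1_norm.
  move=> w.
  have -> : radii_sq Rs k w - k%:R = V k w + \sum_(i < k) (Rs i w ^+ 2 * above M (Rs i w) - radius_tail M).
    have -> : k%:R = \sum_(i < k) (1 : R) by rewrite sumr_const card_ord.
    by rewrite /radii_sq /V -sumrB -big_split/=; apply: eq_bigr => i _; rewrite /g; ring.
  apply: (le_trans (ler_normD _ _)); rewrite lerD2l.
  apply: (le_trans (ler_norm_sum _ _ _)); apply: ler_sum => i _.
  apply: (le_trans (ler_normB _ _)).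
  rewrite (ger0_norm (radius_tail_ge0 M)) ger0_norm//; apply: mulr_ge0; first exact: sqr_ge0.
  by have /andP[] := above01 M (Rs i w).
rewrite RintD//; last exact: L1_norm.
apply: lerD => //; rewrite Rint_sum//.
apply: (@le_trans _ _ (\sum_(i < k) 2 * radius_tail M)).
  apply: ler_sum => i _; have [i1 e1] := radius_tailE i M.
  by rewrite RintD ?Rint_cst ?e1//; [lra|exact: L1_cst].
rewrite sumr_const card_ord -[X in X <= _]mulr_natl.
by have := radius_tail_ge0 M; nra.
Qed.

(** Adds the mean absolute value of the cross term, which its second moment bounds by
    [2 n / sqrt d]. *)
Lemma walk_sq_dev n k : (0 < n)%N -> (k <= n)%N ->
  \int[P]_w `|walk_sq Rs U k w - k%:R| <=
  M ^+ 2 * Num.sqrt n%:R + 2 * n%:R * radius_tail M + 2 * n%:R / Num.sqrt d%:R.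
Proof.
move=> n0 kn.
have nk : k%:R <= n%:R :> R by rewrite ler_nat.
have n_pos : 0 < n%:R :> R by rewrite ltr0n.
have sd : 0 < Num.sqrt d%:R :> R by rewrite sqrtr_gt0.
have [iT2 T0 T2 iS _] := walk_moments Rs_indep U_indep RU_indep U_unif d_gt0 Rs_law Rs_sq k.
have iT := L1_sqr (@measurable_walk_cross _ _ _ _ _ Rs U k) iT2.
have [iQ _] := radii_sq_mean Rs_law Rs_sq k.
have iQk : L1 P (fun w => radii_sq Rs k w - k%:R) by apply: L1B => //; exact: L1_cst.
have ae := walk_sq_ae Rs U_unif k.
have a0 : 0 < 2 * n%:R / Num.sqrt d%:R :> R by rewrite divr_gt0// mulr_gt0.
have ET : \int[P]_w `|walk_cross Rs U k w| <= 2 * n%:R / Num.sqrt d%:R.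
  apply: (le_trans (Rint_sqr_le a0 iT iT2 T2)).
  have : 2 * k%:R ^+ 2 / d%:R / (2 * n%:R / Num.sqrt d%:R) <= 2 * n%:R / Num.sqrt d%:R :> R.
    rewrite ler_pdivrMr// -{1}(sqr_sqrtr (ltW d_pos)).
    rewrite (_ : 2 * n%:R / _ * _ = 4 * n%:R ^+ 2 / Num.sqrt d%:R ^+ 2); last by field; rewrite gt_eqF.
    rewrite ler_pM2r ?invr_gt0 ?exprn_gt0//.
    have : k%:R ^+ 2 <= n%:R ^+ 2 :> R by rewrite lerXn2r ?nnegrE.
    by have := sqr_ge0 (n%:R : R); lra.
  lra.
rewrite (Rint_ae (g := fun w => `|(radii_sq Rs k w - k%:R) + walk_cross Rs U k w|)); last 3 first.
- by apply: (measurableT_comp (@normr_measurable R setT)); apply: measurable_funB => //; exact: measurable_walk_sq.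
- apply: (measurableT_comp (@normr_measurable R setT)); apply: measurable_funD; last exact: measurable_walk_cross.
  by apply: measurable_funB => //; exact: measurable_radii_sq.
- by apply: filterS ae => w ->; congr `|_|; ring.
apply: (@le_trans _ _ (\int[P]_w (`|radii_sq Rs k w - k%:R| + `|walk_cross Rs U k w|))).
  apply: Rint_le; [exact/L1_norm/L1D|by apply: L1D; exact: L1_norm|].
  by move=> w; exact: ler_normD.
rewrite RintD; [|exact: L1_norm|exact: L1_norm].
by apply: lerD => //; exact: radii_sq_dev.
Qed.

End truncation.

End walk_clt.

(** * The characteristic function of the walk *)

Section walk_char.
Context dT (T : measurableType dT) (R : realType) (P : probability T R) (d : nat)
  (Rs : nat -> {RV P >-> R}) (U : nat -> {RV P >-> borel_rV R d}).
Context (Rs_indep : independent_RVs P Rs) (U_indep : independent_RVs P U)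
  (RU_indep : independent_families P Rs U)
  (U_unif : forall i, uniform_on_sphere (distribution P (U i)))
  (d_gt0 : (0 < d)%N)
  (Rs_law : forall i A, measurable A -> P (Rs i @^-1` A) = P (Rs 0%N @^-1` A))
  (Rs_sq : (\int[P]_w (Rs 0%N w ^+ 2)%:E = 1%:E)%E).

Let d_pos : 0 < d%:R :> R. Proof. by rewrite ltr0n. Qed.

Local Notation S2 := (walk_sq Rs U).
Local Notation D := (walk_inc Rs U).
Local Notation Tk := (walk_cross Rs U).

Lemma L1_radius_walk k : L1 P (fun w => Rs k w ^+ 2 * S2 k w).
Proof.
have [i2 _] := radius_sq Rs_law Rs_sq k.
have [_ _ _ iS _] := walk_moments Rs_indep U_indep RU_indep U_unif d_gt0 Rs_law Rs_sq k.
have [+ _] := Rint_past_radius Rs_indep U_indep RU_indep (b := k)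
  (@measurable_past_walk_sq _ _ _ _ _ Rs U k k k (leqnn _) (leqnn _))
  (walk_sq_ge0 Rs U k) iS (measurable_funX 2 (@measurable_id _ R setT)) (@sqr_ge0 _) i2.
by under eq_fun do rewrite mulrC.
Qed.

Lemma Rint_inc2 k (Y : T -> R) C :
  measurable_fun setT (Y : past Rs U k.+1 k -> R) -> (forall w, 0 <= Y w <= C) ->
  L1 P (fun w => Y w * D k w ^+ 2) /\
  \int[P]_w (Y w * D k w ^+ 2) = 4 / d%:R * \int[P]_w (Y w * (Rs k w ^+ 2 * S2 k w)).
Proof.
move=> mY YC; have Y0 w : 0 <= Y w by have /andP[] := YC w.
have iY : L1 P (fun w => Y w * (Rs k w ^+ 2 * S2 k w)).
  apply: (@L1_boundedM _ _ _ _ _ _ C); last exact: L1_radius_walk.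
    exact: measurable_past mY.
  by move=> w; rewrite ger0_norm//; have /andP[] := YC w.
apply: integral_EFinE.
- apply: measurable_funM; first exact: measurable_past mY.
  exact/measurable_funX/measurable_walk_inc.
- by move=> w; apply: mulr_ge0 => //; exact: sqr_ge0.
rewrite (ge0_integral_inc2 Rs_indep U_indep RU_indep U_unif d_gt0 mY)//.
rewrite -RintZ// EFin_Rintegral; last exact: L1Z.
by apply: eq_integral => w _; congr EFin; field; rewrite gt_eqF.
Qed.

Lemma Rint_inc4 k (Y : T -> R) C :
  measurable_fun setT (Y : past Rs U k.+1 k -> R) -> (forall w, 0 <= Y w) ->
  (forall w, Y w * (Rs k w ^+ 2 * S2 k w) ^+ 2 <= C) ->
  L1 P (fun w => Y w * D k w ^+ 4) /\
  \int[P]_w (Y w * D k w ^+ 4) <= 48 / d%:R ^+ 2 * C.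
Proof.
move=> mY Y0 YC.
have mf : measurable_fun setT (fun w => Y w * D k w ^+ 4).
  apply: measurable_funM; first exact: measurable_past mY.
  exact/measurable_funX/measurable_walk_inc.
have f0 w : 0 <= Y w * D k w ^+ 4 by apply: mulr_ge0 => //; rewrite exprn_even_ge0.
have le : (\int[P]_w (Y w * D k w ^+ 4)%:E <= (48 / d%:R ^+ 2 * C)%:E)%E.
  apply: le_trans (ge0_integral_inc4 Rs_indep U_indep RU_indep U_unif d_gt0 mY Y0) _.
  rewrite -(Rint_cst P (48 / d%:R ^+ 2 * C)) EFin_Rintegral; last exact: L1_cst.
  have mR : measurable_fun setT (fun w => Rs k w ^+ 2 * S2 k w).
    by apply: measurable_funM; [exact: measurable_funX|exact: measurable_walk_sq].
  apply: ge0_le_integral => //.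
  - move=> w _; rewrite lee_fin mulr_ge0// divr_ge0 ?sqr_ge0//.
    by rewrite mulr_ge0// sqr_ge0.
  - apply/measurable_EFinP; apply: measurable_funM; first exact: measurable_past mY.
    by apply: measurable_funM => //; apply: measurable_funM => //; apply: measurable_funX; exact: measurable_funM.
  - move=> w _; rewrite lee_fin.
    have -> : Y w * (3 * (4 * (Rs k w ^+ 2 * S2 k w)) ^+ 2 / d%:R ^+ 2) =
      48 / d%:R ^+ 2 * (Y w * (Rs k w ^+ 2 * S2 k w) ^+ 2) by ring.
    by apply: ler_wpM2l => //; apply: divr_ge0 => //; exact: sqr_ge0.
have i : L1 P (fun w => Y w * D k w ^+ 4).
  by apply/L1P_ge0 => //; exact: le_lt_trans le (ltry _).
by split => //; rewrite -lee_fin EFin_Rintegral.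
Qed.

Lemma L1_cos (V : T -> R) : measurable_fun setT V -> L1 P (fun w => cos (V w)).
Proof.
move=> mV; apply: (@L1_bounded _ _ _ _ _ 1) => [|w].
  apply: measurableT_comp => //; apply: continuous_measurable_fun; exact: continuous_cos.
by rewrite ler_norml cos_geN1 cos_le1.
Qed.

(* The increment is symmetric given the past, which removes the sine terms. *)
Lemma walk_char_inc k (t a : R) :
  \int[P]_w cos (t * Tk k.+1 w + a) =
  \int[P]_w (cos (t * Tk k w + a) * cos (t * D k w)).
Proof.
have mT := @measurable_walk_cross _ _ _ P _ Rs U k.
have mI := @measurable_walk_inc _ _ _ P _ Rs U k.
have mcos (e : R) : measurable_fun setT (fun z : R * R => cos (t * (z.1 + e * z.2) + a)).
  apply: measurableT_comp; first by apply: continuous_measurable_fun; exact: continuous_cos.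
  apply: measurable_funD => //; apply: measurable_funM => //; apply: measurable_funD => //.
  exact: measurable_funM.
have i (e : R) : L1 P (fun w => cos (t * (Tk k w + e * D k w) + a)).
  apply: L1_cos; apply: measurable_funD => //; apply: measurable_funM => //.
  by apply: measurable_funD => //; exact: measurable_funM.
have sym : \int[P]_w cos (t * (Tk k w + 1 * D k w) + a) =
           \int[P]_w cos (t * (Tk k w + (-1) * D k w) + a).
  have := Rint_inc_sym Rs_indep U_indep RU_indep U_unif
    (measurable_past_cross (leqnSn k) (leqnn k)) (mcos 1).
  move=> /= ->; apply: eq_Rintegral => w _; congr cos; ring.
have : \int[P]_w (cos (t * (Tk k w + 1 * D k w) + a) + cos (t * (Tk k w + (-1) * D k w) + a)) =
       \int[P]_w (2 * (cos (t * Tk k w + a) * cos (t * D k w))).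
  apply: eq_Rintegral => w _.
  rewrite (_ : t * (Tk k w + 1 * D k w) + a = (t * Tk k w + a) + t * D k w); last by ring.
  rewrite (_ : t * (Tk k w + (-1) * D k w) + a = (t * Tk k w + a) - t * D k w); last by ring.
  by rewrite cosD cosB; ring.
have ic : L1 P (fun w => cos (t * Tk k w + a) * cos (t * D k w)).
  apply: (@L1_boundedM _ _ _ _ _ _ 1); last by apply: L1_cos; exact: measurable_funM.
  - apply: measurableT_comp; first by apply: continuous_measurable_fun; exact: continuous_cos.
    by apply: measurable_funD => //; exact: measurable_funM.
  - by move=> w; rewrite ler_norml cos_geN1 cos_le1.
rewrite RintD// -sym RintZ//.
under [X in _ -> X = _]eq_Rintegral do rewrite walk_crossS -[D k _]mul1r.
lra.
Qed.

Let S2ge0 k w : 0 <= S2 k w. Proof. exact: walk_sq_ge0. Qed.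

Section step.
Context (k n : nat) (M t a : R) (kn : (k <= n)%N) (M_gt0 : 0 < M).

Let dev := \int[P]_w `|S2 k w - k%:R|.
Let largeR w : R := \1_[set x | M < `|x|] (Rs k w).
Let largeS w : R := \1_[set w | 2 * n%:R < `|S2 k w|] w.
(* Fourth moments of the increment are used on [small], second moments elsewhere. *)
Let small w : R := (1 - largeR w) * (1 - largeS w).

Let iS : L1 P (S2 k).
Proof. by have [] := walk_moments Rs_indep U_indep RU_indep U_unif d_gt0 Rs_law Rs_sq k. Qed.

Let iS_ES : L1 P (fun w => S2 k w - k%:R).
Proof. by apply: L1B => //; exact: L1_cst. Qed.

Let mabove : measurable_fun setT (\1_[set x : R | M < `|x|] : R -> R).
Proof. by apply: measurable_indic; exact: (measurable_gt_norm (V := id)). Qed.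

Let mlargeR : measurable_fun setT (largeR : past Rs U k.+1 k -> R).
Proof. by apply: (measurableT_comp mabove); exact: measurable_past_radius. Qed.

Let mlargeS a' : (k <= a')%N -> measurable_fun setT (largeS : past Rs U a' k -> R).
Proof.
move=> ka; apply: measurable_indic; apply: measurable_gt_norm.
exact: measurable_past_walk_sq.
Qed.

Let ind01 (X : Type) (A : set X) x : 0 <= (\1_A x : R) <= 1.
Proof. by rewrite indicE; case: (_ \in _); rewrite /= ?lexx ?ler01. Qed.

(** [Rs k] is independent of the walk up to time [k], so the mean splits into the tail of the radius
    and [E |S_k|^2 = k]. *)
Let largeR_inc : \int[P]_w (largeR w * D k w ^+ 2) = 4 / d%:R * (k%:R * radius_tail Rs M).
Proof.
have [_ ->] := Rint_inc2 mlargeR (fun w => ind01 _ _).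
congr (_ * _).
have mh : measurable_fun setT (fun x : R => x ^+ 2 * \1_[set x | M < `|x|] x).
  by apply: measurable_funM => //; exact: measurable_funX.
have h0 x : 0 <= x ^+ 2 * \1_[set x : R | M < `|x|] x.
  by apply: mulr_ge0; [exact: sqr_ge0|have /andP[] := ind01 [set x : R | M < `|x|] x].
have [it et] := radius_tailE Rs_law Rs_sq k M.
have [_ e] := Rint_past_radius Rs_indep U_indep RU_indep (b := k)
  (@measurable_past_walk_sq _ _ _ _ _ Rs U k k k (leqnn _) (leqnn _))
  (S2ge0 k) iS mh h0 it.
have [_ _ _ _ ES] := walk_moments Rs_indep U_indep RU_indep U_unif d_gt0 Rs_law Rs_sq k.
move: e; rewrite et ES => <-; apply: eq_Rintegral => w _; rewrite /largeR; ring.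
Qed.

Let past_sq (Y : T -> R) : measurable_fun setT (Y : past Rs U k k -> R) ->
  (forall w, 0 <= Y w) -> L1 P (fun w => Y w * S2 k w) ->
  \int[P]_w (Y w * (Rs k w ^+ 2 * S2 k w)) = \int[P]_w (Y w * S2 k w).
Proof.
move=> mY Y0 iY; have [i2 e2] := radius_sq Rs_law Rs_sq k.
have mYS : measurable_fun setT (fun w : past Rs U k k => Y w * S2 k w).
  by apply: measurable_funM => //; exact: measurable_past_walk_sq.
have [_] := Rint_past_radius Rs_indep U_indep RU_indep mYS
  (fun w => mulr_ge0 (Y0 w) (S2ge0 k w)) iY (measurable_funX 2 (@measurable_id _ R setT)) (@sqr_ge0 _) i2.
by rewrite e2 mulr1 => <-; apply: eq_Rintegral => w _; ring.
Qed.

(** Where [|S_k|^2 > 2 n >= 2 k], one has [|S_k|^2 <= 2 (|S_k|^2 - k)], so the mean deviation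
    controls this part. *)
Let largeS_inc : \int[P]_w (largeS w * D k w ^+ 2) <= 4 / d%:R * (2 * dev).
Proof.
have [_ ->] := Rint_inc2 (mlargeS (leqnSn k)) (fun w => ind01 _ _).
apply: ler_wpM2l; first by rewrite divr_ge0.
have iY : L1 P (fun w => largeS w * S2 k w).
  apply: (@L1_boundedM _ _ _ _ _ _ 1) => //; first exact: measurable_past (mlargeS (leqnn k)).
  by move=> w; have /andP[h0 h1] := ind01 [set w | 2 * n%:R < `|S2 k w|] w; rewrite ger0_norm.
rewrite past_sq//; last exact: mlargeS.
rewrite -RintZ; last exact: L1_norm.
apply: Rint_le => //; first exact/L1Z/L1_norm.
have nk : k%:R <= n%:R :> R by rewrite ler_nat.
have k0 : 0 <= k%:R :> R by [].
move=> w; rewrite /largeS indicE; case: (boolP (_ \in _)) => [|_].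
  rewrite inE/= ger0_norm// mul1r => h.
  by have := ler_norm (S2 k w - k%:R); lra.
by rewrite mul0r mulr_ge0.
Qed.

Let small_inc : L1 P (fun w => small w * D k w ^+ 4) /\
  \int[P]_w (small w * D k w ^+ 4) <= 48 / d%:R ^+ 2 * (4 * n%:R ^+ 2 * M ^+ 4).
Proof.
apply: Rint_inc4.
- apply: measurable_funM; apply: measurable_funB => //; exact: mlargeS.
- move=> w; have /andP[_ h1] := ind01 [set w | 2 * n%:R < `|S2 k w|] w.
  have /andP[_ h2] := ind01 [set x | M < `|x|] (Rs k w).
  by apply: mulr_ge0; rewrite subr_ge0.
move=> w; have C0 : 0 <= 4 * n%:R ^+ 2 * M ^+ 4.
  by rewrite mulr_ge0 ?exprn_even_ge0// mulr_ge0 ?exprn_even_ge0.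
rewrite /small /largeR /largeS !indicE; case: (boolP (_ \in _)) => [_|h1].
  by rewrite subrr !mul0r.
case: (boolP (_ \in _)) => [_|h2]; first by rewrite subrr mulr0 mul0r.
rewrite !subr0 !mul1r exprMn.
move: h1 h2; rewrite !notin_setE/= => /negP; rewrite -leNgt => h1 /negP; rewrite -leNgt ger0_norm// => h2.
rewrite mulrC; apply: ler_pM; [exact: sqr_ge0|exact: sqr_ge0| |].
  by rewrite (_ : 4 * n%:R ^+ 2 = (2 * n%:R) ^+ 2); [rewrite lerXn2r ?nnegrE ?mulr_ge0|ring].
rewrite (exprM M 2 2) lerXn2r ?nnegrE ?sqr_ge0//.
by rewrite -(real_normK (num_real (Rs k w))) lerXn2r ?nnegrE// ltW.
Qed.

Let inc2 : L1 P (fun w => D k w ^+ 2).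
Proof.
have [+ _] := @Rint_inc2 k (fun=> 1) 1 (measurable_cst _) (fun=> ltac:(by rewrite ler01 lexx)).
by under eq_fun do rewrite mul1r.
Qed.

Let B w := cos (t * Tk k w + a).

Let mB a' : (k <= a')%N -> measurable_fun setT (B : past Rs U a' k -> R).
Proof.
move=> ka; apply: measurableT_comp; first by apply: continuous_measurable_fun; exact: continuous_cos.
by apply: measurable_funD => //; apply: measurable_funM => //; exact: measurable_past_cross.
Qed.

Let B1 w : `|B w| <= 1. Proof. by rewrite ler_norml cos_geN1 cos_le1. Qed.

(** The second moment formula takes nonnegative weights; it is applied to [1 + B] and to 1, and the
    results are subtracted. The factor [R_k^2] averages to 1 by independence. *)
Let B_inc : \int[P]_w (B w * D k w ^+ 2) = 4 / d%:R * \int[P]_w (B w * S2 k w).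
Proof.
have [i1 e1] := @Rint_inc2 k (fun=> 1) 1 (measurable_cst _) (fun=> ltac:(by rewrite ler01 lexx)).
have YB w : 0 <= 1 + B w <= 2 by have := B1 w; rewrite ler_norml => /andP[]; lra.
have mY a' (ka : (k <= a')%N) : measurable_fun setT (fun w : past Rs U a' k => 1 + B w).
  by apply: measurable_funD => //; exact: mB.
have [i2 e2] := Rint_inc2 (mY _ (leqnSn k)) YB.
have iYS : L1 P (fun w => (1 + B w) * S2 k w).
  apply: (@L1_boundedM _ _ _ _ _ _ 2) => //; first exact: measurable_past (mY _ (leqnn k)).
  by move=> w; have /andP[? ?] := YB w; rewrite ger0_norm.
have i1S : L1 P (fun w => 1 * S2 k w) by under eq_fun do rewrite mul1r.
rewrite past_sq// in e1; rewrite past_sq// in e2; first last.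
- by move=> w; have /andP[] := YB w.
- exact: mY.
have -> : \int[P]_w (B w * D k w ^+ 2) =
    \int[P]_w ((1 + B w) * D k w ^+ 2 - 1 * D k w ^+ 2) by apply: eq_Rintegral => w _; ring.
rewrite RintB// e1 e2 -mulrBr -RintB//; congr (_ * _); apply: eq_Rintegral => w _; ring.
Qed.

Let tail_split x : 0 <= cos (t * D k x) - 1 + (t * D k x) ^+ 2 / 2 <=
  t ^+ 4 * (small x * D k x ^+ 4) +
  t ^+ 2 / 2 * (largeR x * D k x ^+ 2 + largeS x * D k x ^+ 2).
Proof.
move: (D k x) => y.
rewrite cos_ge_quadratic/=; have := cos_le_quartic (t * y).
have := cos_le_quadratic (t * y); rewrite !exprMn.
have t4 : 0 <= t ^+ 4 * y ^+ 4 by rewrite mulr_ge0 ?exprn_even_ge0.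
have t2 : 0 <= t ^+ 2 * y ^+ 2 by rewrite mulr_ge0 ?sqr_ge0.
rewrite /small /largeR /largeS !indicE; case: (_ \in _); case: (_ \in _) => /=; lra.
Qed.

(** Replace [cos (t D_k)] by [1 - (t D_k)^2 / 2], then [|S_k|^2] by [k]. The first costs the fourth
    moment on [small] (192 = 48 * 4), the radius tail and [2 * dev] from large [|S_k|^2]; the second
    costs one more [dev]. *)
Lemma walk_char_step :
  `|\int[P]_w cos (t * Tk k.+1 w + a) -
    (1 - 2 * t ^+ 2 * k%:R / d%:R) * \int[P]_w cos (t * Tk k w + a)| <=
  t ^+ 4 * (192 * n%:R ^+ 2 * M ^+ 4 / d%:R ^+ 2) +
  2 * t ^+ 2 / d%:R * (k%:R * radius_tail Rs M + 3 * dev).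
Proof.
have mBT : measurable_fun setT B := measurable_past (mB (leqnn k)).
have iB : L1 P B by apply: (@L1_bounded _ _ _ _ _ 1).
have iBD : L1 P (fun w => B w * D k w ^+ 2) by exact: (@L1_boundedM _ _ _ _ _ _ 1).
have iBS : L1 P (fun w => B w * S2 k w) by exact: (@L1_boundedM _ _ _ _ _ _ 1).
have [i4 e4] := small_inc.
have [iR _] := Rint_inc2 mlargeR (fun w => ind01 _ _).
have [iL _] := Rint_inc2 (mlargeS (leqnSn k)) (fun w => ind01 _ _).
pose g w := cos (t * D k w) - 1 + (t * D k w) ^+ 2 / 2.
pose h w := t ^+ 4 * (small w * D k w ^+ 4) +
  t ^+ 2 / 2 * (largeR w * D k w ^+ 2 + largeS w * D k w ^+ 2).
have ih : L1 P h by apply: L1D; apply: L1Z => //; exact: L1D.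
have mD := @measurable_walk_inc _ _ _ P _ Rs U k.
have ig : L1 P g.
  apply: L1D; first by apply: L1B; [apply: L1_cos; exact: measurable_funM|exact: L1_cst].
  by under eq_fun do rewrite exprMn mulrAC; exact: L1Z.
have iBg : L1 P (fun w => B w * g w) by exact: (@L1_boundedM _ _ _ _ _ _ 1).
have eh : \int[P]_w h w <= t ^+ 4 * (192 * n%:R ^+ 2 * M ^+ 4 / d%:R ^+ 2) +
   2 * t ^+ 2 / d%:R * (k%:R * radius_tail Rs M + 2 * dev).
  rewrite RintD; [|exact: L1Z|by apply: L1Z; exact: L1D].
  rewrite !RintZ//; last exact: L1D.
  rewrite RintD// largeR_inc; apply: lerD.
    rewrite ler_wpM2l ?exprn_even_ge0//; apply: le_trans e4 _.
    by rewrite le_eqVlt; apply/orP; left; apply/eqP; ring.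
  apply: (@le_trans _ _ (t ^+ 2 / 2 * (4 / d%:R * (k%:R * radius_tail Rs M) + 4 / d%:R * (2 * dev)))).
    by rewrite ler_wpM2l ?divr_ge0 ?sqr_ge0// lerD2l.
  by rewrite le_eqVlt; apply/orP; left; apply/eqP; field; rewrite gt_eqF.
have Bg : `|\int[P]_w (B w * g w)| <= \int[P]_w h w.
  apply: (le_trans (Rint_norm iBg)); apply: Rint_le => //; first exact: L1_norm.
  move=> w; have /andP[g0 gh] := tail_split w.
  by rewrite normrM (ger0_norm g0); apply: le_trans gh; exact: ler_piMl.
have BS : `|\int[P]_w (B w * S2 k w) - k%:R * \int[P]_w B w| <= dev.
  have -> : \int[P]_w (B w * S2 k w) - k%:R * \int[P]_w B w = \int[P]_w (B w * (S2 k w - k%:R)).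
    rewrite -RintZ// -RintB//; last exact: L1Z.
    by apply: eq_Rintegral => w _; ring.
  have iBd : L1 P (fun w => B w * (S2 k w - k%:R)) by exact: (@L1_boundedM _ _ _ _ _ _ 1).
  apply: (le_trans (Rint_norm iBd)); apply: Rint_le; [exact: L1_norm|exact: L1_norm|].
  by move=> w; rewrite normrM; exact: ler_piMl.
have -> : \int[P]_w cos (t * Tk k.+1 w + a) =
    \int[P]_w B w - t ^+ 2 / 2 * \int[P]_w (B w * D k w ^+ 2) + \int[P]_w (B w * g w).
  rewrite walk_char_inc -RintZ// -RintB//; last exact: L1Z.
  rewrite -RintD//; last by apply: L1B => //; exact: L1Z.
  by apply: eq_Rintegral => w _; rewrite /g -/(B w); field.
rewrite B_inc -/(B _).
set b := \int[P]_w B w in BS *; set s := \int[P]_w (B w * S2 k w) in BS *.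
set v := \int[P]_w (B w * g w) in Bg *.
rewrite (_ : _ - _ = v - 2 * t ^+ 2 / d%:R * (s - k%:R * b)); last by field; rewrite gt_eqF.
apply: (le_trans (ler_normB _ _)); rewrite normrM.
have c0 : 0 <= 2 * t ^+ 2 / d%:R by rewrite divr_ge0// mulr_ge0// sqr_ge0.
rewrite (ger0_norm c0).
have : 2 * t ^+ 2 / d%:R * `|s - k%:R * b| <= 2 * t ^+ 2 / d%:R * dev by exact: ler_wpM2l.
have := le_trans Bg eh; rewrite !mulrDr; set c := 2 * t ^+ 2 / d%:R; lra.
Qed.

End step.

End walk_char.

(** [s <= n] puts every factor [1 - s k / n^2] between 0 and 1, so the recursion is a contraction
    and the errors merely add up. *)
Lemma exp_recursion (R : realType) (s E : R) (n : nat) (a : nat -> R) :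
  0 <= s -> s <= n%:R -> (0 < n)%N -> `|a 0%N| <= 1 ->
  (forall k, (k < n)%N -> `|a k.+1 - (1 - s * k%:R / n%:R ^+ 2) * a k| <= E) ->
  `|a n - expR (- (s / 2 * (1 - n%:R^-1))) * a 0%N| <= n%:R * (E + s ^+ 2 / n%:R ^+ 2).
Proof.
move=> s0 sn n0 a01 aE.
have n_pos : 0 < n%:R :> R by rewrite ltr0n.
pose x k : R := s * k%:R / n%:R ^+ 2.
(* Solves the recursion with each factor [1 - x] replaced by [expR (- x)]; the exponent comes from
   [0 + ... + (k - 1) = k (k - 1) / 2]. *)
pose b k := expR (- (s * k%:R * (k%:R - 1) / (2 * n%:R ^+ 2))) * a 0%N.
have key k : (k <= n)%N -> `|a k - b k| <= k%:R * (E + s ^+ 2 / n%:R ^+ 2).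
  elim: k => [_|k ih kn].
    by rewrite /b mulr0 !mul0r oppr0 expR0 mul1r subrr normr0.
  have kn' : k%:R <= n%:R :> R by rewrite ler_nat ltnW.
  have x0 : 0 <= x k by rewrite divr_ge0 ?mulr_ge0 ?sqr_ge0.
  have x1 : x k <= 1.
    rewrite ler_pdivrMr ?exprn_gt0// mul1r expr2; exact: ler_pM.
  have xs : x k ^+ 2 <= s ^+ 2 / n%:R ^+ 2.
    have xn : x k <= s / n%:R.
      rewrite ler_pdivrMr ?exprn_gt0// (_ : s / n%:R * n%:R ^+ 2 = s * n%:R); last by field; rewrite gt_eqF.
      exact: ler_wpM2l.
    by rewrite -expr_div_n lerXn2r// nnegrE divr_ge0.
  have bS : b k.+1 = expR (- x k) * b k.
    rewrite /b mulrA -expRD; congr (expR _ * _); rewrite /x -natr1; field.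
    by rewrite gt_eqF.
  have b1 : `|b k| <= 1.
    rewrite /b normrM mulr_ile1// ger0_norm ?expR_ge0// -[leRHS]expR0 ler_expR oppr_le0.
    apply: divr_ge0; last by rewrite mulr_ge0// sqr_ge0.
    case: (k) => [|m]; first by rewrite mulr0 mul0r.
    by rewrite -mulrA mulr_ge0// mulr_ge0// subr_ge0 ler1n.
  have -> : a k.+1 - b k.+1 = (a k.+1 - (1 - x k) * a k) + (1 - x k) * (a k - b k)
     - (expR (- x k) - (1 - x k)) * b k by rewrite bS; ring.
  rewrite -natr1; apply: (le_trans (ler_normB _ _)).
  have h1 : `|(expR (- x k) - (1 - x k)) * b k| <= s ^+ 2 / n%:R ^+ 2.
    rewrite normrM -[leRHS]mulr1; apply: ler_pM => //.
    exact: le_trans (expRN_approx x0) xs.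
  have h2 : `|(1 - x k) * (a k - b k)| <= k%:R * (E + s ^+ 2 / n%:R ^+ 2).
    rewrite normrM; apply: le_trans (ih (ltnW kn)).
    by rewrite ler_piMl// ger0_norm; lra.
  have h3 := aE k kn; rewrite -/(x k) in h3.
  have := ler_normD (a k.+1 - (1 - x k) * a k) ((1 - x k) * (a k - b k)).
  set W := E + _ in h2 *; have WE : W = E + s ^+ 2 / n%:R ^+ 2 by [].
  lra.
have := key n (leqnn n); rewrite /b.
rewrite (_ : s * n%:R * (n%:R - 1) / (2 * n%:R ^+ 2) = s / 2 * (1 - n%:R^-1))//.
by field; rewrite gt_eqF.
Qed.

Section radius_tail.
Context dT (T : measurableType dT) (R : realType) (P : probability T R)
  (Rs : nat -> {RV P >-> R}).
Hypothesis Rs_sq : (\int[P]_w (Rs 0%N w ^+ 2)%:E = 1%:E)%E.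

Lemma radius_tail_cvg0 : radius_tail Rs m%:R @[m --> \oo] --> (0 : R).
Proof.
have [i0 _] : L1 P (fun w => Rs 0%N w ^+ 2) /\ \int[P]_w Rs 0%N w ^+ 2 = 1.
  by apply: integral_EFinE => // [|w]; [exact: measurable_funX|exact: sqr_ge0].
have mabove (m : nat) : measurable_fun setT (\1_[set x : R | m%:R < `|x|] : R -> R).
  by apply: measurable_indic; exact: (measurable_gt_norm (V := id)).
pose f m w := Rs 0%N w ^+ 2 * \1_[set x : R | m%:R < `|x|] (Rs 0%N w).
have mf m : measurable_fun setT (f m).
  by apply: measurable_funM; [exact: measurable_funX|exact: measurableT_comp].
have fle m w : `|f m w| <= Rs 0%N w ^+ 2.
  rewrite /f indicE; case: (_ \in _); rewrite ?mulr1 ?mulr0 ?normr0 ?sqr_ge0//.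
  by rewrite ger0_norm ?sqr_ge0.
have /fine_cvgP[_] : (\int[P]_w (f m w)%:E)%E @[m --> \oo] --> 0%:E.
  rewrite -[X in _ --> X](integral0 P setT).
  apply: (@dominated_cvg _ _ _ _ _ _ _ _ (fun w => (Rs 0%N w ^+ 2)%:E)) => //.
  - by move=> m; exact/measurable_EFinP.
  - move=> w _ /=; apply: cvg_near_cst.
    near=> m; rewrite /f indicE memNset ?mulr0//=; apply/negP; rewrite -leNgt ltW//.
    near: m; exact: nbhs_infty_gtr.
  - by move=> m w _; rewrite /= lee_fin fle.
exact.
Unshelve. all: by end_near.
Qed.

End radius_tail.

Section walk_char_bound.
Context dT (T : measurableType dT) (R : realType) (P : probability T R) (d : nat)
  (Rs : nat -> {RV P >-> R}) (U : nat -> {RV P >-> borel_rV R d}).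
Context (Rs_indep : independent_RVs P Rs) (U_indep : independent_RVs P U)
  (RU_indep : independent_families P Rs U)
  (U_unif : forall i, uniform_on_sphere (distribution P (U i)))
  (d_gt0 : (0 < d)%N)
  (Rs_law : forall i A, measurable A -> P (Rs i @^-1` A) = P (Rs 0%N @^-1` A))
  (Rs_sq : (\int[P]_w (Rs 0%N w ^+ 2)%:E = 1%:E)%E).

(** The frequency is [t c] with [c^2 = d / (2 n^2)], which turns the drift [2 (t c)^2 k / d] into
    [t^2 k / n^2]. In the error, 48 is 192 / 4, and 7 adds the direct radius tail to three
    deviations that hold two tails each. *)
Lemma walk_char_bound n (t a M : R) : 0 < M -> (0 < n)%N -> t ^+ 2 <= n%:R ->
  `|\int[P]_w cos (t * (Num.sqrt (d%:R / 2) / n%:R * walk_cross Rs U n w) + a) -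
    expR (- (t ^+ 2 / 2 * (1 - n%:R^-1))) * cos a| <=
  (48 * M ^+ 4 + 1) * t ^+ 4 / n%:R +
  t ^+ 2 * (7 * radius_tail Rs M + 3 * M ^+ 2 / Num.sqrt n%:R + 6 / Num.sqrt d%:R).
Proof.
move=> M0 n0 tn.
have d_pos : 0 < d%:R :> R by rewrite ltr0n.
have n_pos : 0 < n%:R :> R by rewrite ltr0n.
have sn : 0 < Num.sqrt n%:R :> R by rewrite sqrtr_gt0.
have sn2 : Num.sqrt n%:R ^+ 2 = n%:R :> R by rewrite sqr_sqrtr// ltW.
have sd : 0 < Num.sqrt d%:R :> R by rewrite sqrtr_gt0.
pose c : R := Num.sqrt (d%:R / 2) / n%:R.
have c2 : c ^+ 2 = d%:R / 2 / n%:R ^+ 2 by rewrite expr_div_n sqr_sqrtr ?divr_ge0// ltW.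
pose ch k := \int[P]_w cos (t * c * walk_cross Rs U k w + a).
have ch0 : ch 0%N = cos a.
  rewrite -(Rint_cst P (cos a)); apply: eq_Rintegral => w _.
  by rewrite /walk_cross big_ord0 mulr0 add0r.
pose E := 48 * M ^+ 4 * t ^+ 4 / n%:R ^+ 2 + t ^+ 2 / n%:R ^+ 2 *
  (n%:R * radius_tail Rs M +
   3 * (M ^+ 2 * Num.sqrt n%:R + 2 * n%:R * radius_tail Rs M + 2 * n%:R / Num.sqrt d%:R)).
have step k : (k < n)%N -> `|ch k.+1 - (1 - t ^+ 2 * k%:R / n%:R ^+ 2) * ch k| <= E.
  move=> kn; have := walk_char_step Rs_indep U_indep RU_indep U_unif d_gt0 Rs_law Rs_sq
    (t * c) a (ltnW kn) M0.
  rewrite -/(ch _) -/(ch _) (_ : 2 * (t * c) ^+ 2 * k%:R / d%:R = t ^+ 2 * k%:R / n%:R ^+ 2); last first.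
    by rewrite exprMn c2; field; rewrite !gt_eqF.
  move=> /le_trans; apply; rewrite /E; apply: lerD.
    rewrite le_eqVlt; apply/orP; left; apply/eqP.
    by rewrite exprMn (exprM c 2 2) c2; field; rewrite !gt_eqF.
  rewrite (_ : 2 * (t * c) ^+ 2 / d%:R = t ^+ 2 / n%:R ^+ 2); last first.
    by rewrite exprMn c2; field; rewrite !gt_eqF.
  apply: ler_wpM2l; first by rewrite divr_ge0 ?sqr_ge0.
  apply: lerD; first by rewrite ler_wpM2r ?radius_tail_ge0// ler_nat ltnW.
  rewrite ler_pM2l//; exact: (walk_sq_dev Rs_indep U_indep RU_indep U_unif d_gt0 Rs_law Rs_sq M0 n0 (ltnW kn)).
have ch01 : `|ch 0%N| <= 1 by rewrite ch0 ler_norml cos_geN1 cos_le1.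
have := exp_recursion (sqr_ge0 t) tn n0 ch01 step; rewrite ch0 /ch.
under eq_Rintegral do rewrite -mulrA.
move=> /le_trans; apply; rewrite le_eqVlt; apply/orP; left; apply/eqP.
have -> : 3 * M ^+ 2 / Num.sqrt n%:R = 3 * M ^+ 2 * Num.sqrt n%:R / n%:R.
  by rewrite -[X in _ = _ / X]sn2; field; rewrite gt_eqF.
by rewrite /E; field; rewrite !gt_eqF.
Qed.

End walk_char_bound.

(** * The central limit theorem for the cross terms *)

Lemma cvg_invn0 (R : realType) : (m%:R^-1 : R) @[m --> \oo] --> (0 : R).
Proof.
apply/gtr0_cvgV0; last exact: cvgr_idn.
by near=> m; rewrite ltr0n; near: m; exact: nbhs_infty_gt.
Unshelve. all: by end_near.
Qed.

Lemma cvg_sqrt_invn0 (R : realType) : ((Num.sqrt m%:R)^-1 : R) @[m --> \oo] --> (0 : R).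
Proof.
rewrite -[X in _ --> X](@sqrtr0 R).
under eq_fun do rewrite -sqrtrV//.
by apply: (@cvg_comp _ _ _ (fun m : nat => m%:R^-1 : R) Num.sqrt); [exact: cvg_invn0|exact: sqrt_continuous].
Qed.

Section walk_cross_clt.
Context dT (T : measurableType dT) (R : realType) (P : probability T R)
  (Rs : nat -> {RV P >-> R}) (U : forall d, nat -> {RV P >-> borel_rV R d}) (n : nat -> nat).
Context (Rs_indep : independent_RVs P Rs)
  (U_indep : forall d, (0 < d)%N -> independent_RVs P (U d))
  (RU_indep : forall d, (0 < d)%N -> independent_families P Rs (U d))
  (U_unif : forall d i, (0 < d)%N -> uniform_on_sphere (distribution P (U d i)))
  (Rs_law : forall i A, measurable A -> P (Rs i @^-1` A) = P (Rs 0%N @^-1` A))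
  (Rs_sq : (\int[P]_w (Rs 0%N w ^+ 2)%:E = 1%:E)%E)
  (n_gt0 : forall d, (0 < d)%N -> (0 < n d)%N) (n_cvg : n @ \oo --> \oo).

Lemma walk_cross_sqr d : (0 < d)%N -> L1 P (fun w => walk_cross Rs (U d) (n d) w ^+ 2) /\
  \int[P]_w walk_cross Rs (U d) (n d) w ^+ 2 <= 2 * (n d)%:R ^+ 2 / d%:R.
Proof.
move=> d0; have [] // := walk_moments Rs_indep (U_indep d0) (RU_indep d0)
  (fun i => U_unif i d0) d0 Rs_law Rs_sq (n d).
Qed.

Lemma measurable_scaled_cross (c : nat -> R) d :
  measurable_fun setT (fun w => c d * walk_cross Rs (U d) (n d) w).
Proof. by apply: measurable_funM => //; exact: measurable_walk_cross. Qed.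

Lemma scaled_cross_tail (c : nat -> R) d K : (0 < d)%N -> 0 < K ->
  \int[P]_w \1_[set w | K < `|c d * walk_cross Rs (U d) (n d) w|] w <=
  c d ^+ 2 * (2 * (n d)%:R ^+ 2 / d%:R) / K ^+ 2.
Proof.
move=> d0 K0; have [i2 e2] := walk_cross_sqr d0.
have i : L1 P (fun w => (c d * walk_cross Rs (U d) (n d) w) ^+ 2).
  by under eq_fun do rewrite exprMn; exact: L1Z.
apply: sqr_tail => //; first exact: measurable_scaled_cross.
under eq_Rintegral do rewrite exprMn.
by rewrite RintZ//; apply: ler_wpM2l => //; exact: sqr_ge0.
Qed.

Lemma walk_cross_clt : cvg_in_distribution P
  (fun d w => Num.sqrt (d%:R / 2) / (n d)%:R * walk_cross Rs (U d) (n d) w)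
  (normal_prob 0 1) (idfun : measurableTypeR R -> R).
Proof.
pose c d : R := Num.sqrt (d%:R / 2) / (n d)%:R.
apply: cvg_in_distribution_trig => //.
- by move=> d; exact: (measurable_scaled_cross c).
- exact: measurable_id.
(* The scaled cross term has second moment at most 1, so Chebyshev's inequality at this level gives
   exactly [e]. *)
- move=> e e0; exists (Num.sqrt e)^-1; first by rewrite invr_gt0 sqrtr_gt0.
  near=> d.
  have d0 : (0 < d)%N by near: d; exact: nbhs_infty_gt.
  have d1 : 0 < d%:R :> R by rewrite ltr0n.
  have n0 : 0 < (n d)%:R :> R by rewrite ltr0n n_gt0.
  apply: (le_trans (@scaled_cross_tail c d _ d0 _)); first by rewrite invr_gt0 sqrtr_gt0.
  have s1 : Num.sqrt e ^+ 2 = e by rewrite sqr_sqrtr// ltW.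
  have s2 : Num.sqrt (d%:R / 2) ^+ 2 = d%:R / 2 :> R by rewrite sqr_sqrtr// divr_ge0.
  rewrite exprVn s1 invrK /c expr_div_n s2.
  by rewrite le_eqVlt; apply/orP; left; apply/eqP; field; rewrite !gt_eqF.
move=> t a; rewrite Rint_normal_cos.
have [nV sV] : ((n d)%:R^-1 : R) @[d --> \oo] --> (0 : R) /\
    ((Num.sqrt (n d)%:R)^-1 : R) @[d --> \oo] --> (0 : R).
  by split; [exact: (cvg_comp _ _ n_cvg (@cvg_invn0 R))|exact: (cvg_comp _ _ n_cvg (@cvg_sqrt_invn0 R))].
apply/cvgrPdist_le => e e0; have e3 : 0 < e / 3 by rewrite divr_gt0.
(* [M] is settled before [d] varies: the terms left over carry powers of [M] but vanish as [d]
   grows. *)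
have [M M0 ME] : exists2 M : R, 0 < M & t ^+ 2 * (7 * radius_tail Rs M) <= e / 3.
  have : t ^+ 2 * (7 * radius_tail Rs m%:R) @[m --> \oo] --> t ^+ 2 * (7 * 0).
    by do 2 apply: cvgMr => //; exact: radius_tail_cvg0.
  rewrite !mulr0 => /cvgrPdist_le /(_ _ e3) [m _ mh].
  exists m.+1%:R => //; have := mh m.+1 (leqnSn m); rewrite sub0r normrN.
  exact: le_trans (ler_norm _).
have h1 : (48 * M ^+ 4 + 1) * t ^+ 4 * (n d)%:R^-1 + t ^+ 2 * (3 * M ^+ 2 * (Num.sqrt (n d)%:R)^-1
   + 6 * (Num.sqrt d%:R)^-1) @[d --> \oo] --> (0 : R).
  rewrite (_ : 0 = (48 * M ^+ 4 + 1) * t ^+ 4 * 0 + t ^+ 2 * (3 * M ^+ 2 * 0 + 6 * 0)); last by ring.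
  apply: cvgD; first exact: cvgMr.
  by apply: cvgMr; apply: cvgD; apply: cvgMr => //; exact: cvg_sqrt_invn0.
have h2 : expR (- (t ^+ 2 / 2 * (1 - (n d)%:R^-1))) * cos a @[d --> \oo] --> expR (- (t ^+ 2 / 2)) * cos a.
  apply: cvgMl; rewrite [X in _ --> expR (- X)](_ : _ = t ^+ 2 / 2 * (1 - 0)); last by rewrite subr0 mulr1.
  apply: (@cvg_comp _ _ _ _ expR); last exact: continuous_expR.
  by apply: cvgN; apply: cvgMr; apply: cvgB => //; exact: cvg_cst.
have h3 : \forall d \near \oo, t ^+ 2 <= (n d)%:R.
  have : (n d)%:R @[d --> \oo] --> (+oo%R : set_system R) by exact: (cvg_comp _ _ n_cvg (@cvgr_idn R)).
  by move/cvgryPge; exact.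
near=> d.
have d0 : (0 < d)%N by near: d; exact: nbhs_infty_gt.
have tn : t ^+ 2 <= (n d)%:R by near: d.
have := walk_char_bound Rs_indep (U_indep d0) (RU_indep d0) (fun i => U_unif i d0) d0 Rs_law Rs_sq
  a M0 (n_gt0 d0) tn.
have g1 : `|0 - ((48 * M ^+ 4 + 1) * t ^+ 4 * (n d)%:R^-1 + t ^+ 2 * (3 * M ^+ 2 * (Num.sqrt (n d)%:R)^-1
   + 6 * (Num.sqrt d%:R)^-1))| <= e / 3.
  by near: d; move/cvgrPdist_le : h1; exact.
have g2 : `|expR (- (t ^+ 2 / 2)) * cos a - expR (- (t ^+ 2 / 2 * (1 - (n d)%:R^-1))) * cos a| <= e / 3.
  by near: d; move/cvgrPdist_le : h2; exact.
rewrite sub0r normrN in g1; have := le_trans (ler_norm _) g1.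
set x := \int[P]_w _; set y := expR _ * _ in g2 *; set z := expR _ * _ in g2 *.
move: ME; set r := radius_tail Rs M => ME.
set p := (n d)%:R^-1; set q := (Num.sqrt (n d)%:R)^-1; set u := (Num.sqrt d%:R)^-1.
move=> g1' g3.
have := ler_normB (y - z) (x - z); rewrite (_ : y - z - (x - z) = y - x); last by ring.
have E : (48 * M ^+ 4 + 1) * t ^+ 4 * p + t ^+ 2 * (7 * r + 3 * M ^+ 2 * q + 6 * u) =
  ((48 * M ^+ 4 + 1) * t ^+ 4 * p + t ^+ 2 * (3 * M ^+ 2 * q + 6 * u)) + t ^+ 2 * (7 * r) by ring.
rewrite E in g3; lra.
Unshelve. all: by end_near.
Qed.

End walk_cross_clt.

(** * Growth of the normalizing sequence *)

Section block_independence.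
Context dT (T : measurableType dT) (R : realType) (P : probability T R)
  (Rs : nat -> {RV P >-> R}).

(** Unlike the past, a block may start at a positive index, so that a stretch of later radii can be
    separated from the first ones. *)
Definition block_cylinder (a b : nat) : set (set T) := [set C | exists2 A : nat -> set R,
  forall i, measurable (A i) & C = [set w | forall i, (a <= i < b)%N -> A i (Rs i w)]].

Notation block a b := (g_sigma_algebraType (block_cylinder a b)).

Lemma block_cylinderI a b : setI_closed (block_cylinder a b).
Proof.
move=> _ _ [A mA ->] [B mB ->]; exists (fun i => A i `&` B i) => [i|]; first exact: measurableI.
apply/seteqP; split => w /= => [[h1 h2] i ii|h]; first by split; auto.
by split => i ii; have [] := h i ii.
Qed.

Lemma block_cylinder_measurable a b : block_cylinder a b `<=` measurable.
Proof.
move=> _ [A mA ->].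
have := @measurable_cylinder _ _ T _ (fun i => Rs i : T -> R)
  (fun i => if (a <= i)%N then A i else setT) b.
rewrite (_ : [set w | _] = [set w | forall i, (a <= i < b)%N -> A i (Rs i w)]).
  by apply => // i; case: ifP.
apply/seteqP; split => w /= h i.
  by move=> /andP[ai ib]; have := h i ib; rewrite ai.
by move=> ib; case: ifP => // ai; apply: h; rewrite ai ib.
Qed.

Lemma measurable_block_radius a b i : (a <= i < b)%N ->
  measurable_fun setT (Rs i : block a b -> R).
Proof.
move=> ib _ A mA; rewrite setTI; apply: sub_sigma_algebra.
exists (fun j => if j == i then A else setT) => [j|]; first by case: ifP.
apply/seteqP; split => w /=.
  by move=> wA j _; case: eqP => // ->.
by move=> /(_ i ib); rewrite eqxx.
Qed.

Hypothesis Rs_indep : independent_RVs P Rs.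

Lemma block_independent m n : (m <= n)%N ->
  independent_systems P <<s block_cylinder 0 m >> <<s block_cylinder m n >>.
Proof.
move=> mn; apply: independent_sigma => //.
- exact: block_cylinderI.
- exact: block_cylinderI.
- exact: block_cylinder_measurable.
- exact: block_cylinder_measurable.
have blockE a b (A : nat -> set R) : (forall i, measurable (A i)) ->
    P [set w | forall i, (a <= i < b)%N -> A i (Rs i w)] =
    (\prod_(i <- index_iota a b) P (Rs i @^-1` A i))%E.
  move=> mA; rewrite -Rs_indep ?iota_uniq//; congr (P _).
  by apply/seteqP; split => w /= h i; [rewrite mem_index_iota|rewrite -mem_index_iota]; exact: h.
move=> _ _ [A mA ->] [B mB ->].
pose C i := if (i < m)%N then A i else B i.
have mC i : measurable (C i) by rewrite /C; case: ifP.
rewrite (_ : _ `&` _ = [set w | forall i, (0 <= i < n)%N -> C i (Rs i w)]); last first.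
  apply/seteqP; split => w /=.
    move=> [h1 h2] i ni; rewrite /C; case: ltnP => im; first exact: h1.
    by apply: h2; rewrite im.
  move=> h; split => i.
    by move=> /= im; have := h i (leq_trans im mn); rewrite /C im.
  by move=> /andP[mi ni]; have := h i ni; rewrite /C ltnNge mi.
rewrite !blockE// (@big_cat_nat _ _ _ m)//=; congr (_ * _)%E; apply: eq_big_nat => i.
  by move=> /andP[_ im]; rewrite /C im.
by move=> /andP[mi _]; rewrite /C ltnNge mi.
Qed.

Local Notation pr A := (\int[P]_w \1_A w).

(* The deviation of the first [m] radii is independent of that of the following [n - m]; it
   exceeds [l] in the direction of the sign of the latter with probability at least [p]. *)
Lemma radii_sq_anticoncentration m n (l p : R) : (m <= n)%N ->
  p <= pr [set w | l < radii_sq Rs m w - m%:R] ->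
  p <= pr [set w | radii_sq Rs m w - m%:R < - l] -> 0 <= l ->
  p <= pr [set w | l < `|radii_sq Rs n w - n%:R|].
Proof.
move=> mn; have [k ->] : exists k, (n = m + k)%N by exists (n - m)%N; rewrite subnKC.
move: (leq_addr k m) => {}mn p1 p2 l0.
pose X w := radii_sq Rs m w - m%:R.
pose Y w := \sum_(i < k) Rs (m + i)%N w ^+ 2 - k%:R.
have XY w : radii_sq Rs (m + k) w - (m + k)%:R = X w + Y w.
  by rewrite /X /Y /radii_sq big_split_ord/= natrD; ring.
have mX : measurable_fun setT (X : block 0 m -> R).
  apply: measurable_funB => //; apply: measurable_sum => i; apply: measurable_funX.
  by apply: measurable_block_radius; exact: ltn_ord.
have mY : measurable_fun setT (Y : block m (m + k) -> R).
  apply: measurable_funB => //; apply: measurable_sum => i; apply: measurable_funX.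
  by apply: measurable_block_radius; rewrite leq_addr/= ltn_add2l.
have sX (B : set R) : measurable B -> <<s block_cylinder 0 m >> (X @^-1` B).
  by move=> mB; have := mX measurableT B mB; rewrite setTI.
have sY (B : set R) : measurable B -> <<s block_cylinder m (m + k) >> (Y @^-1` B).
  by move=> mB; have := mY measurableT B mB; rewrite setTI.
have mT a b A : <<s block_cylinder a b >> A -> measurable A.
  by apply: smallest_sub => //; [exact: sigma_algebra_measurable|exact: block_cylinder_measurable].
have ind A B : measurable A -> measurable B ->
    pr (X @^-1` A `&` Y @^-1` B) = pr (X @^-1` A) * pr (Y @^-1` B).
  move=> mA mB; have mA' := mT _ _ _ (sX _ mA); have mB' := mT _ _ _ (sY _ mB).
  apply: EFin_inj; rewrite EFinM !Rint_indic//; last exact: measurableI.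
  exact: (block_independent mn (sX _ mA) (sY _ mB)).
pose A1 := [set x : R | l < x]; pose A2 := [set x : R | x < - l].
pose B1 := [set y : R | 0 <= y]; pose B2 := [set y : R | y < 0].
have mA1 : measurable A1 by rewrite /A1 -set_itvoy.
have mA2 : measurable A2 by rewrite /A2 -set_itvNyo.
have mB1 : measurable B1 by rewrite /B1 -set_itvcy.
have mB2 : measurable B2 by rewrite /B2 -set_itvNyo.
have B12 : pr (Y @^-1` B1) + pr (Y @^-1` B2) = 1.
  rewrite -RintD; [|exact/L1_indic/(mT _ _ _ (sY _ mB1))|exact/L1_indic/(mT _ _ _ (sY _ mB2))].
  rewrite -[RHS](Rint_cst P); apply: eq_Rintegral => w _.
  rewrite !indicE; have [Y0|Y0] := leP 0 (Y w).
    by rewrite mem_set// memNset ?addr0//= /B2/= ltNge Y0.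
  by rewrite memNset ?mem_set ?add0r//= /B1/= leNgt Y0.
have b1 : 0 <= pr (Y @^-1` B1) by apply: Rint_ge0.
have b2 : 0 <= pr (Y @^-1` B2) by apply: Rint_ge0.
apply: (@le_trans _ _ (pr (X @^-1` A1 `&` Y @^-1` B1) + pr (X @^-1` A2 `&` Y @^-1` B2))).
  rewrite !ind//.
  have : p * pr (Y @^-1` B1) <= pr (X @^-1` A1) * pr (Y @^-1` B1) by exact: ler_wpM2r.
  have : p * pr (Y @^-1` B2) <= pr (X @^-1` A2) * pr (Y @^-1` B2) by exact: ler_wpM2r.
  have : p * (pr (Y @^-1` B1) + pr (Y @^-1` B2)) = p by rewrite B12 mulr1.
  lra.
have i1 : L1 P (\1_(X @^-1` A1 `&` Y @^-1` B1) : T -> R).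
  by apply: L1_indic; apply: measurableI; [exact: mT (sX _ mA1)|exact: mT (sY _ mB1)].
have i2 : L1 P (\1_(X @^-1` A2 `&` Y @^-1` B2) : T -> R).
  by apply: L1_indic; apply: measurableI; [exact: mT (sX _ mA2)|exact: mT (sY _ mB2)].
rewrite -RintD//; apply: Rint_le; first exact: L1D.
  apply: L1_indic; apply: measurable_gt_norm; apply: measurable_funB => //.
  exact: measurable_radii_sq.
move=> w; rewrite !indicE.
case: (boolP (w \in _ `&` _)) => [|_]; rewrite ?inE/=.
  move=> [h1 h2]; rewrite /A1 /B1/= in h1 h2.
  rewrite memNset; last by move=> [h3 h4]; rewrite /A2 /B2/= in h3 h4; lra.
  by rewrite mem_set/= ?XY ?ger0_norm; lra.
case: (boolP (w \in _ `&` _)) => [|_]; rewrite ?inE/=; last by rewrite addr0.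
move=> [h1 h2]; rewrite /A2 /B2/= in h1 h2.
by rewrite mem_set/= ?XY ?ltr0_norm; lra.
Qed.

End block_independence.

Section mean_zero.
Context dT (T : measurableType dT) (R : realType) (P : probability T R).

(** The positive part cut at 1: bounded and continuous, it can be tested along convergence in
    distribution, and its mean still detects mass on the positive half-line. *)
Definition cpos (x : R) : R := Num.min 1 (Num.max 0 x).

Lemma cpos01 x : 0 <= cpos x <= 1.
Proof. by rewrite /cpos le_min ler01 le_max lexx ge_min lexx. Qed.

Lemma continuous_cpos : continuous cpos.
Proof.
by move=> x; apply: continuous_min; [exact: cvg_cst|apply: continuous_max; [exact: cvg_cst|exact: cvg_id]].
Qed.

Lemma cpos_le e x : 0 <= e -> cpos x <= e + \1_[set x | e < x] x.
Proof.
move=> e0; have /andP[c0 c1] := cpos01 x; rewrite indicE.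
case: (boolP (x \in _)) => [_|]; first by rewrite /=; lra.
rewrite notin_setE/= => /negP; rewrite -leNgt addr0 => xe.
by rewrite /cpos ge_min ge_max e0 xe orbT.
Qed.

(** A zero mean equates the integrals of the positive and negative parts; if one vanished, so would
    the other, and [V] would be 0 almost surely. *)
Lemma mean_zero_signs (V : T -> R) : measurable_fun setT V -> ('E_P[V] = 0)%E ->
  P [set w | V w = 0] <> 1%E -> 0 < \int[P]_w cpos (V w) /\ 0 < \int[P]_w cpos (- V w).
Proof.
move=> mV; rewrite unlock integralE => EV V0.
pose pos w := Num.max (V w) 0; pose neg w := Num.max (- V w) 0.
have mpos : measurable_fun setT pos by exact: measurable_maxr.
have mneg : measurable_fun setT neg by apply: measurable_maxr => //; exact: measurable_funN.
have pos0 w : 0 <= pos w by rewrite le_max lexx orbT.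
have neg0 w : 0 <= neg w by rewrite le_max lexx orbT.
(* The mean is an extended real: an infinite value of either integral would make the difference
   infinite, so both are finite and equal. *)
have pmE : (\int[P]_w (pos w)%:E = \int[P]_w (neg w)%:E)%E.
  have ip : (0 <= \int[P]_w (pos w)%:E)%E by apply: integral_ge0 => w _; rewrite lee_fin.
  have im : (0 <= \int[P]_w (neg w)%:E)%E by apply: integral_ge0 => w _; rewrite lee_fin.
  move: EV; rewrite (_ : (EFin \o V)^\+%E = EFin \o pos); last first.
    by apply/funext => w; rewrite funeposE /= EFin_max.
  rewrite (_ : (EFin \o V)^\-%E = EFin \o neg); last first.
    by apply/funext => w; rewrite funenegE /= EFin_max EFinN.
  move: ip im; rewrite /=; case: (\int[P]_w _)%E => [a| |]; case: (\int[P]_w _)%E => [b| |] //= _ _.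
  by move=> [] /eqP; rewrite subr_eq0 => /eqP ->.
have ae0 (f : T -> R) : measurable_fun setT f -> (forall x, 0 <= f x) ->
    (\int[P]_x (f x)%:E = 0)%E -> {ae P, forall x, f x = 0}.
  move=> mf f0 h; have : (\int[P]_x `|(f x)%:E| = 0)%E.
    by under eq_integral do rewrite gee0_abs ?lee_fin//.
  move=> /(ae_eq_integral_abs P measurableT ((measurable_EFinP _ _).2 mf)).
  by apply: filterS => x /(_ I) [].
have int0 (f : T -> R) : measurable_fun setT f -> {ae P, forall x, f x = 0} ->
    (\int[P]_x (f x)%:E = 0)%E.
  move=> mf h; rewrite -(integral0 P setT); apply: ae_eq_integral => //.
    exact/measurable_EFinP.
  by apply: filterS h => x -> _.
have ipos : (\int[P]_w (pos w)%:E <> 0)%E.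
  move=> p0; have n0 := esym pmE; rewrite p0 in n0.
  have mV0 : measurable [set w | V w = 0].
    by rewrite -[X in measurable X]setTI; exact: (mV measurableT [set 0] (measurable_set1 _)).
  apply: V0; have : P (~` [set w | V w = 0]) = 0%E.
    apply/negligibleP; first exact: measurableC.
    have : {ae P, forall w, V w = 0}.
      move: (ae0 _ mpos pos0 p0) (ae0 _ mneg neg0 n0); apply: filterS2 => w.
      by rewrite /pos /neg !maxEle; case: ifP; case: ifP; lra.
    by [].
  by move=> h; rewrite -[X in P X]setCK probability_setC ?h ?sube0//; exact: measurableC.
have cposE (f : T -> R) : measurable_fun setT f ->
    ((\int[P]_w (Num.max (f w) 0)%:E)%E <> 0%E) -> 0 < \int[P]_w cpos (f w).
  move=> mf; apply: contra_notP => /negP; rewrite -leNgt => c0.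
  have mc : measurable_fun setT (fun w => cpos (f w)).
    by apply: measurableT_comp => //; apply: continuous_measurable_fun; exact: continuous_cpos.
  have cp0 w : 0 <= cpos (f w) by have /andP[] := cpos01 (f w).
  have {}c0 : (\int[P]_w (cpos (f w))%:E = 0)%E.
    rewrite -EFin_Rintegral; first by congr EFin; apply/eqP; rewrite eq_le c0 Rint_ge0.
    by apply: (@L1_bounded _ _ _ _ _ 1) => // w; have /andP[? ?] := cpos01 (f w); rewrite ger0_norm.
  apply: int0; first exact: measurable_maxr.
  apply: filterS (ae0 _ mc cp0 c0) => w; rewrite /cpos minEle !maxEle; do !case: ifP; lra.
split; first exact: cposE.
by apply: cposE; [exact: measurable_funN|rewrite -pmE].
Qed.

End mean_zero.

(** Doubling gives the power along [2^j N], and the comparison within a factor 2 fills the gaps. The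
    exponent may have either sign, since both [scale] and its inverse are fed to it. *)
Lemma powR_growth (R : realType) (b : nat -> R) (C g : R) (N : nat) : (0 < N)%N ->
  (forall n, (N <= n)%N -> 0 < b n) ->
  (forall m n, (N <= m)%N -> (m <= n)%N -> (n <= 2 * m)%N -> b n <= C * b m) ->
  (forall m, (N <= m)%N -> b (2 * m)%N <= 2 `^ g * b m) ->
  exists2 C' : R, 0 < C' & forall n, (N <= n)%N -> b n <= C' * n%:R `^ g.
Proof.
move=> N0 b0 bC bg.
have bN := b0 N (leqnn N).
have C0 : 0 < C.
  have := bC N N (leqnn N) (leqnn N); rewrite mulSn mul1n leq_addr => /(_ isT) h.
  by have := lt_le_trans bN h; rewrite pmulr_lgt0.
(* The ratio of [n] to the power of two below [n / N] lies between [N] and [2 N]; [D] pays for it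
   whatever the sign of [g]. *)
pose D : R := (2 * N)%:R `^ `|g|.
have D0 : 0 < D by rewrite powR_gt0// ltr0n muln_gt0.
have dyadic j : b (2 ^ j * N)%N <= (2 ^ j)%:R `^ g * b N.
  elim: j => [|j ih]; first by rewrite mul1n powR1 mul1r.
  rewrite expnS -mulnA natrM powRM//.
  apply: (le_trans (bg _ _)); first by rewrite leq_pmull// expn_gt0.
  by rewrite -mulrA ler_wpM2l// powR_ge0.
exists (C * b N * D); first by rewrite !mulr_gt0.
move=> n Nn; have n0 : (0 < n)%N := leq_trans N0 Nn.
have q0 : (0 < n %/ N)%N by rewrite divn_gt0.
pose j := trunc_log 2 (n %/ N).
have /andP[j1 j2] : (2 ^ j <= n %/ N < 2 ^ j.+1)%N by exact: trunc_log_bounds.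
have n1 : (2 ^ j * N <= n)%N by rewrite (leq_trans (leq_mul j1 (leqnn N)))// leq_trunc_div.
have n2 : (n < 2 * (2 ^ j * N))%N by rewrite mulnA -expnS -ltn_divLR.
have jN : (N <= 2 ^ j * N)%N by rewrite leq_pmull// expn_gt0.
apply: (le_trans (bC _ _ jN n1 (ltnW n2))).
rewrite -!mulrA ler_pM2l//; apply: (le_trans (dyadic j)).
rewrite mulrC ler_pM2l// /D; set x := (2 ^ j)%:R.
have x0 : 0 < x :> R by rewrite /x ltr0n expn_gt0.
have [g0|g0] := leP 0 g.
  rewrite (ger0_norm g0); apply: (@le_trans _ _ (n%:R `^ g)).
    by rewrite ge0_ler_powR ?nnegrE// /x ler_nat (leq_trans _ n1)// leq_pmulr.
  rewrite ler_peMl ?powR_ge0// -[leLHS](powRr0 (2 * N)%:R).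
  by rewrite ler_powR// ler1n muln_gt0.
rewrite (ltr0_norm g0).
have e (y : R) : 0 < y -> y `^ g = (y `^ (- g))^-1 by move=> y0; rewrite -powRN opprK.
rewrite (e x)// (e n%:R) ?ltr0n// ler_pdivlMr ?powR_gt0 ?ltr0n//.
rewrite mulrC ler_pdivrMr ?powR_gt0// -powRM//.
apply: ge0_ler_powR; rewrite ?nnegrE ?mulr_ge0 ?oppr_ge0 ?(ltW g0) ?(ltW x0)//.
by rewrite /x -natrM ler_nat -mulnA (mulnC N) ltnW.
Qed.

Section scale.
Context dT (T : measurableType dT) (R : realType) (P : probability T R)
  dz (Tz : measurableType dz) (Pz : probability Tz R) (Rs : nat -> {RV P >-> R})
  (zeta : {RV Pz >-> R}) (alpha : R) (L : R -> R).
Context (Rs_indep : independent_RVs P Rs)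
  (L_sv : slowly_varying L) (zeta_mean : ('E_Pz[zeta] = 0)%E)
  (zeta_nd : Defs.nondegenerate (distribution Pz zeta)).

Definition scale (m : nat) : R := m%:R `^ alpha^-1 * L m%:R.

Context (R_cvg : cvg_in_distribution P
    (fun m w => (radii_sq Rs m w - m%:R) / scale m) Pz zeta).

Let X m w := (radii_sq Rs m w - m%:R) / scale m.

Let mX m : measurable_fun setT (X m).
Proof. by apply: measurable_funM => //; apply: measurable_funB => //; exact: measurable_radii_sq. Qed.

Let mz : measurable_fun setT zeta. Proof. exact: measurable_funP. Qed.

Lemma scale_gt0 : \forall m \near \oo, 0 < scale m.
Proof.
have h : \forall m \near \oo, 0 < L (m%:R : R) by have [h _] := L_sv; exact: (@cvgr_idn R _ h).
near=> m; rewrite mulr_gt0 ?powR_gt0 ?ltr0n//; near: m => //; exact: nbhs_infty_gt.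
Unshelve. all: by end_near.
Qed.

Lemma scale_doubling : scale (2 * m)%N / scale m @[m --> \oo] --> 2 `^ alpha^-1.
Proof.
have [_ /(_ 2 (ltr0Sn _ _)) h2] := L_sv.
have : 2 `^ alpha^-1 * (L (2 * m%:R) / L m%:R) @[m --> \oo] --> 2 `^ alpha^-1 * 1.
  by apply: cvgMr => //; exact: (cvg_comp _ _ (@cvgr_idn R) h2).
rewrite mulr1; apply: cvg_trans; apply: near_eq_cvg.
near=> m; have m0 : (0 < m)%N by near: m; exact: nbhs_infty_gt.
rewrite /scale natrM powRM//; set p := 2 `^ _; set q := _ `^ _.
rewrite (mulrC p q) -(mulrA q) -mulf_div divff ?mul1r ?mulrA//.
by rewrite gt_eqF// powR_gt0// ltr0n.
Unshelve. all: by end_near.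
Qed.

(* Tightness of [X n] bounds [scale m / scale n], since [radii_sq n - n] is as spread out as
   [radii_sq m - m], whose limit law charges both half-lines because it is centered. *)
Lemma scale_quasimonotone : exists C : R, exists2 N : nat, 0 < C &
  forall m n, (N <= m)%N -> (m <= n)%N -> 0 < scale m <= C * scale n.
Proof.
have [c1 c2] := mean_zero_signs mz zeta_mean (zeta_nd (c := 0)).
pose q := Num.min (\int[Pz]_w cpos (zeta w)) (\int[Pz]_w cpos (- zeta w)).
have q0 : 0 < q by rewrite /q lt_min c1 c2.
have q1 : q <= \int[Pz]_w cpos (zeta w) by rewrite /q ge_min lexx.
have q2 : q <= \int[Pz]_w cpos (- zeta w) by rewrite /q ge_min lexx orbT.
(* For large [m] the mean of [cpos] is at least [3 e], and it is at most [e] plus the probability of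
   exceeding [e]; so each sign has probability at least [2 e], against a tail of at most [e] from
   tightness. *)
clearbody q; pose e : R := q / 4; have e0 : 0 < e by rewrite divr_gt0.
have qe : q = 4 * e by rewrite /e; field.
clearbody e.
have cposN : continuous (fun x => cpos (- x : R)).
  by move=> x; apply: (@continuous_comp _ _ _ -%R (@cpos R)); [exact: opp_continuous|exact: continuous_cpos].
have bcpos (y : R) : `|cpos y| <= 1 by have /andP[? ?] := cpos01 y; rewrite ger0_norm.
have cvgX (f : R -> R) : continuous f -> (exists M : R, forall x : R, `|f x| <= M) ->
    \int[P]_w f (X m w) @[m --> \oo] --> \int[Pz]_w f (zeta w).
  by move: f; apply/cvg_in_distributionP.
have tail (s : R) (V : R -> R) : (forall x, V x = s * x) -> continuous (fun x => cpos (V x)) ->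
    q <= \int[Pz]_w cpos (V (zeta w)) ->
    \forall m \near \oo, 2 * e <= \int[P]_w \1_[set w | e < V (X m w)] w.
  move=> VE cV qV.
  have mV : measurable_fun setT V.
    by rewrite (_ : V = fun x => s * x); [exact: measurable_funM|exact/funext].
  have bV : exists M : R, forall x : R, `|cpos (V x)| <= M by exists 1.
  have /cvgrPdist_le /(_ e e0) := cvgX _ cV bV.
  apply: filterS => m; rewrite ler_norml => /andP[_ h].
  have mA : measurable [set w | e < V (X m w)].
    rewrite -[X in measurable X]setTI.
    have := measurable_fun_ltr (measurable_cst e) (measurableT_comp mV (mX m)).
    by move=> /(_ measurableT [set true] I); rewrite (_ : _ @^-1` _ = [set w | e < V (X m w)]).
  have : \int[P]_w cpos (V (X m w)) <= \int[P]_w (e + \1_[set w | e < V (X m w)] w).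
    apply: Rint_le.
    - apply: (@L1_bounded _ _ _ _ _ 1) => // ; apply: measurableT_comp; last exact: measurableT_comp.
      by apply: continuous_measurable_fun; exact: continuous_cpos.
    - by apply: L1D; [exact: L1_cst|exact: L1_indic].
    - by move=> w; exact: cpos_le (ltW e0).
  by rewrite RintD ?Rint_cst; [lra|exact: L1_cst|exact: L1_indic].
have up := tail 1 id (fun x => esym (mul1r x)) (@continuous_cpos R) q1.
have down := tail (-1) -%R (fun x => esym (mulN1r x)) cposN q2.
have [K K0 XK] := tight_of_cvg mX mz R_cvg e0.
have := scale_gt0 => pos.
have [N _ hN] : \forall m \near \oo, [/\ 0 < scale m,
   2 * e <= \int[P]_w \1_[set w | e < X m w] w,
   2 * e <= \int[P]_w \1_[set w | e < - X m w] w &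
   \int[P]_w \1_[set w | K < `|X m w|] w <= e].
  by near=> m; split; near: m.
(* If [scale m] exceeded [K / e * scale n], a deviation beyond [e * scale m] at time [n] would
   exceed [K * scale n], and its probability would be both at least [2 e] and at most [e]. *)
exists (K / e), N; first by rewrite divr_gt0.
move=> m n Nm mn; have [am u d _] := hN m Nm; have [an _ _ t] := hN n (leq_trans Nm mn).
rewrite am/= leNgt; apply/negP => lt.
have uE : [set w | e < X m w] = [set w | e * scale m < radii_sq Rs m w - m%:R].
  by apply/seteqP; split => w /=; rewrite /X ltr_pdivlMr.
have dE : [set w | e < - X m w] = [set w | radii_sq Rs m w - m%:R < - (e * scale m)].
  by apply/seteqP; split => w /=; rewrite /X -(mulNr (radii_sq Rs m w - m%:R)) ltr_pdivlMr// => h; lra.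
rewrite uE in u; rewrite dE in d.
have := radii_sq_anticoncentration Rs_indep mn u d (mulr_ge0 (ltW e0) (ltW am)).
suff : \int[P]_w \1_[set w | e * scale m < `|radii_sq Rs n w - n%:R|] w <=
       \int[P]_w \1_[set w | K < `|X n w|] w by lra.
apply: Rint_le.
- apply: L1_indic; apply: measurable_gt_norm; apply: measurable_funB => //.
  exact: measurable_radii_sq.
- by apply: L1_indic; exact: measurable_gt_norm.
move=> w; rewrite !indicE ler_nat; case: (boolP (w \in _)) => //; rewrite inE/= => h.
rewrite mem_set//= /X normrM normfV (gtr0_norm an) ltr_pdivlMr//.
apply: lt_trans h; move: lt; rewrite mulrAC ltr_pdivrMr//; lra.
Unshelve. all: by end_near.
Qed.

(** The slack [k] absorbs the convergence of the doubling ratio, which then eventually lies between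
    two powers of 2. The lower bound is the growth lemma for the inverse of [scale], where
    quasi-monotonicity reads the other way. *)
Lemma scale_bounds (k : R) : 0 < k -> exists2 C : R, 0 < C &
  \forall m \near \oo, [/\ 0 < scale m, scale m <= C * m%:R `^ (alpha^-1 + k) &
    m%:R `^ (alpha^-1 - k) <= C * scale m].
Proof.
move=> k0; have [C [N1 C0 mono]] := scale_quasimonotone.
have pow2 (x y : R) : x < y -> 2 `^ x < 2 `^ y :> R.
  by move=> xy; rewrite /powR pnatr_eq0/= ltr_expR ltr_pM2r// ln_gt0// ltr1n.
have up : \forall m \near \oo, scale (2 * m)%N / scale m <= 2 `^ (alpha^-1 + k).
  by have /cvgr_le := scale_doubling; apply; apply: pow2; lra.
have down : \forall m \near \oo, 2 `^ (alpha^-1 - k) <= scale (2 * m)%N / scale m.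
  by have /cvgr_ge := scale_doubling; apply; apply: pow2; lra.
have [N _ hN] : \forall m \near \oo, [/\ (0 < m)%N, (N1 <= m)%N, scale (2 * m)%N / scale m <= 2 `^ (alpha^-1 + k) &
    2 `^ (alpha^-1 - k) <= scale (2 * m)%N / scale m].
  by near=> m; split; near: m; [exact: nbhs_infty_gt|exact: nbhs_infty_ge|exact: up|exact: down].
have N0 : (0 < N)%N by have [] := hN N (leqnn N).
have pos m : (N <= m)%N -> 0 < scale m.
  by move=> /hN[_ Nm _ _]; have /andP[] := mono m m Nm (leqnn m).
have mono' m n : (N <= m)%N -> (m <= n)%N -> scale m <= C * scale n.
  by move=> /hN[_ Nm _ _] mn; have /andP[] := mono m n Nm mn.
have up' m : (N <= m)%N -> scale (2 * m)%N <= 2 `^ (alpha^-1 + k) * scale m.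
  by move=> Nm; have [_ _ + _] := hN m Nm; rewrite ler_pdivrMr// pos.
have [C1 C10 h1] : exists2 C1 : R, 0 < C1 & forall m, (N <= m)%N -> scale m <= C1 * m%:R `^ (alpha^-1 + k).
  apply: (@powR_growth R scale (C * 2 `^ (alpha^-1 + k))) => // m n Nm mn n2.
  apply: (le_trans (mono' _ _ (leq_trans Nm mn) n2)); rewrite -mulrA ler_pM2l//; exact: up'.
have [C2 C20 h2] : exists2 C2 : R, 0 < C2 &
    forall m, (N <= m)%N -> (scale m)^-1 <= C2 * m%:R `^ (- (alpha^-1 - k)).
  apply: (@powR_growth R (fun m => (scale m)^-1) C) => // [m Nm|m n Nm mn n2|m Nm].
  - by rewrite invr_gt0 pos.
  - have pm := pos m Nm; have pn := pos n (leq_trans Nm mn).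
    by rewrite ler_pdivlMr// mulrC ler_pdivrMr// mono'.
  - have pm := pos m Nm; have pn : 0 < scale (2 * m)%N by rewrite pos// (leq_trans Nm)// leq_pmull.
    rewrite powRN ler_pdivlMr// mulrC ler_pdivrMr// mulrC ler_pdivlMr ?powR_gt0//.
    by have [_ _ _] := hN m Nm; rewrite ler_pdivlMr// mulrC.
exists (Num.max C1 C2); first by rewrite lt_max C10.
exists N => // m Nm; have pm := pos m Nm; split => //.
  by apply: (le_trans (h1 m Nm)); rewrite ler_wpM2r ?powR_ge0// le_max lexx.
have m0 : 0 < m%:R :> R by rewrite ltr0n (leq_trans N0).
have := h2 m Nm; rewrite powRN ler_pdivlMr ?powR_gt0// mulrC ler_pdivrMr// => /le_trans; apply.
by rewrite ler_wpM2r ?(ltW pm)// le_max lexx orbT.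
Unshelve. all: by end_near.
Qed.

End scale.

(** * The two regimes *)

Lemma cvg_powRN (R : realType) (s : R) : 0 < s -> m%:R `^ (- s) @[m --> \oo] --> (0 : R).
Proof.
move=> s0; have h := powR_cvg0 s0.
have : (m%:R^-1 : R) `^ s @[m --> \oo] --> (0 : R).
  apply: (cvg_comp _ _ _ h) => A [e /= e0 eA].
  have /cvgrPdist_lt /(_ e e0) := @cvg_invn0 R; move: (nbhs_infty_gt 0).
  by apply: filterS2 => m m0 me; apply: eA => //; rewrite invr_gt0 ltr0n.
apply: cvg_trans; apply: near_eq_cvg; near=> m.
by rewrite -mulN1r powRrM powR_inv1.
Unshelve. all: by end_near.
Qed.

Section rates.
Context (R : realType) (a : nat -> R) (n : nat -> nat) (alpha delta : R).
Context (alpha_gt1 : 1 < alpha) (delta_gt0 : 0 < delta) (n_cvg : n @ \oo --> \oo)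
  (a_bounds : forall k, 0 < k -> exists2 C : R, 0 < C &
    \forall m \near \oo, [/\ 0 < a m, a m <= C * m%:R `^ (alpha^-1 + k) &
      m%:R `^ (alpha^-1 - k) <= C * a m]).

Let u : R := 1 - alpha^-1.
Let b : R := alpha / (2 * alpha - 2).

Let u_gt0 : 0 < u. Proof. by have h := alpha_gt1; rewrite subr_gt0 invf_lt1//; lra. Qed.
Let b_gt0 : 0 < b. Proof. by have h := alpha_gt1; rewrite divr_gt0//; lra. Qed.
(** The critical identity: the ratio of the two scales is about [n^u] against [d^(1/2)], and
    [n = d^b] equates them. *)
Let bu : b * u = 2^-1.
Proof.
by have h := alpha_gt1; rewrite /b /u; field; apply/andP; split; rewrite gt_eqF//; lra.
Qed.

Lemma rate_above : (\forall d \near \oo, d%:R `^ (b + delta) < (n d)%:R) ->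
  a (n d) * (Num.sqrt d%:R / (n d)%:R) @[d --> \oo] --> (0 : R).
Proof.
(* Chosen so that the slack [k (b + delta)] eats half of the gain [delta u]; the final exponent of
   [d] is [- delta u / 2]. *)
move=> nd; pose k : R := delta * u / (2 * (b + delta)).
have k0 : 0 < k by rewrite divr_gt0// mulr_gt0// addr_gt0.
have ku : k * (b + delta) = delta * u / 2 by rewrite /k; field; rewrite gt_eqF ?addr_gt0.
have uk : 0 <= u - k.
  rewrite subr_ge0 -(ler_pM2r (addr_gt0 b_gt0 delta_gt0)) ku (mulrDr u).
  have : 0 < u * b by rewrite mulr_gt0.
  have : 0 < u * delta by rewrite mulr_gt0.
  move: u => v; lra.
have [C C0 aC] := a_bounds k0.
have s0 : 0 < delta * u / 2 by rewrite divr_gt0// mulr_gt0.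
have lim : C * d%:R `^ (- (delta * u / 2)) @[d --> \oo] --> (0 : R).
  by rewrite -[X in _ --> X](mulr0 C); apply: cvgMr; exact: cvg_powRN.
apply: (squeeze_cvgr _ (cvg_cst 0) lim).
have := n_cvg aC => nC.
near=> d.
have [a0 aU _] : [/\ 0 < a (n d), a (n d) <= C * (n d)%:R `^ (alpha^-1 + k) &
   (n d)%:R `^ (alpha^-1 - k) <= C * a (n d)] by near: d.
have dn : d%:R `^ (b + delta) < (n d)%:R by near: d.
have d0 : 0 < d%:R :> R by rewrite ltr0n; near: d; exact: nbhs_infty_gt.
have n0 : 0 < (n d)%:R :> R := le_lt_trans (powR_ge0 _ _) dn.
have dneq (x : R) : (d%:R == 0 :> R) ==> (x == 0) by rewrite gt_eqF.
have nneq (x : R) : (n d)%:R `^ x * ((n d)%:R : R)^-1 = (n d)%:R `^ (x - 1).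
  by rewrite -(powR_inv1 (ltW n0)) -powRD//; apply/implyP => _; rewrite gt_eqF.
rewrite mulr_ge0 ?divr_ge0 ?sqrtr_ge0 ?(ltW a0)//=.
apply: (@le_trans _ _ (C * (n d)%:R `^ (alpha^-1 + k) * (Num.sqrt d%:R / (n d)%:R))).
  by rewrite ler_wpM2r// divr_ge0 ?sqrtr_ge0.
rewrite -mulrA ler_pM2l// (mulrC (Num.sqrt _)) mulrA nneq -powR12_sqrt; last exact: ltW.
have -> : alpha^-1 + k - 1 = - (u - k) by rewrite /u; ring.
rewrite powRN.
have : (d%:R `^ (b + delta)) `^ (u - k) <= (n d)%:R `^ (u - k).
  by apply: ge0_ler_powR; rewrite ?nnegrE ?powR_ge0// ltW.
rewrite -powRrM => h.
apply: (@le_trans _ _ ((d%:R `^ ((b + delta) * (u - k)))^-1 * d%:R `^ 2^-1)).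
  rewrite ler_wpM2r ?powR_ge0// lef_pV2// posrE powR_gt0//.
rewrite -powRN -powRD; last by apply/implyP => _; rewrite gt_eqF.
rewrite (_ : _ + _ = - (delta * u / 2))//.
have : (b + delta) * (u - k) = 2^-1 + delta * u - delta * u / 2 by rewrite -ku -bu; ring.
lra.
Unshelve. all: by end_near.
Qed.

Lemma rate_below : (\forall d \near \oo, (n d)%:R < d%:R `^ (b - delta)) ->
  (a (n d))^-1 * ((n d)%:R / Num.sqrt d%:R) @[d --> \oo] --> (0 : R).
Proof.
(* Here the slack enters as [k (b - delta)], at most [k b = delta u / 2], so again half of the gain
   remains. *)
move=> nd; pose k : R := delta * u / (2 * b).
have k0 : 0 < k by rewrite divr_gt0// mulr_gt0.
have kb : k * b = delta * u / 2 by rewrite /k; field; rewrite gt_eqF.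
have [C C0 aC] := a_bounds k0.
have s0 : 0 < delta * u / 2 by rewrite divr_gt0// mulr_gt0.
have lim : C * d%:R `^ (- (delta * u / 2)) @[d --> \oo] --> (0 : R).
  by rewrite -[X in _ --> X](mulr0 C); apply: cvgMr; exact: cvg_powRN.
apply: (squeeze_cvgr _ (cvg_cst 0) lim).
have := n_cvg aC => nC; have := n_cvg (nbhs_infty_gt 0) => npos.
near=> d.
have [a0 _ aL] : [/\ 0 < a (n d), a (n d) <= C * (n d)%:R `^ (alpha^-1 + k) &
   (n d)%:R `^ (alpha^-1 - k) <= C * a (n d)] by near: d.
have dn : (n d)%:R < d%:R `^ (b - delta) by near: d.
have d1 : 1 <= d%:R :> R by rewrite ler1n; near: d; exact: nbhs_infty_gt.
have d0 : 0 < d%:R :> R by lra.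
have n0 : 0 < (n d)%:R :> R by rewrite ltr0n; near: d.
have dneq (x y : R) : (d%:R : R) `^ x * d%:R `^ y = d%:R `^ (x + y).
  by rewrite powRD//; apply/implyP => _; rewrite gt_eqF.
have nneq x y : ((n d)%:R : R) `^ x * (n d)%:R `^ y = (n d)%:R `^ (x + y).
  by rewrite powRD//; apply/implyP => _; rewrite gt_eqF.
rewrite mulr_ge0 ?invr_ge0 ?divr_ge0 ?sqrtr_ge0 ?(ltW a0)//=.
have aV : (a (n d))^-1 <= C * (n d)%:R `^ (- (alpha^-1 - k)).
  by rewrite powRN ler_pdivlMr ?powR_gt0// mulrC ler_pdivrMr.
apply: (@le_trans _ _ (C * (n d)%:R `^ (- (alpha^-1 - k)) * ((n d)%:R / Num.sqrt d%:R))).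
  by rewrite ler_wpM2r// divr_ge0 ?sqrtr_ge0.
rewrite -mulrA ler_pM2l// mulrA -{2}(powRr1 (ltW n0)) nneq -powR12_sqrt; last exact: ltW.
rewrite -powRN (_ : _ + 1 = u + k); last by rewrite /u; ring.
have uk0 : 0 <= u + k by rewrite addr_ge0// ltW.
have : (n d)%:R `^ (u + k) <= (d%:R `^ (b - delta)) `^ (u + k).
  by apply: ge0_ler_powR; rewrite ?nnegrE ?powR_ge0// ltW.
rewrite -powRrM => h.
apply: (@le_trans _ _ (d%:R `^ ((b - delta) * (u + k)) * d%:R `^ (- 2^-1))).
  by rewrite ler_wpM2r ?powR_ge0.
rewrite dneq ler_powR//.
have : (b - delta) * (u + k) = 2^-1 - delta * u + delta * u / 2 - delta * k by rewrite -kb -bu; ring.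
have : 0 < delta * k by rewrite mulr_gt0.
lra.
Unshelve. all: by end_near.
Qed.

End rates.

(** * Assembly of the two regimes *)

Lemma cvg_in_distribution_ae dT dZ (T : measurableType dT) (TZ : measurableType dZ) (R : realType)
    (P : probability T R) (Q : probability TZ R) (X Y : nat -> T -> R) (Z : TZ -> R) :
  (forall n, measurable_fun setT (X n)) -> (forall n, measurable_fun setT (Y n)) ->
  measurable_fun setT Z ->
  (\forall n \near \oo, {ae P, forall w, X n w = Y n w}) ->
  cvg_in_distribution P Y Q Z -> cvg_in_distribution P X Q Z.
Proof.
move=> mX mY mZ XY /cvg_in_distributionP YZ; apply/cvg_in_distributionP => // f cf bf.
apply: cvg_trans (YZ mY mZ f cf bf); apply: near_eq_cvg.
have mf := continuous_measurable_fun cf.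
apply: filterS XY => n h; apply: Rint_ae; [exact: measurableT_comp|exact: measurableT_comp|].
by apply: filterS h => w ->.
Qed.

Theorem theorem3p6 (R : realType)
  (dT : measure_display) (T : measurableType dT) (P : probability T R)
  (d0 : measure_display) (T0 : measurableType d0) (P0 : probability T0 R)
  (dz : measure_display) (Tz : measurableType dz) (Pz : probability Tz R)
  (Rad : {RV P0 >-> R})
  (Rs : nat -> {RV P >-> R})
  (U : forall d : nat, nat -> {RV P >-> borel_rV R d})
  (alpha : R) (L : R -> R) (zeta : {RV Pz >-> R}) (n : nat -> nat)
  (Rad_ge0 : forall w, 0 <= Rad w)
  (Rad_sq : ('E_P0[(fun w => Rad w ^+ 2)%R] = 1)%E)
  (Rs_law : forall (i : nat) (A : set R), measurable A ->
    distribution P (Rs i) A = distribution P0 Rad A)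
  (Rs_indep : independent_RVs P Rs)
  (U_unif : forall d i : nat, (0 < d)%N ->
    uniform_on_sphere (distribution P (U d i)))
  (U_indep : forall d : nat, (0 < d)%N -> independent_RVs P (U d))
  (RU_indep : forall d : nat, (0 < d)%N -> independent_families P Rs (U d))
  (alpha_gt1 : 1 < alpha) (alpha_lt2 : alpha < 2)
  (L_sv : slowly_varying L)
  (zeta_mean : ('E_Pz[zeta] = 0)%E)
  (zeta_stable : alpha_stable alpha (distribution Pz zeta))
  (zeta_pos : spectrally_positive (distribution Pz zeta))
  (R_cvg : cvg_in_distribution P
    (fun m w => (\sum_(i < m) Rs i w ^+ 2 - m%:R)
                  / (m%:R `^ alpha^-1 * L m%:R))
    Pz zeta)
  (n_gt0 : forall d : nat, (0 < d)%N -> (0 < n d)%N)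
  (n_cvg : n @ \oo --> \oo) :
  ((exists2 delta : R, 0 < delta &
      \forall d \near \oo,
        d%:R `^ (alpha / (2 * alpha - 2) + delta) < (n d)%:R) ->
    cvg_in_distribution P
      (fun d w => (enorm (walk Rs (U d) (n d) w) ^+ 2 - (n d)%:R)
                    / Num.sqrt (2 * (n d)%:R ^+ 2 / d%:R))
      (normal_prob 0 1) (idfun : measurableTypeR R -> R)) /\
  ((exists2 delta : R, 0 < delta &
      \forall d \near \oo,
        (n d)%:R < d%:R `^ (alpha / (2 * alpha - 2) - delta)) ->
    cvg_in_distribution P
      (fun d w => (enorm (walk Rs (U d) (n d) w) ^+ 2 - (n d)%:R)
                    / ((n d)%:R `^ alpha^-1 * L (n d)%:R))
      Pz zeta).
Proof.
have law0 i A : measurable A -> P (Rs i @^-1` A) = P (Rs 0%N @^-1` A).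
  by move=> mA; exact: (etrans (Rs_law i A mA) (esym (Rs_law 0%N A mA))).
have Rs_sq : (\int[P]_w (Rs 0%N w ^+ 2)%:E = 1%:E)%E.
  have m2 : measurable_fun setT (fun x : R => (x ^+ 2)%:E).
    by apply/measurable_EFinP; exact: measurable_funX.
  have p2 (x : R) : (0 <= (x ^+ 2)%:E)%E by rewrite lee_fin sqr_ge0.
  rewrite -[RHS]Rad_sq unlock.
  rewrite -[LHS](ge0_integral_distribution (Rs 0%N) m2 p2).
  rewrite -[RHS](ge0_integral_distribution Rad m2 p2).
  by apply: eq_measure_integral => A mA _; exact: Rs_law.
have mz : measurable_fun setT zeta by exact: measurable_funP.
pose X m w := (radii_sq Rs m w - m%:R) / scale alpha L m.
have mX m : measurable_fun setT (X m).
  by apply: measurable_funM => //; apply: measurable_funB => //; exact: measurable_radii_sq.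
have Xz : cvg_in_distribution P X Pz zeta by exact: R_cvg.
have Xnz : cvg_in_distribution P (fun d => X (n d)) Pz zeta.
  by move=> f cf bf; exact: (cvg_comp _ _ n_cvg (Xz f cf bf)).
have mXn d : measurable_fun setT (X (n d)) by [].
have bounds := scale_bounds Rs_indep L_sv zeta_mean zeta_stable.1 Xz.
have pos : \forall d \near \oo, 0 < scale alpha L (n d).
  exact: (n_cvg _ (scale_gt0 alpha L_sv)).
have mW d k : measurable_fun setT (fun w => enorm (walk Rs (U d) k w) ^+ 2).
  by under eq_fun do rewrite enorm_walk; exact: measurable_walk_sq.
have split_ae d (s : R) : (0 < d)%N -> {ae P, forall w,
    (enorm (walk Rs (U d) (n d) w) ^+ 2 - (n d)%:R) / s =
    (radii_sq Rs (n d) w - (n d)%:R) / s + s^-1 * walk_cross Rs (U d) (n d) w}.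
  move=> dp; apply: filterS (walk_sq_ae Rs (fun i => U_unif d i dp) (n d)) => w h.
  by rewrite enorm_walk h; ring.
split => [[delta delta0 nd]|[delta delta0 nd]].
(* The ratio of the stable scale to the Gaussian one: the radial part is [c d * X (n d)], with [c]
   vanishing and [X (n d)] tight. *)
- pose c d : R := scale alpha L (n d) * (Num.sqrt (d%:R / 2) / (n d)%:R).
  have c0 : c @ \oo --> (0 : R).
    have := rate_above alpha_gt1 delta0 n_cvg bounds nd.
    set r : nat -> R := fun d => _ => r0.
    have : r d * Num.sqrt 2^-1 @[d --> \oo] --> 0 * (Num.sqrt 2^-1 : R) by exact: cvgMl.
    rewrite mul0r; apply: cvg_trans; apply: near_eq_cvg.
    by near=> d; rewrite /c /r sqrtrM//; ring.
  apply: (@cvg_in_distribution_ae _ _ _ _ _ _ _ _ (fun d w =>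
    Num.sqrt (d%:R / 2) / (n d)%:R * walk_cross Rs (U d) (n d) w + c d * X (n d) w)).
  + by move=> d; apply: measurable_funM => //; apply: measurable_funB.
  + move=> d; apply: measurable_funD; last exact: measurable_funM.
    by apply: measurable_funM => //; exact: measurable_walk_cross.
  + exact: measurable_id.
  + near=> d.
    have dp : (0 < d)%N by near: d; exact: nbhs_infty_gt.
    have dR : 0 < d%:R :> R by rewrite ltr0n.
    have nR : 0 < (n d)%:R :> R by rewrite ltr0n n_gt0.
    have sp : 0 < scale alpha L (n d) by near: d.
    have sE : (Num.sqrt (2 * (n d)%:R ^+ 2 / d%:R))^-1 = Num.sqrt (d%:R / 2) / (n d)%:R :> R.
      rewrite (_ : 2 * _ / _ = (n d)%:R ^+ 2 * (d%:R / 2)^-1); last by field; rewrite gt_eqF.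
      by rewrite sqrtrM ?sqr_ge0// sqrtr_sqr sqrtrV ?divr_ge0// invfM invrK ger0_norm// mulrC.
    apply: filterS (split_ae d (Num.sqrt (2 * (n d)%:R ^+ 2 / d%:R)) dp) => w ->; rewrite sE /c /X addrC; congr (_ + _).
    by field; rewrite !gt_eqF.
  apply: cvg_in_distributionD0.
  + by move=> d; apply: measurable_funM => //; exact: measurable_walk_cross.
  + by move=> d; exact: measurable_funM.
  + exact: measurable_id.
  + exact: walk_cross_clt.
  + by apply: cvg_in_probability0_scale => //; exact: tight_of_cvg Xnz.
- apply: (@cvg_in_distribution_ae _ _ _ _ _ _ _ _ (fun d w =>
    X (n d) w + (scale alpha L (n d))^-1 * walk_cross Rs (U d) (n d) w)) => //.
  + by move=> d; apply: measurable_funM => //; apply: measurable_funB.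
  + move=> d; apply: measurable_funD => //.
    by apply: measurable_funM => //; exact: measurable_walk_cross.
  + near=> d; apply: split_ae; near: d; exact: nbhs_infty_gt.
  apply: cvg_in_distributionD0 => //.
  + by move=> d; apply: measurable_funM => //; exact: measurable_walk_cross.
  move=> e e0.
  have r0 := rate_below alpha_gt1 delta0 n_cvg bounds nd.
  (* Chebyshev's bound for the cross term divided by the stable scale, whose second moment is at
     most 2 times the square of the rate. *)
  have lim : 2 / e ^+ 2 * ((scale alpha L (n d))^-1 * ((n d)%:R / Num.sqrt d%:R)) ^+ 2
      @[d --> \oo] --> (0 : R).
    rewrite [X in _ --> X](_ : 0 = 2 / e ^+ 2 * (0 * 0)); last by ring.
    by apply: cvgMr; under eq_fun do rewrite expr2; exact: cvgM.
  apply: (squeeze_cvgr _ (cvg_cst 0) lim); near=> d.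
  have dp : (0 < d)%N by near: d; exact: nbhs_infty_gt.
  rewrite Rint_ge0//=.
  apply: (le_trans (@scaled_cross_tail _ _ _ _ _ _ n Rs_indep U_indep RU_indep U_unif law0 Rs_sq
    (fun d => (scale alpha L (n d))^-1) d e dp e0)).
  rewrite le_eqVlt; apply/orP; left; apply/eqP.
  have s2 : Num.sqrt d%:R ^+ 2 = d%:R :> R by rewrite sqr_sqrtr.
  by rewrite !exprMn (exprVn (Num.sqrt _)) s2; ring.
Unshelve. all: by end_near.
Qed.
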